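(* Let $B$ be a local $C^*$-algebra. Then $W(\,\cdot\,,B)$ is a contravariant functor from the category of local $C^*$-algebras (with $*$-homomorphisms) to the category of ordered abelian monoids, where for a $*$-homomorphism $f:A\to A'$ the induced map $W(f,B):W(A',B)\to W(A,B)$ is $[\psi']\mapsto[\psi'\circ f]$.
   Context: A pre-$C^*$-algebra $A$ is a local $C^*$-algebra if there is a family $\{A_i\}_{i\in I}$ of $C^*$-subalgebras of $A$ such that for all $i,j\in I$ there is $k\in I$ with $A_i,A_j\subset A_k$, and $A=\bigcup_{i}A_i$. For such $A$, $M_\infty(A)=\bigcup_nM_n(A)$ is again a local $C^*$-algebra. All ($C^*$- and local $C^*$-)algebras are assumed separable. A c.p.c. order zero map between local $C^*$-algebras is a completely positive contractive linear map $\phi$ with $\phi(a)\phi(b)=0$ whenever $a,b$ are positive and $ab=0$. For c.p.c. order zero maps $\phi,\psi:A\to B$ write $\phi\precsim\psi$ if there is a sequence $(b_n)$ in $B$ with $\|b_n^*\psi(a)b_n-\phi(a)\|\to0$ for every $a\in A$; $\phi\sim\psi$ means $\phi\precsim\psi\precsim\phi$. $W(A,B)$ is the set of $\sim$-classes of c.p.c. order zero maps $A\to M_\infty(B)$, with addition $[\phi]+[\psi]=[\phi\,\hat\oplus\,\psi]$, where $(\phi\,\hat\oplus\,\psi)(a)=\phi(a)\oplus\psi(a)\in M_2(M_\infty(B))\cong M_\infty(B)$, and order $[\phi]\le[\psi]$ iff $\phi\precsim\psi$. Morphisms of ordered abelian monoids are order-preserving monoid homomorphisms. *)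

(* Defs.v *)
From HB Require Import structures.
From mathcomp Require Import all_boot all_order all_algebra.
From mathcomp Require Import complex.
From mathcomp Require Import all_classical all_reals all_analysis.

Set Implicit Arguments.
Unset Strict Implicit.
Unset Printing Implicit Defensive.

Import Order.TTheory GRing.Theory Num.Theory.
Import numFieldNormedType.Exports.

Local Open Scope classical_set_scope.
Local Open Scope ring_scope.

(* MathComp rings are unital, so the product of a (possibly non-unital)
   *-algebra is an additional operation on a module over R[i]. *)
HB.mixin Record isStarAlgebra (R : realType) (A : Type)
    of GRing.Lmodule R[i] A := {
  smul : A -> A -> A;
  star : A -> A;
  smulA : associative smul;
  smulDl : left_distributive smul +%R;
  smulDr : right_distributive smul +%R;
  smulZl : forall (c : R[i]) (x y : A), smul (c *: x) y = c *: smul x y;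
  smulZr : forall (c : R[i]) (x y : A), smul x (c *: y) = c *: smul x y;
  starK : involutive star;
  starD : {morph star : x y / x + y};
  starZ : forall (c : R[i]) (x : A), star (c *: x) = conjc c *: star x;
  starM : forall x y : A, star (smul x y) = smul (star y) (star x)
}.

#[short(type="starAlgType")]
HB.structure Definition StarAlgebra (R : realType) :=
  {A of isStarAlgebra R A & GRing.Lmodule R[i] A}.

Declare Scope star_scope.
Delimit Scope star_scope with star.
Notation "x ** y" := (smul x y)
  (at level 40, left associativity) : star_scope.
Local Open Scope star_scope.

HB.mixin Record isPreCStar (R : realType) (A : Type)
    of StarAlgebra R A & NormedModule R[i] A := {
  norm_smul : forall x y : A, `|x ** y| <= `|x| * `|y|;
  norm_cstar : forall x : A, `|star x ** x| = `|x| ^+ 2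
}.

#[short(type="preCStarType")]
HB.structure Definition PreCStar (R : realType) :=
  {A of isPreCStar R A & StarAlgebra R A & NormedModule R[i] A}.

Definition cstar_subalgebra (R : realType) (A : preCStarType R) (S : set A) :=
  [/\ S 0,
      (forall x y, S x -> S y -> S (x + y)),
      (forall (c : R[i]) x, S x -> S (c *: x)),
      (forall x y, S x -> S y -> S (x ** y)) /\ (forall x, S x -> S (star x)) &
      (forall u : nat -> A, (forall n, S (u n)) -> cauchy (u @ \oo) ->
         exists2 l, S l & u @ \oo --> l)].

HB.mixin Record isLocalCStar (R : realType) (A : Type) of PreCStar R A := {
  local_family : exists (I : Type) (S : I -> set A),
    [/\ (forall i, cstar_subalgebra (S i)),
        (forall i j, exists k, S i `<=` S k /\ S j `<=` S k) &
        \bigcup_i S i = [set: A]];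
  local_separable : exists u : nat -> A, dense (range u)
}.

#[short(type="localCStarType")]
HB.structure Definition LocalCStar (R : realType) :=
  {A of isLocalCStar R A & PreCStar R A}.

Record star_hom (R : realType) (A A' : starAlgType R) := StarHom {
  star_hom_fun :> {linear A -> A'};
  star_homM : forall x y, star_hom_fun (x ** y) = star_hom_fun x ** star_hom_fun y;
  star_homV : forall x, star_hom_fun (star x) = star (star_hom_fun x)
}.

Section star_hom_category.
Variable R : realType.

Definition star_hom_id (A : starAlgType R) : star_hom A A.
Proof. by exists (idfun : {linear A -> A}). Defined.

Definition star_hom_comp (A A' A'' : starAlgType R)
  (g : star_hom A' A'') (f : star_hom A A') : star_hom A A''.
Proof.
exists (g \o f : {linear A -> A''}).
- by move=> x y /=; rewrite !star_homM.
- by move=> x /=; rewrite !star_homV.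
Defined.

End star_hom_category.

Section M_infinity.
Variables (R : realType) (B : starAlgType R).

Lemma star0 : star (0 : B) = 0.
Proof. by apply: (addIr (star (0 : B))); rewrite -starD !add0r. Qed.

Lemma smul0r (x : B) : 0 ** x = 0.
Proof. by apply: (addIr (0 ** x)); rewrite -smulDl !add0r. Qed.

Lemma smulr0 (x : B) : x ** 0 = 0.
Proof. by apply: (addIr (x ** 0)); rewrite -smulDr !add0r. Qed.

Lemma smul_suml n (f : 'I_n -> B) (y : B) :
  (\sum_(i < n) f i) ** y = \sum_(i < n) (f i ** y).
Proof.
apply: (big_morph (fun x => x ** y)); last exact: smul0r.
by move=> a b; rewrite smulDl.
Qed.

Lemma smul_sumr n (f : 'I_n -> B) (y : B) :
  y ** (\sum_(i < n) f i) = \sum_(i < n) (y ** f i).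
Proof.
apply: (big_morph (fun x => y ** x)); last exact: smulr0.
by move=> a b; rewrite smulDr.
Qed.

Lemma star_sum n (f : 'I_n -> B) :
  star (\sum_(i < n) f i) = \sum_(i < n) star (f i).
Proof. exact: (big_morph _ (@starD R B) star0). Qed.

(* M_oo(B), the union of the M_n(B) along the upper left corner embeddings *)
Definition in_corner (n : nat) (x : nat -> nat -> B) :=
  forall i j, (n <= i)%N || (n <= j)%N -> x i j = 0.

Definition finite_mx : {pred nat -> nat -> B} :=
  fun x => `[< exists n, in_corner n x >].

Lemma in_cornerW m n x : (m <= n)%N -> in_corner m x -> in_corner n x.
Proof.
move=> mn xm i j /orP[h|h]; apply: xm; first by rewrite (leq_trans mn h).
by rewrite (leq_trans mn h) orbT.
Qed.

Lemma finite_mx_submod : submod_closed finite_mx.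
Proof.
split; first by apply/asboolP; exists 0%N.
move=> c x y /asboolP[n xn] /asboolP[m ym]; apply/asboolP; exists (maxn n m).
move=> i j h; rewrite !fctE.
rewrite (in_cornerW (leq_maxl n m) xn h) (in_cornerW (leq_maxr n m) ym h).
by rewrite scaler0 addr0.
Qed.

HB.instance Definition _ :=
  GRing.isSubmodClosed.Build R[i] (nat -> nat -> B) finite_mx finite_mx_submod.

Record Minf := MkMinf { mx_of : nat -> nat -> B; _ : mx_of \in finite_mx }.

HB.instance Definition _ := [isSub for mx_of].
HB.instance Definition _ := [Choice of Minf by <:].
HB.instance Definition _ := [SubChoice_isSubLmodule of Minf by <:].

Lemma Minf_corner (x : Minf) : exists n, in_corner n (mx_of x).
Proof. by case: x => x /= /asboolP. Qed.

Lemma Minf_eq (x y : Minf) : (forall i j, mx_of x i j = mx_of y i j) -> x = y.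
Proof. by move=> h; apply: val_inj; apply/funext => i; apply/funext => j; exact: h. Qed.

Definition mk_Minf (f : nat -> nat -> B) (hf : exists n, in_corner n f) : Minf :=
  MkMinf (introT (asboolP _) hf).

Lemma sum_corner n (f : nat -> B) : (forall k, (n <= k)%N -> f k = 0) ->
  \sum_(k \in [set: nat]) f k = \sum_(k < n) f k.
Proof.
move=> f0; rewrite (@fsbig_ord _ _ +%R n f); apply/esym/fsbig_widen => // k [_ /= h].
by apply: f0; rewrite leqNgt; apply/negP.
Qed.

Definition mx_mul (x y : Minf) (i j : nat) : B :=
  \sum_(k \in [set: nat]) (mx_of x i k ** mx_of y k j).

Lemma mx_mulE n (x y : Minf) i j :
  in_corner n (mx_of x) \/ in_corner n (mx_of y) ->
  mx_mul x y i j = \sum_(k < n) (mx_of x i k ** mx_of y k j).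
Proof.
move=> h; apply: sum_corner => k nk; case: h => h.
- by rewrite h ?nk ?orbT// smul0r.
- by rewrite [mx_of y _ _]h ?nk// smulr0.
Qed.

Lemma mx_mul_corner n (x y : Minf) : in_corner n (mx_of x) ->
  in_corner n (mx_of y) -> in_corner n (mx_mul x y).
Proof.
move=> xn yn i j h; rewrite (mx_mulE _ _ (or_introl xn)) big1// => k _.
case/orP: h => h; first by rewrite xn ?h// smul0r.
by rewrite [mx_of y _ _]yn ?h ?orbT// smulr0.
Qed.

Lemma mx_mul_finite (x y : Minf) : exists n, in_corner n (mx_mul x y).
Proof.
have [n xn] := Minf_corner x; have [m ym] := Minf_corner y.
exists (maxn n m); apply: mx_mul_corner.
- exact: in_cornerW (leq_maxl n m) xn.
- exact: in_cornerW (leq_maxr n m) ym.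
Qed.

Definition Minf_mul (x y : Minf) : Minf := mk_Minf (mx_mul_finite x y).

Lemma mx_star_finite (x : Minf) :
  exists n, in_corner n (fun i j => star (mx_of x j i)).
Proof.
have [n xn] := Minf_corner x; exists n => i j h.
by rewrite xn ?star0// orbC.
Qed.

Definition Minf_star (x : Minf) : Minf := mk_Minf (mx_star_finite x).

Lemma Minf_addE (x y : Minf) i j :
  mx_of (x + y) i j = mx_of x i j + mx_of y i j.
Proof. by []. Qed.

Lemma Minf_scaleE c (x : Minf) i j : mx_of (c *: x) i j = c *: mx_of x i j.
Proof. by []. Qed.

Lemma Minf_mulA : associative Minf_mul.
Proof.
move=> x y z; apply: Minf_eq => i j.
have [n xn] := Minf_corner x; have [m zm] := Minf_corner z.
rewrite /= (mx_mulE _ _ (or_introl xn)) (mx_mulE _ _ (or_intror zm)) /=.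
under eq_bigr => k _ do rewrite (mx_mulE _ _ (or_intror zm)) smul_sumr.
under [RHS]eq_bigr => k _ do rewrite (mx_mulE _ _ (or_introl xn)) smul_suml.
rewrite exchange_big /=.
by apply: eq_bigr => k _; apply: eq_bigr => l _; rewrite smulA.
Qed.

Lemma Minf_mulDl : left_distributive Minf_mul +%R.
Proof.
move=> x y z; apply: Minf_eq => i j; rewrite Minf_addE /=.
have [m zm] := Minf_corner z.
rewrite !(mx_mulE _ _ (or_intror zm)) -big_split /=.
by apply: eq_bigr => k _; rewrite -smulDl.
Qed.

Lemma Minf_mulDr : right_distributive Minf_mul +%R.
Proof.
move=> x y z; apply: Minf_eq => i j; rewrite Minf_addE /=.
have [m xm] := Minf_corner x.
rewrite !(mx_mulE _ _ (or_introl xm)) -big_split /=.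
by apply: eq_bigr => k _; rewrite -smulDr.
Qed.

Lemma Minf_mulZl (c : R[i]) x y : Minf_mul (c *: x) y = c *: Minf_mul x y.
Proof.
apply: Minf_eq => i j; rewrite Minf_scaleE /=.
have [m ym] := Minf_corner y.
rewrite !(mx_mulE _ _ (or_intror ym)) scaler_sumr.
by apply: eq_bigr => k _; rewrite -smulZl.
Qed.

Lemma Minf_mulZr (c : R[i]) x y : Minf_mul x (c *: y) = c *: Minf_mul x y.
Proof.
apply: Minf_eq => i j; rewrite Minf_scaleE /=.
have [m xm] := Minf_corner x.
rewrite !(mx_mulE _ _ (or_introl xm)) scaler_sumr.
by apply: eq_bigr => k _; rewrite -smulZr.
Qed.

Lemma Minf_starK : involutive Minf_star.
Proof. by move=> x; apply: Minf_eq => i j /=; rewrite starK. Qed.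

Lemma Minf_starD : {morph Minf_star : x y / x + y}.
Proof. by move=> x y; apply: Minf_eq => i j; rewrite Minf_addE /= -starD. Qed.

Lemma Minf_starZ (c : R[i]) x : Minf_star (c *: x) = conjc c *: Minf_star x.
Proof. by apply: Minf_eq => i j; rewrite Minf_scaleE /= -starZ. Qed.

Lemma Minf_starM x y : Minf_star (Minf_mul x y) = Minf_mul (Minf_star y) (Minf_star x).
Proof.
apply: Minf_eq => i j /=; have [n xn] := Minf_corner x.
have sxn : in_corner n (mx_of (Minf_star x)).
  by move=> k l h /=; rewrite xn ?star0// orbC.
rewrite (mx_mulE _ _ (or_introl xn)) (mx_mulE _ _ (or_intror sxn)) star_sum.
by apply: eq_bigr => k _; rewrite starM.
Qed.

HB.instance Definition _ := isStarAlgebra.Build R Minf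
  Minf_mulA Minf_mulDl Minf_mulDr Minf_mulZl Minf_mulZr
  Minf_starK Minf_starD Minf_starZ Minf_starM.

(* The isomorphism M_2(M_oo(B)) ~ M_oo(B) given by the bijection
   (i, p) |-> 2 i + p from N x {0, 1} to N. *)
Definition mx2_to_mx (m : 'M[Minf]_2) (i j : nat) : B :=
  mx_of (m (inord (odd i)) (inord (odd j))) i./2 j./2.

Lemma mx2_to_mx_finite m : exists n, in_corner n (mx2_to_mx m).
Proof.
have /choice[N mN] : forall pq : 'I_2 * 'I_2,
  exists n, in_corner n (mx_of (m pq.1 pq.2)).
  by move=> pq; exact: Minf_corner.
exists (\max_pq N pq).*2 => i j h; rewrite /mx2_to_mx.
have le_max p : (N p <= \max_pq N pq)%N by exact: leq_bigmax.
by apply: (in_cornerW (le_max _) (mN (_, _))); rewrite !geq_half_double.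
Qed.

Definition Minf_of_mx2 (m : 'M[Minf]_2) : Minf := mk_Minf (mx2_to_mx_finite m).

Definition Minf_dsum (x y : Minf) : Minf :=
  Minf_of_mx2 (\matrix_(p < 2, q < 2)
    if p == q then (if p == ord0 then x else y) else 0).

End M_infinity.

Section Minf_norm.
Variables (R : realType) (B : preCStarType R).

Definition rnorm (A : preCStarType R) (a : A) : R := complex.Re `|a|.

(* The C*-norm of M_oo(B): M_n(B) acts faithfully by adjointable operators on
   the Hilbert B-module B^n, whose inner product is
   <xi, eta> = \sum_k xi_k^* eta_k, and the norm is the operator norm. *)
Definition finite_col (xi : nat -> B) :=
  exists n, forall k, (n <= k)%N -> xi k = 0.

Definition col_norm (xi : nat -> B) : R :=
  Num.sqrt (rnorm (\sum_(k \in [set: nat]) (star (xi k) ** xi k))).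

Definition mx_col (x : Minf B) (xi : nat -> B) (i : nat) : B :=
  \sum_(k \in [set: nat]) (mx_of x i k ** xi k).

Definition Minf_norm (x : Minf B) : R :=
  sup [set col_norm (mx_col x xi) |
        xi in [set xi | finite_col xi /\ col_norm xi <= 1]].

End Minf_norm.

Section order_zero.
Variable R : realType.

Definition positive (A : starAlgType R) (a : A) := exists x : A, a = star x ** x.

(* x = y^* y in the *-algebra M_n(A) *)
Definition mx_positive (A : starAlgType R) n (x : 'M[A]_n) :=
  exists y : 'M[A]_n, x = \matrix_(i, j) \sum_k (star (y k i) ** y k j).

Definition completely_positive (A D : starAlgType R) (phi : A -> D) :=
  forall n (x : 'M[A]_n), mx_positive x -> mx_positive (map_mx phi x).

Definition order_zero (A D : starAlgType R) (phi : A -> D) :=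
  forall a b, positive a -> positive b -> a ** b = 0 -> phi a ** phi b = 0.

(* c.p.c. order zero maps A -> M_oo(B) *)
Record cpc0 (A B : localCStarType R) := Cpc0 {
  cpc0_fun :> {linear A -> Minf B};
  cpc0_cp : completely_positive cpc0_fun;
  cpc0_contractive : forall a, Minf_norm (cpc0_fun a) <= rnorm a;
  cpc0_order_zero : order_zero cpc0_fun
}.

Definition cuntz_le (A B : localCStarType R) (phi psi : cpc0 A B) :=
  exists b : nat -> Minf B, forall a,
    (fun n => Minf_norm (star (b n) ** psi a ** b n - phi a)) @ \oo --> (0 : R).

Definition cuntz_eq (A B : localCStarType R) (phi psi : cpc0 A B) :=
  cuntz_le phi psi /\ cuntz_le psi phi.

Definition W_class (A B : localCStarType R) (phi : cpc0 A B) : set (cpc0 A B) :=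
  [set psi | cuntz_eq psi phi].

Definition W (A B : localCStarType R) : Type :=
  {C : set (cpc0 A B) | exists phi, C = W_class phi}.

Definition W_cl (A B : localCStarType R) (phi : cpc0 A B) : W A B :=
  exist _ (W_class phi) (ex_intro _ phi erefl).

End order_zero.

Record ordered_abelian_monoid (M : Type) := OrderedAbelianMonoid {
  oam_zero : M;
  oam_add : M -> M -> M;
  oam_le : M -> M -> Prop;
  oam_addA : associative oam_add;
  oam_addC : commutative oam_add;
  oam_add0 : left_id oam_zero oam_add;
  oam_le_refl : forall x, oam_le x x;
  oam_le_trans : forall y x z, oam_le x y -> oam_le y z -> oam_le x z;
  oam_le_anti : forall x y, oam_le x y -> oam_le y x -> x = y;
  oam_le_add : forall x y z, oam_le x y -> oam_le (oam_add x z) (oam_add y z)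
}.

Record oam_hom (M N : Type) (SM : ordered_abelian_monoid M)
    (SN : ordered_abelian_monoid N) := OamHom {
  oam_fun :> M -> N;
  oam_hom0 : oam_fun (oam_zero SM) = oam_zero SN;
  oam_homD : forall x y,
    oam_fun (oam_add SM x y) = oam_add SN (oam_fun x) (oam_fun y);
  oam_hom_le : forall x y, oam_le SM x y -> oam_le SN (oam_fun x) (oam_fun y)
}.

(* Main.v *)
Require Import Defs.
From HB Require Import structures.
From mathcomp Require Import all_boot all_order all_algebra.
From mathcomp Require Import complex ring lra zify.
From mathcomp Require Import all_classical all_reals all_analysis.

(* The only substantial points are that the comparison of order zero maps is
   reflexive and transitive and that *-homomorphisms are contractive; the laws
   of the monoid then come from relabelling the indices of matrices.

   For transitivity, an element [d] with [d^* psi(a) d] close to [phi(a)] on a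
   finite set is replaced by [p d], where [p] is an approximation of [pi(f)] for
   the decomposition [psi = h pi] of an order zero map and [f] is an approximate
   unit: the maps [d^* p^* psi(.) p d ~ d^* psi(f . f) d] are then uniformly
   bounded, so that convergence on a dense sequence suffices, and comparison
   may be tested on finite sets, where it is transitive.  The decomposition
   itself is not needed, only the identity [psi(ab) psi(c) = psi(a) psi(bc)],
   which says that a bounded bilinear map vanishing on pairs with zero product
   is balanced; it follows from a partition of unity along the spectrum of [b].

   The underlying C*-algebra theory is derived without Gelfand duality: [h] is
   positive when [h + t] expands norms by [t] for all [t >= 0], and the norm of
   a self-adjoint [g] is, up to sign, an approximate eigenvalue of [g]. *)

Set Implicit Arguments.
Unset Strict Implicit.
Unset Printing Implicit Defensive.

Import Order.TTheory GRing.Theory Num.Theory.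
Import numFieldNormedType.Exports.
Import ComplexField.Normc.

Local Open Scope classical_set_scope.
Local Open Scope complex_scope.
Local Open Scope ring_scope.
Local Open Scope star_scope.

(** * C*-seminorms on unital complex *-algebras *)

(** What makes transitivity delicate is the order of quantifiers. One sequence must serve every [a],
    and when two sequences are composed, the second index has to be chosen after the norm of the
    first factor, which nothing controls. Testing on finite sets removes the conflict; the uniform
    bounds then bring back a single sequence. A structure theorem for order zero maps would require
    multipliers of a completion of M_oo(B). In M_oo(B) no limits of elements and no continuous
    functional calculus are formed: only polynomials occur, notably averages of powers of [1 - k],
    which play the role of the spectral projection at 0. Limits of elements are taken only in
    complete subalgebras of the domain of a map, for Neumann series and for the functions of [b] in
    the partition of unity. Several norm inequalities are first proved with a crude constant, which
    the C*-identity then sharpens, as in the proof of the spectral radius formula. *)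

Section complex_scalars.
Variable R : realType.
Implicit Types (r : R) (c : R[i]).

Lemma normcR r : normc r%:C = `|r|.
Proof. by rewrite /= expr0n addr0 sqrtr_sqr. Qed.

Lemma normci r : normc ('i%C * r%:C : R[i]) = `|r|.
Proof. by rewrite normcM normcR /= expr0n expr1n add0r sqrtr1 mul1r. Qed.

Lemma conjci : conjc ('i%C : R[i]) = - 'i%C.
Proof. by apply/eqP; rewrite eq_complex /= oppr0 !eqxx. Qed.

Lemma conjciM r : conjc ('i%C * r%:C : R[i]) = - ('i%C * r%:C).
Proof. by simpc. Qed.

Lemma normc_ge0 c : 0 <= normc c.
Proof. by case: c => a b; exact: sqrtr_ge0. Qed.

Lemma normc_conj c : normc (conjc c) = normc c.
Proof. by case: c => a b /=; rewrite sqrrN. Qed.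

Lemma le_affine_small (a b C e0 : R) : 0 < e0 ->
  (forall e, 0 < e -> e <= e0 -> a <= b + C * e) -> a <= b.
Proof.
move=> e00 h; apply/ler_addgt0Pr => d d0.
pose e := Num.min e0 (d / (`|C| + 1)).
have C1 : 0 < `|C| + 1 by rewrite ltr_wpDl.
have e_gt0 : 0 < e by rewrite lt_min e00 divr_gt0.
apply: (le_trans (h e e_gt0 _)); first by rewrite ge_min lexx.
rewrite lerD2l; apply: (@le_trans _ _ ((`|C| + 1) * e)).
  by rewrite ler_wpM2r ?(ltW e_gt0)// (le_trans (ler_norm _))// lerDl.
by rewrite mulrC -ler_pdivlMr// ge_min lexx orbT.
Qed.

End complex_scalars.

Section cstar_seminorm.
Variables (R : realType) (U : algType R[i]).

(** Only a seminorm is asked for: on the unitization of an algebra that already has a unit [e], the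
    operator norm kills [1 - e]. No completeness is imposed, as M_oo(B) is in general not
    complete. *)
Record cstar_seminorm (st : U -> U) (N : U -> R) : Prop := CStarSeminorm {
  csK : involutive st;
  csD : {morph st : x y / x + y};
  csZ : forall c x, st (c *: x) = conjc c *: st x;
  csM : forall x y, st (x * y) = st y * st x;
  csnD : forall x y, N (x + y) <= N x + N y;
  csnZ : forall c x, N (c *: x) = normc c * N x;
  csnM : forall x y, N (x * y) <= N x * N y;
  csnC : forall x, N (st x * x) = N x ^+ 2
}.

Variables (st : U -> U) (N : U -> R) (cs : cstar_seminorm st N).
Implicit Types (x y z a b c d h k g u v : U) (r t e mu : R).

Lemma cs0 : st 0 = 0.
Proof. by apply: (addIr (st 0)); rewrite -(csD cs) !add0r. Qed.
Lemma csN x : st (- x) = - st x.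
Proof. by apply: (addrI (st x)); rewrite -(csD cs) !subrr cs0. Qed.
Lemma csB x y : st (x - y) = st x - st y.
Proof. by rewrite (csD cs) csN. Qed.
Lemma cs1 : st 1 = 1.
Proof. by rewrite -[LHS]mulr1 -[X in _ * X](csK cs) -(csM cs) mulr1 (csK cs). Qed.
Lemma csX x n : st (x ^+ n) = st x ^+ n.
Proof. by elim: n => [|n ih]; rewrite ?expr0 ?cs1// exprS (csM cs) ih -exprSr. Qed.
Lemma csZr r x : st (r%:C *: x) = r%:C *: st x.
Proof. by rewrite (csZ cs) conjc_real. Qed.
Lemma cs_sum I (s : seq I) (P : pred I) (F : I -> U) :
  st (\sum_(i <- s | P i) F i) = \sum_(i <- s | P i) st (F i).
Proof. exact: (big_morph _ (csD cs) cs0). Qed.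

Lemma csn0 : N 0 = 0.
Proof. by rewrite -(scale0r (0 : U)) (csnZ cs) normc0 mul0r. Qed.
Lemma csnZr r x : N (r%:C *: x) = `|r| * N x.
Proof. by rewrite (csnZ cs) normcR. Qed.
Lemma csnN x : N (- x) = N x.
Proof.
rewrite -scaleN1r (_ : -1 = (-1 : R)%:C) ?csnZr ?normrN1 ?mul1r//.
by apply/eqP; rewrite eq_complex /= oppr0 !eqxx.
Qed.
Lemma csn_ge0 x : 0 <= N x.
Proof. by have := csnD cs x (- x); rewrite subrr csn0 csnN; lra. Qed.
Hint Resolve csn_ge0 : core.
Lemma csnB x y : N (x - y) <= N x + N y.
Proof. by rewrite -(csnN y) (csnD cs). Qed.
Lemma csnBC x y : N (x - y) = N (y - x).
Proof. by rewrite -csnN opprB. Qed.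
Lemma csn_lower x y : N x - N y <= N (x - y).
Proof. by have := csnD cs (x - y) y; rewrite subrK; lra. Qed.
Lemma csn_lowerD x y : N x - N y <= N (x + y).
Proof. by have := csn_lower x (- y); rewrite opprK csnN. Qed.
Lemma csn_sum I (s : seq I) (P : pred I) (F : I -> U) :
  N (\sum_(i <- s | P i) F i) <= \sum_(i <- s | P i) N (F i).
Proof.
elim/big_rec2 : _ => [|i y1 y2 _ h]; first by rewrite csn0.
by rewrite (le_trans (csnD cs _ _))// lerD2l.
Qed.

Lemma csn_st x : N (st x) = N x.
Proof.
suff H y : N y <= N (st y) by apply/le_anti; rewrite H -{2}(csK cs x) H.
have := csnM cs (st y) y; rewrite (csnC cs) expr2.
have [->|y0] := eqVneq (N y) 0; first by [].
by rewrite ler_pM2r// lt_neqAle eq_sym y0 csn_ge0.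
Qed.
Lemma csn1 : N 1 <= 1.
Proof.
have := csnC cs 1; rewrite cs1 mulr1 expr2.
have [->//|n0] := eqVneq (N 1) 0.
by move/eqP; rewrite -[X in X == _]mulr1 (inj_eq (mulfI n0)) eq_sym => /eqP ->.
Qed.
Lemma csnX x n : (0 < n)%N -> N (x ^+ n) <= N x ^+ n.
Proof.
case: n => // n _; elim: n => [|n ih]; first by rewrite !expr1.
by rewrite exprS [in leRHS]exprS (le_trans (csnM cs _ _))// ler_wpM2l.
Qed.

Definition sa x := st x = x.
Lemma saD x y : sa x -> sa y -> sa (x + y).
Proof. by rewrite /sa (csD cs) => -> ->. Qed.
Lemma saB x y : sa x -> sa y -> sa (x - y).
Proof. by rewrite /sa csB => -> ->. Qed.
Lemma saZ r x : sa x -> sa (r%:C *: x).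
Proof. by rewrite /sa csZr => ->. Qed.
Lemma saX x n : sa x -> sa (x ^+ n).
Proof. by rewrite /sa csX => ->. Qed.
Lemma saA r : sa (r%:C%:A).
Proof. by rewrite /sa csZr cs1. Qed.
Lemma saM x y : sa x -> sa y -> GRing.comm x y -> sa (x * y).
Proof. by rewrite /sa (csM cs) => -> -> ->. Qed.
Lemma saC x : sa (st x * x).
Proof. by rewrite /sa (csM cs) (csK cs). Qed.

Lemma csn_exp2 x n : sa x -> N (x ^+ (2 ^ n)) = N x ^+ (2 ^ n).
Proof.
move=> sx; elim: n => [|n ih]; first by rewrite expn0 !expr1.
by rewrite expnSr !exprM -ih expr2 -{1}(saX (2 ^ n) sx) (csnC cs).
Qed.

(* [z = a + i b] is normal with [z^* z = c ^ 2], and [a] is its real part. *)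
Lemma csn_sqrD_le a b c : sa a -> sa b -> sa c -> GRing.comm a b ->
  c * c = a * a + b * b -> N a <= N c.
Proof.
move=> sa_a sa_b sa_c ab cE.
pose z := a + 'i%C *: b; have stz : st z = a - 'i%C *: b.
  by rewrite /z (csD cs) (csZ cs) sa_a sa_b conjci scaleNr.
have zz : st z * z = c * c.
  rewrite stz /z cE mulrDr !mulrDl -!scalerAr !mulNr -!scalerAl -ab.
  rewrite scalerN scalerA -(expr2 'i%C) sqr_i scaleN1r opprK addrACA.
  by rewrite [- _ + _]addrC addrACA subrr addr0.
have Nz : N z = N c.
  apply/eqP; rewrite -(eqrXn2 (n := 2))//.
  by rewrite -!(csnC cs) zz sa_c.
have : N (2%:R%:C *: a) <= N z + N (st z).
  rewrite (_ : _ *: a = z + st z) ?(csnD cs)//.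
  by rewrite stz /z addrACA subrr addr0 rmorph_nat scaler_nat mulr2n.
by rewrite csnZr csn_st Nz ger0_norm//; lra.
Qed.

(** With [s = i mu], the elements [k + s] and [k - s] are adjoint to each other and commute, so by
    the C*-identity they give the same norm on [x]; their difference is [2 s]. This is the resolvent
    bound off the real axis, without inverses. *)
Lemma csn_resolvent k mu x : sa k -> `|mu| * N x <= N ((k + ('i%C * mu%:C)%:A) * x).
Proof.
move=> sk; set s := ('i%C * mu%:C)%:A.
have sts : st s = - s.
  rewrite /s (csZ cs) cs1 -scaleNr; congr (_ *: _).
  by rewrite conjciM.
have ks : GRing.comm k s by rewrite /GRing.comm -scalerAl -scalerAr mul1r mulr1.
have c2 : (k - s) * (k + s) = (k + s) * (k - s).
  by apply/commrD; apply/commr_sym/commrB => //; exact: commr_sym.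
have eqN : N ((k + s) * x) = N ((k - s) * x).
  apply/eqP; rewrite -(eqrXn2 (n := 2))//; apply/eqP.
  rewrite -!(csnC cs) !(csM cs) (csD cs) csB sk sts opprK -!mulrA.
  by congr (N (_ * _)); rewrite mulrA c2 -mulrA.
have := csnB ((k + s) * x) ((k - s) * x); rewrite -eqN -mulrBl opprB.
rewrite [k + s]addrC addrACA subrr addr0 -mulr2n -scaler_nat.
rewrite /s scalerA -scalerAl mul1r (csnZ cs) normcM normci.
rewrite -(rmorph_nat (real_complex R)) normcR ger0_norm//.
lra.
Qed.
End cstar_seminorm.

(** * Positivity *)

Section real_polynomial_calculus.
Variables (R : realType) (U : algType R[i]).

Definition peval (h : U) : {poly R} -> U :=
  horner_alg h \o map_poly (real_complex R).

HB.instance Definition _ h := GRing.RMorphism.copy (peval h)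
  (horner_alg h \o map_poly (real_complex R)).

Lemma pevalX h : peval h 'X = h.
Proof. by rewrite /peval /= map_polyX horner_algX. Qed.

Lemma pevalC h (r : R) : peval h r%:P = r%:C%:A.
Proof. by rewrite /peval /= map_polyC horner_algC. Qed.

Lemma pevalD h p q : peval h (p + q) = peval h p + peval h q.
Proof. exact: rmorphD. Qed.

Lemma pevalB h p q : peval h (p - q) = peval h p - peval h q.
Proof. exact: rmorphB. Qed.

Lemma pevalM h p q : peval h (p * q) = peval h p * peval h q.
Proof. exact: rmorphM. Qed.

Lemma pevalXn h p n : peval h (p ^+ n) = peval h p ^+ n.
Proof. exact: rmorphXn. Qed.

Lemma peval0 h : peval h 0 = 0.
Proof. exact: rmorph0. Qed.

Lemma peval1 h : peval h 1 = 1.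
Proof. exact: rmorph1. Qed.

Lemma pevalZ h (r : R) p : peval h (r *: p) = r%:C *: peval h p.
Proof. by rewrite -mul_polyC pevalM pevalC -scalerAl mul1r. Qed.

Lemma peval_comm h p q : GRing.comm (peval h p) (peval h q).
Proof. by rewrite /GRing.comm -!pevalM mulrC. Qed.

End real_polynomial_calculus.

Section positivity.
Variables (R : realType) (U : algType R[i]) (st : U -> U) (N : U -> R).
Hypothesis cs : cstar_seminorm st N.
Implicit Types (x y z a b c d h k g u v : U) (r t e mu : R) (p q : {poly R}).

Local Notation sa := (sa st).

Lemma sa_peval h p : sa h -> sa (peval h p).
Proof.
move=> sh; elim/poly_ind: p => [|p r ih]; first by rewrite peval0 /sa (cs0 cs).
rewrite pevalD pevalM pevalX pevalC; apply: (saD cs); last exact: (saA cs).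
by apply: (saM cs) => //; rewrite -{2}(pevalX h); exact: peval_comm.
Qed.

(** Accretivity of left multiplication by [h]. It refers to norms only, so it makes sense before
    spectra or square roots are at hand. *)
Definition cpos h := sa h /\
  forall mu x, 0 <= mu -> N x <= N (x + mu%:C *: (h * x)).

(** Apply the expansion property to [z = x - e h x], for which [z + e h z = x - e^2 h^2 x]. The
    error is of second order in [e], which makes this form stable under sums. *)
Lemma cpos_contract h e x : cpos h -> 0 <= e ->
  N (x - e%:C *: (h * x)) <= (1 + N h ^+ 2 * e ^+ 2) * N x.
Proof.
move=> [sh ph] e0; set z := x - _.
apply: (le_trans (ph e z e0)).
have -> : z + e%:C *: (h * z) = x - (e ^+ 2)%:C *: (h * h * x).
  rewrite /z mulrBr scalerBr addrA subrK -scalerAr scalerA mulrA.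
  by rewrite -rmorphM -expr2.
apply: (le_trans (csnB cs _ _)); rewrite mulrDl mul1r lerD2l (csnZr cs).
rewrite ger0_norm ?sqr_ge0// [leRHS](_ : _ = e ^+ 2 * (N h ^+ 2 * N x)); last by ring.
rewrite ler_wpM2l ?sqr_ge0//.
rewrite (le_trans (csnM cs _ _))// ler_wpM2r ?(csn_ge0 cs)//.
by rewrite expr2 (csnM cs).
Qed.

(** Converse of the previous estimate. With [y = x + mu h x], the vector [(1 + mu / e) x] is the sum
    of [y] and [mu / e] times [x - e h x]; the quadratic error contributes [mu C e N x], which
    disappears with [e]. *)
Lemma cpos_of_contract h C : sa h ->
  (forall e x, 0 < e -> e <= 1 ->
     N (x - e%:C *: (h * x)) <= (1 + C * e ^+ 2) * N x) -> cpos h.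
Proof.
move=> sh H; split=> // mu x mu0; set y := x + _.
apply: (@le_affine_small _ _ _ (mu * C * N x) 1) => // e e0 e1.
have E : (1 + mu / e)%:C *: x = y + (mu / e)%:C *: (x - e%:C *: (h * x)).
  rewrite scalerBr scalerA -rmorphM divfK ?gt_eqF// rmorphD scalerDl scale1r.
  by rewrite /y [_ + (_ - _)]addrC addrA addrAC subrK addrC.
have me0 : 0 <= mu / e by rewrite divr_ge0// ltW.
have := csnD cs y ((mu / e)%:C *: (x - e%:C *: (h * x))).
rewrite -E !(csnZr cs) !ger0_norm ?addr_ge0//.
have := ler_wpM2l me0 (H e x e0 e1).
rewrite mulrA mulrDr mulr1 (_ : mu / e * (C * _) = mu * C * e); last first.
  by field; rewrite gt_eqF.
lra.
Qed.

Lemma cpos_sa h : cpos h -> sa h. Proof. by case. Qed.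

Lemma cpos0 : cpos 0.
Proof.
by split=> [|mu x _]; [exact: (cs0 cs) | rewrite mul0r scaler0 addr0].
Qed.

(** [x - e (h + k) x] is the mean of [x - 2 e h x] and [x - 2 e k x]; hence the detour through
    contraction estimates. *)
Lemma cposD h k : cpos h -> cpos k -> cpos (h + k).
Proof.
move=> ph pk; apply: (@cpos_of_contract _ (2 * (N h ^+ 2 + N k ^+ 2))).
  by apply: (saD cs); apply: cpos_sa.
move=> e x e0 _; have e20 : 0 <= 2 * e by lra.
have := lerD (cpos_contract x ph e20) (cpos_contract x pk e20).
set v := x - _; set w := x - _ => vw.
have vwE : v + w = 2%:C *: (x - e%:C *: ((h + k) * x)).
  rewrite /v /w addrACA -opprD -scalerDr -mulrDl scalerBr scalerA -rmorphM.
  by congr (_ - _); rewrite rmorph_nat scaler_nat.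
have := csnD cs v w; rewrite vwE (csnZr cs) ger0_norm//.
have := csn_ge0 cs x; nra.
Qed.

Lemma cposZ r h : 0 <= r -> cpos h -> cpos (r%:C *: h).
Proof.
move=> r0 [sh ph]; split; first exact: (saZ cs).
move=> mu x mu0; rewrite -scalerAl scalerA -rmorphM.
by apply: ph; rewrite mulr_ge0.
Qed.

Lemma cpos_sum I (s : seq I) (P : pred I) (F : I -> U) :
  (forall i, P i -> cpos (F i)) -> cpos (\sum_(i <- s | P i) F i).
Proof. by move=> h; apply: big_ind => //; [exact: cpos0 | exact: cposD]. Qed.

Lemma algC_comm (c : R[i]) x : c%:A * x = x * c%:A.
Proof. by rewrite -scalerAl mul1r -scalerAr mulr1. Qed.

(* [1 + nu ^ 2 k ^ 2 = (nu k + i) (nu k - i)], and each factor expands norms *)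
Lemma cpos_sqr k : sa k -> cpos (k * k).
Proof.
move=> sk; split; first by apply: (saM cs).
move=> mu x mu0; pose nu := Num.sqrt mu.
have skn : sa (nu%:C *: k) by apply: (saZ cs).
have := csn_resolvent cs 1 x skn; rewrite normr1 mul1r => /le_trans; apply.
set y := _ * x; have := csn_resolvent cs (-1) y skn.
rewrite normrN1 mul1r => /le_trans; apply.
have i1 : 'i%C * 1%:C = 'i%C :> R[i] by exact: mulr1.
have iN1 : 'i%C * (-1)%:C = - 'i%C :> R[i] by rewrite rmorphN mulrN; congr (- _).
rewrite /y i1 iN1 scaleNr.
set w := nu%:C *: k; set s := 'i%C%:A.
have sw : s * w = w * s by exact: algC_comm.
have ss : s * s = -1.
  by rewrite -scalerAl mul1r scalerA -expr2 sqr_i scaleN1r.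
rewrite mulrA mulrDr !mulrBl sw ss opprK addrA subrK mulrDl mul1r [_ + x]addrC.
rewrite (_ : w * w = mu%:C *: (k * k)) ; last first.
  by rewrite /w -scalerAl -scalerAr scalerA -rmorphM -expr2 sqr_sqrtr.
by rewrite -scalerAl.
Qed.

Lemma cpos_approx h : sa h ->
  (forall e, 0 < e -> exists2 g, cpos g & N (h - g) <= e) -> cpos h.
Proof.
move=> sh H; split=> // mu x mu0.
apply: (@le_affine_small _ _ _ (mu * N x) 1) => // e e0 _.
have [g pg hg] := H e e0.
have -> : x + mu%:C *: (h * x) = x + mu%:C *: (g * x) + mu%:C *: ((h - g) * x).
  by rewrite mulrBl scalerBr -addrA; congr (_ + _); rewrite addrC subrK.
have := csn_lowerD cs (x + mu%:C *: (g * x)) (mu%:C *: ((h - g) * x)).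
have := pg.2 mu x mu0; rewrite (csnZr cs) ger0_norm//.
have := csnM cs (h - g) x; have := csn_ge0 cs x.
move=> Nx /le_trans/(_ (ler_wpM2r Nx hg)) /(ler_wpM2l mu0).
rewrite (_ : mu * (e * N x) = mu * N x * e); last by ring.
lra.
Qed.

Lemma cpos_lower h t x : cpos h -> 0 <= t -> t * N x <= N (t%:C *: x + h * x).
Proof.
move=> ph; rewrite le_eqVlt => /predU1P[<-|t0]; first by rewrite mul0r (csn_ge0 cs).
have -> : t%:C *: x + h * x = t%:C *: (x + t^-1%:C *: (h * x)).
  by rewrite scalerDr scalerA -rmorphM divff ?gt_eqF// scale1r.
rewrite (csnZr cs) gtr0_norm// ler_pM2l//; apply: ph.2.
by rewrite invr_ge0 ltW.
Qed.

(* [p ^ 2 + ((1 - p ^ 2) / 2) ^ 2 = ((1 + p ^ 2) / 2) ^ 2] *)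
Lemma peval_amgm g p q : sa g ->
  2 * N (peval g (p * q)) <= N (peval g ((1 + p ^+ 2) * q)).
Proof.
move=> sg; have -> : 2 * N (peval g (p * q)) = N (peval g (2%:P * (p * q))).
  by rewrite mul_polyC pevalZ (csnZr cs) ger0_norm.
apply: (@csn_sqrD_le _ _ _ _ cs _ (peval g ((1 - p ^+ 2) * q)));
  rewrite -?pevalM -?pevalD; [exact: sa_peval..| exact: peval_comm |].
by congr (peval _ _); rewrite (_ : 2%:P = 2); [ring | rewrite rmorph_nat].
Qed.

(** Iterates the preceding inequality with [p = X^(2^j)] for [j < n]; the exponents add up to
    [2^n - 1]. *)
Lemma peval_prod_lower g q n : sa g ->
  2 ^+ n * N (peval g ('X ^+ (2 ^ n).-1 * q)) <=
  N (peval g ((\prod_(j < n) (1 + 'X ^+ (2 ^ j.+1))) * q)).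
Proof.
move=> sg; elim: n q => [|n ih] q.
  by rewrite big_ord0 expn0 expr0 mul1r.
rewrite big_ord_recr /= -mulrA; apply: le_trans (ih _).
rewrite exprSr -mulrA ler_wpM2l ?exprn_ge0//.
rewrite mulrCA expnS mulnC exprM; apply: le_trans (peval_amgm _ _ sg).
rewrite mulrA -exprD (_ : (2 ^ n + (2 ^ n).-1 = (2 ^ n * 2).-1)%N)//.
by have := expn_gt0 2 n; lia.
Qed.

Lemma prod_geometric n : (1 - 'X ^+ 2) * (\prod_(j < n) (1 + 'X ^+ (2 ^ j.+1))) =
  1 - 'X ^+ (2 ^ n.+1) :> {poly R}.
Proof.
elim: n => [|n ih]; first by rewrite big_ord0 expn1 mulr1.
by rewrite big_ord_recr /= mulrA ih [(2 ^ n.+2)%N]expnS mulnC exprM; ring.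
Qed.

(** For [y = g (1 + g^2)(1 + g^4)...(1 + g^(2^n))] the product [(1 - g^2) y] telescopes to
    [g - g^(2^(n+1) + 1)], of norm at most 2, while [N y >= 2^n] because [N (g^(2^n)) = 1]. *)
Lemma sa_approx_eigen1 g e : sa g -> N g = 1 -> 0 < e ->
  exists2 y, 0 < N y & N (y - g * g * y) <= e * N y.
Proof.
move=> sg g1 e0.
have [n hn] : exists n, 2 <= e * 2 ^+ n.
  exists (Num.bound (2 / e)); rewrite mulrC -ler_pdivrMr//.
  have /ltW/le_trans := archi_boundP (divr_ge0 (ler0n R 2) (ltW e0)); apply.
  by rewrite -natrX ler_nat ltnW// ltn_expl.
set P := \prod_(j < n) (1 + 'X ^+ (2 ^ j.+1)) : {poly R}.
have Ny : 2 ^+ n <= N (peval g (P * 'X)).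
  have := peval_prod_lower 'X n sg; rewrite -exprSr prednK ?expn_gt0//.
  by rewrite pevalXn pevalX (csn_exp2 cs)// g1 expr1n mulr1.
exists (peval g (P * 'X)); first by apply: lt_le_trans Ny; rewrite exprn_gt0.
have -> : peval g (P * 'X) - g * g * peval g (P * 'X) =
    g - g ^+ (2 ^ n.+1).+1.
  rewrite [RHS](_ : _ = peval g ('X - 'X ^+ (2 ^ n.+1).+1)); last first.
    by rewrite pevalB pevalXn pevalX.
  rewrite (_ : g * g = peval g ('X * 'X)); last by rewrite pevalM pevalX.
  rewrite -pevalM -pevalB; congr peval.
  by rewrite exprSr -[X in _ = X - _]mul1r -mulrBl -prod_geometric -/P; ring.
apply: (@le_trans _ _ 2); last by apply: (le_trans hn); rewrite ler_wpM2l// ltW.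
apply: (le_trans (csnB cs _ _)); rewrite exprSr g1.
have := csnM cs (g ^+ (2 ^ n.+1)) g; rewrite (csn_exp2 cs)// g1 expr1n mulr1; lra.
Qed.

Lemma sa_approx_eigen g e : sa g -> 0 < N g -> 0 < e ->
  exists2 y, 0 < N y & N ((N g ^+ 2)%:C *: y - g * g * y) <= e * N y.
Proof.
move=> sg g0 e0; set r := N g.
have sg' : sa (r^-1%:C *: g) by exact: (saZ cs).
have g'1 : N (r^-1%:C *: g) = 1.
  by rewrite (csnZr cs) ger0_norm ?invr_ge0 ?ltW// mulVf// gt_eqF.
have e'0 : 0 < e / r ^+ 2 by rewrite divr_gt0// exprn_gt0.
have [y y0 hy] := sa_approx_eigen1 sg' g'1 e'0; exists y => //.
have -> : (r ^+ 2)%:C *: y - g * g * y = (r ^+ 2)%:C *: (y - (r^-1%:C *: g) * (r^-1%:C *: g) * y).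
  rewrite scalerBr -!scalerAl -!scalerAr -!scalerAl !scalerA -!rmorphM.
  by rewrite [X in _ = _ - X%:C *: _](_ : _ = 1) ?scale1r//; field; rewrite gt_eqF.
rewrite (csnZr cs) ger0_norm ?sqr_ge0//.
apply: (le_trans (ler_wpM2l (sqr_ge0 r) hy)).
by rewrite mulrA mulrCA divff ?mulr1// expf_neq0// gt_eqF.
Qed.
End positivity.

(** * Spectral bounds for polynomials in a self-adjoint element *)

Section spectral_bounds.
Variables (R : realType) (U : algType R[i]) (st : U -> U) (N : U -> R).
Hypothesis cs : cstar_seminorm st N.
Implicit Types (x y z a b c d h k g u v w : U) (r t e mu : R) (p q : {poly R}).

Local Notation sa := (sa st).
Local Notation cpos := (cpos st N).
Local Notation cge0 := (csn_ge0 cs).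

(** Otherwise both bounds apply at [l = N g], so that [l^2 - g^2 = (l + g)(l - g)] is bounded below,
    against the approximate eigenvector of [g^2] for the value [N g ^ 2]. *)
Lemma sa_norm_le g t : sa g -> 0 <= t ->
  (forall l, t < l ->
     exists2 K, 0 < K & forall y, K * N y <= N (l%:C *: y + g * y)) ->
  (forall l, t < l ->
     exists2 K, 0 < K & forall y, K * N y <= N (l%:C *: y - g * y)) ->
  N g <= t.
Proof.
move=> sg t0 hp hm; rewrite leNgt; apply/negP => tg.
have g0 : 0 < N g by apply: le_lt_trans tg.
have [K K0 hK] := hp _ tg; have [L L0 hL] := hm _ tg.
have e0 : 0 < K * L / 2 by rewrite !mulr_gt0.
have [y y0 hy] := sa_approx_eigen cs sg g0 e0.
have := hK ((N g)%:C *: y - g * y).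
have -> : (N g)%:C *: ((N g)%:C *: y - g * y) + g * ((N g)%:C *: y - g * y) =
    (N g ^+ 2)%:C *: y - g * g * y.
  by rewrite scalerBr mulrBr -scalerAr scalerA -rmorphM -expr2 mulrA addrA subrK.
have := ler_wpM2l (ltW K0) (hL y).
by move: hy; nra.
Qed.

Lemma cpos_norm_le h t : 0 <= t -> cpos h -> cpos (t%:C%:A - h) -> N h <= t.
Proof.
move=> t0 ph pth; apply: sa_norm_le => //; first exact: cpos_sa ph.
  move=> l tl; exists l; first exact: le_lt_trans tl.
  by move=> y; apply: (cpos_lower cs) => //; apply: ltW; exact: le_lt_trans tl.
move=> l tl; exists (l - t); first by rewrite subr_gt0.
move=> y; have -> : l%:C *: y - h * y = (l - t)%:C *: y + (t%:C%:A - h) * y.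
  by rewrite rmorphB scalerBl mulrBl -scalerAl mul1r addrA subrK.
by apply: (cpos_lower cs) => //; rewrite subr_ge0 ltW.
Qed.

Lemma cpos_norm_sub h t : sa h -> N h <= t -> cpos (t%:C%:A - h).
Proof.
move=> sh ht; have t0 : 0 <= t := le_trans (cge0 h) ht.
split=> [|mu x mu0]; first by apply: (saB cs) => //; exact: (saA cs).
have -> : x + mu%:C *: ((t%:C%:A - h) * x) =
    (1 + mu * t)%:C *: x - mu%:C *: (h * x).
  rewrite mulrBl -scalerAl mul1r scalerBr scalerA rmorphD rmorphM scalerDl.
  by rewrite scale1r addrA.
have := csn_lower cs ((1 + mu * t)%:C *: x) (mu%:C *: (h * x)).
have mt : 0 <= 1 + mu * t by rewrite addr_ge0// mulr_ge0.
rewrite !(csnZr cs) !ger0_norm//.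
have := ler_wpM2l mu0 (le_trans (csnM cs h x) (ler_wpM2r (cge0 x) ht)); lra.
Qed.

Lemma cpos_le_norm h k : cpos h -> cpos (k - h) -> N h <= N k.
Proof.
move=> ph pkh; apply: cpos_norm_le => //; first exact: cge0.
rewrite -[_ - h](subrKA k); apply: (cposD cs) => //.
apply: cpos_norm_sub => //; rewrite -(subrK h k).
by apply: (saD cs); [exact: cpos_sa pkh | exact: cpos_sa ph].
Qed.

Lemma cpos_compl h : cpos h -> N h <= 1 -> N (1 - h) <= 1.
Proof.
move=> ph h1; have ph1 := cpos_norm_sub (cpos_sa ph) h1.
rewrite rmorph1 scale1r in ph1.
apply: cpos_norm_le => //.
by rewrite rmorph1 scale1r opprB addrC subrK.
Qed.

(** By the resolvent bound if [z] is not real, and by the triangle inequality if [z] is large. *)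
Lemma bounded_below_factor h (z : R[i]) : sa h ->
  (complex.Im z != 0) || (N h < normc z) ->
  exists2 K, 0 < K & forall y, K * N y <= N ((h - z%:A) * y).
Proof.
move=> sh /orP[z0|hz].
  exists `|complex.Im z|; first by rewrite normr_gt0.
  move=> y; have -> : h - z%:A =
      (h - (complex.Re z)%:C%:A) + ('i%C * (- complex.Im z)%:C)%:A.
    by rewrite {1}[z]complexE scalerDl opprD addrA rmorphN mulrN scaleNr.
  rewrite -normrN; apply: (csn_resolvent cs).
  by apply: (saB cs) => //; exact: (saA cs).
exists (normc z - N h); first by rewrite subr_gt0.
move=> y; rewrite [(h - _) * y]mulrBl -scalerAl mul1r (csnBC cs).
apply: le_trans (csn_lower cs _ _); rewrite (csnZ cs) mulrBl lerD2l lerN2.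
exact: (csnM cs).
Qed.

Lemma bounded_below_prod h (s : seq R[i]) : sa h ->
  (forall z : R[i], z \in s -> (complex.Im z != 0) || (N h < normc z)) ->
  exists2 K, 0 < K & forall y,
    K * N y <= N (horner_alg h (\prod_(z <- s) ('X - z%:P)) * y).
Proof.
move=> sh; elim: s => [|z s ih] hs.
  by exists 1 => // y; rewrite big_nil rmorph1 !mul1r.
have [|K K0 hK] := ih; first by move=> w ws; apply: hs; rewrite inE ws orbT.
have [|L L0 hL] := bounded_below_factor sh (hs z _); first by rewrite inE eqxx.
exists (L * K); first exact: mulr_gt0.
move=> y; rewrite big_cons rmorphM rmorphB /= horner_algX horner_algC -!mulrA.
by apply: le_trans (hL _); rewrite ler_pM2l.
Qed.

(** Replaces the spectral mapping theorem. If [N g > M] for [g = p(h)], the polynomial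
    [N g ^ 2 - p ^ 2] is positive on [[-r, r]], so each of its complex roots [z] gives a factor
    [h - z] bounded below. Then [N g ^ 2 - g ^ 2] is bounded below too, contradicting the
    approximate eigenvector of [g^2]. *)
Lemma peval_norm_le h r p M : sa h -> N h <= r ->
  (forall t, `|t| <= r -> `|p.[t]| <= M) -> N (peval h p) <= M.
Proof.
move=> sh hr hp; have r0 := le_trans (cge0 h) hr.
have M0 : 0 <= M by apply: le_trans (hp 0 _); rewrite ?normr0.
rewrite leNgt; apply/negP => gM; set g := peval h p in gM.
have g0 := le_lt_trans M0 gM.
pose q := (N g ^+ 2)%:P - p ^+ 2.
have q0 t : `|t| <= r -> 0 < q.[t].
  move=> tr; rewrite !hornerE subr_gt0 -(ger0_norm (sqr_ge0 p.[t])) normrX.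
  by rewrite ltrXn2r// (le_lt_trans (hp t tr)).
have [s qE] := closed_field_poly_normal (map_poly (real_complex R) q).
have [|K K0 hK] := bounded_below_prod (h := h) (s := s) sh.
  move=> z zs; have : root (map_poly (real_complex R) q) z.
    by rewrite qE rootE hornerZ; move: zs; rewrite -root_prod_XsubC => /eqP ->; rewrite mulr0.
  case: (eqVneq (complex.Im z) 0) => [z0|//] zr /=; apply: (le_lt_trans hr).
  have zE : z = (complex.Re z)%:C by rewrite {1}[z]complexE z0 rmorph0 mulr0 addr0.
  rewrite zE normcR ltNge; apply/negP => /q0.
  by move: zr; rewrite zE rootE horner_map fmorph_eq0 => /eqP ->; rewrite ltxx.
set lc := lead_coef _ in qE.
have lc0 : lc != 0.
  rewrite /lc lead_coef_eq0 map_poly_eq0; apply: contraTneq (q0 0 _) => [->|].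
    by rewrite horner0 ltxx.
  by rewrite normr0.
have lcn : 0 < normc lc.
  by rewrite lt_neqAle normc_ge0 andbT eq_sym; apply: contra lc0 => /eqP/eq0_normc ->.
have e0 : 0 < normc lc * K / 2 by rewrite !mulr_gt0.
have [y y0 hy] := sa_approx_eigen cs (sa_peval cs p sh) g0 e0.
have : N ((N g ^+ 2)%:C *: y - g * g * y) = normc lc * N (horner_alg h (\prod_(z <- s) ('X - z%:P)) * y).
  rewrite -(csnZ cs) scalerAl; congr N.
  rewrite (_ : lc *: _ = peval h q).
    by rewrite /q pevalB pevalC pevalXn mulrBl -scalerAl mul1r expr2.
  rewrite /peval /= qE -mul_polyC rmorphM /= horner_algC -scalerAl mul1r//.
move: hy (hK y); rewrite -/g => /[swap] hy /[swap] ->.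
move=> /(le_trans (ler_wpM2l (ltW lcn) hy)).
by have := mulr_gt0 (mulr_gt0 lcn K0) y0; lra.
Qed.

Lemma poly_bounded p r : exists2 M, 0 <= M & forall t, `|t| <= r -> `|p.[t]| <= M.
Proof.
elim/poly_ind: p => [|p c [M M0 hM]].
  by exists 0 => // t _; rewrite horner0 normr0.
exists (M * `|r| + `|c|) => [|t tr]; first by rewrite addr_ge0// mulr_ge0.
rewrite !hornerE (le_trans (ler_normD _ _))// lerD2r normrM ler_pM//.
  exact: hM.
by rewrite (le_trans tr)// ler_norm.
Qed.

(** If [0 <= p <= M] on the interval, then [|M / 2 - p| <= M / 2] there; the resulting norm bound at
    [h] turns into positivity of [M / 2 - (M / 2 - p)]. *)
Lemma peval_cpos h r p : sa h -> N h <= r ->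
  (forall t, `|t| <= r -> 0 <= p.[t]) -> cpos (peval h p).
Proof.
move=> sh hr hp; have [M M0 hM] := poly_bounded p r.
have H : N (peval h ((M / 2)%:P - p)) <= M / 2.
  apply: (peval_norm_le sh hr) => t tr; rewrite !hornerE ler_norml.
  by have := hp t tr; have := hM t tr; rewrite ler_norml => /andP[]; lra.
have := cpos_norm_sub (sa_peval cs ((M / 2)%:P - p) sh) H.
by rewrite pevalB pevalC opprB addrC subrK.
Qed.
End spectral_bounds.

(** * Approximate square roots and the positivity of y^* y *)

Section square_root_iteration.
Variable R : realType.

(* [sqrt_iter n] converges to [1 - sqrt (1 - 'X)]; all coefficients being
   nonnegative, norms are dominated by the values [sqrt_val n] at [1]. *)
Fixpoint sqrt_iter n : {poly R} :=
  if n is m.+1 then 2^-1 *: ('X + sqrt_iter m ^+ 2) else 0.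

Fixpoint sqrt_val n : R :=
  if n is m.+1 then 2^-1 * (1 + sqrt_val m ^+ 2) else 0.

Lemma sqrt_val_bounds n : 0 <= sqrt_val n <= 1.
Proof. by elim: n => [|n /andP[? ?]] /=; [rewrite lexx ler01 | nra]. Qed.

(** A bounded sequence cannot grow by more than [e] at every step. One small increment is all that
    is used later; the limit of the iteration is never formed. *)
Lemma sqrt_val_step e : 0 < e -> exists n, sqrt_val n.+1 - sqrt_val n <= e.
Proof.
move=> e0; apply: contrapT => /forallNP H.
have {}H n : n%:R * e <= sqrt_val n.
  elim: n => [|n ih]; first by rewrite mul0r.
  by have /negP := H n; rewrite -ltNge -natr1 mulrDl mul1r; lra.
have := archi_boundP (divr_ge0 ler01 (ltW e0)); rewrite ltr_pdivrMr// => h.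
have := H (Num.bound (1 / e)); have /andP[_] := sqrt_val_bounds (Num.bound (1 / e)).
lra.
Qed.

End square_root_iteration.

Section positive_elements.
Variables (R : realType) (U : algType R[i]) (st : U -> U) (N : U -> R).
Hypothesis cs : cstar_seminorm st N.
Implicit Types (x y z a b c d h k g w : U) (r t e mu : R) (p q : {poly R}).

Local Notation sa := (sa st).
Local Notation cpos := (cpos st N).
Local Notation cge0 := (csn_ge0 cs).

Lemma sqrt_iter_bounds a n : N a <= 1 ->
  N (peval a (sqrt_iter R n)) <= sqrt_val R n /\
  N (peval a (sqrt_iter R n.+1 - sqrt_iter R n)) <= sqrt_val R n.+1 - sqrt_val R n.
Proof.
move=> a1; elim: n => [|n [ih1 ih2]].
  rewrite /= peval0 (csn0 cs) expr0n/= !addr0 expr0n/= subr0 addr0 pevalZ pevalX.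
  by rewrite (csnZr cs) ger0_norm// subr0 ler_pM2l.
have ih3 : N (peval a (sqrt_iter R n.+1)) <= sqrt_val R n.+1.
  rewrite /= pevalZ (csnZr cs) ger0_norm// ler_pM2l// pevalD pevalX.
  rewrite (le_trans (csnD cs _ _))// lerD// pevalXn expr2.
  rewrite (le_trans (csnM cs _ _))// expr2 ler_pM//; exact: cge0.
split=> //.
have -> : sqrt_iter R n.+2 - sqrt_iter R n.+1 =
    2^-1 *: ((sqrt_iter R n.+1 - sqrt_iter R n) * (sqrt_iter R n.+1 + sqrt_iter R n)).
  by rewrite /= -scalerBr; congr (_ *: _); ring.
have -> : sqrt_val R n.+2 - sqrt_val R n.+1 =
    2^-1 * ((sqrt_val R n.+1 - sqrt_val R n) * (sqrt_val R n.+1 + sqrt_val R n)).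
  by rewrite /=; ring.
rewrite pevalZ (csnZr cs) ger0_norm// ler_pM2l// pevalM.
rewrite (le_trans (csnM cs _ _))// ler_pM//; try exact: cge0.
by rewrite pevalD (le_trans (csnD cs _ _))// lerD.
Qed.

(** With [a = 1 - h] and [Y_n] the iterate at [a], the recursion [2 Y_(n+1) = a + Y_n^2] gives
    exactly [h - (1 - Y_n)^2 = - 2 (Y_(n+1) - Y_n)], so one small increment suffices. *)
Lemma cpos_sqrt_approx h e : cpos h -> N h <= 1 -> 0 < e ->
  exists2 s, sa s & N (h - s * s) <= e.
Proof.
move=> ph h1 e0; have e20 : 0 < e / 2 by rewrite divr_gt0.
have [n hn] := sqrt_val_step e20; pose a := 1 - h.
have sa_a : sa a by apply: (saB cs); [exact: (cs1 cs) | exact: cpos_sa ph].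
have a1 : N a <= 1 by exact: (cpos_compl cs).
exists (peval a (1 - sqrt_iter R n)); first exact: (sa_peval cs).
have -> : h - peval a (1 - sqrt_iter R n) * peval a (1 - sqrt_iter R n) =
    - (2%:C *: peval a (sqrt_iter R n.+1 - sqrt_iter R n)).
  have -> : h = peval a (1 - 'X) by rewrite pevalB peval1 pevalX opprB addrC subrK.
  rewrite -pevalM -pevalB -pevalZ -[RHS]sub0r -(peval0 a) -pevalB.
  congr peval; rewrite /= !scalerBr !scalerA mulfV// scale1r -!mul_polyC.
  by rewrite (_ : 2%:P = 2) ?rmorph_nat//; ring.
rewrite (csnN cs) (csnZr cs) ger0_norm//.
by have [_] := sqrt_iter_bounds n a1; lra.
Qed.

Lemma cpos_sqrt h e : cpos h -> 0 < e -> exists2 s, sa s & N (h - s * s) <= e.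
Proof.
move=> ph e0; pose t := N h + 1.
have t0 : 0 < t by rewrite ltr_wpDl// cge0.
have ph' : cpos (t^-1%:C *: h) by apply: (cposZ cs) => //; rewrite invr_ge0 ltW.
have [|s ss hs] := cpos_sqrt_approx ph' _ (divr_gt0 e0 t0).
  rewrite (csnZr cs) gtr0_norm ?invr_gt0// ler_pdivrMl// mulr1.
  by rewrite lerDl.
exists ((Num.sqrt t)%:C *: s); first exact: (saZ cs).
have -> : h - (Num.sqrt t)%:C *: s * ((Num.sqrt t)%:C *: s) =
    t%:C *: (t^-1%:C *: h - s * s).
  rewrite scalerBr scalerA -rmorphM divff ?gt_eqF// scale1r; congr (_ - _).
  by rewrite -scalerAl -scalerAr scalerA -rmorphM -expr2 sqr_sqrtr// ltW.
by rewrite (csnZr cs) gtr0_norm// mulrC -ler_pdivlMr.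
Qed.

(* [y y^* + y^* y] is a sum of squares, so [y y^* >= - e]; as [y y^*] and
   [y^* y] have the same nonzero spectrum, also [y^* y >= - e]. *)
Lemma csn_le_of_opp_spectrum y e : 0 <= e -> cpos (e%:C%:A - st y * y) ->
  N (st y * y) <= e.
Proof.
(* [a^2 + b^2 = 2 (y y^* + y^* y)], so half of this sum of squares plus [e - y^* y] is
   [e + y y^*]. *)
move=> e0 pe; have pe' : cpos (e%:C%:A + y * st y).
  pose a := y + st y; pose b := 'i%C *: (y - st y).
  have sa_a : sa a by rewrite /sa (csD cs) (csK cs) addrC.
  have sa_b : sa b.
    by rewrite /sa (csZ cs) (csB cs) (csK cs) conjci scaleNr -scalerN opprB.
  have -> : e%:C%:A + y * st y = (2^-1)%:C *: (a * a + b * b) + (e%:C%:A - st y * y).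
    rewrite /a /b -scalerAl -scalerAr scalerA -(expr2 'i%C) sqr_i scaleN1r.
    set P := y * y + st y * st y; set Q := y * st y + st y * y.
    have -> : (y + st y) * (y + st y) = P + Q.
      by rewrite mulrDl !mulrDr [st y * y + _]addrC addrACA.
    have -> : (y - st y) * (y - st y) = P - Q.
      by rewrite mulrBl !mulrBr opprB addrACA -opprD.
    rewrite opprB [P + Q]addrC addrACA subrr addr0.
    rewrite (_ : Q + Q = 2%:C *: Q); last by rewrite rmorph_nat scaler_nat mulr2n.
    by rewrite scalerA -rmorphM mulVf// scale1r /Q addrA [_ + e%:C%:A]addrC addrA addrK.
  by apply: (cposD cs) => //; apply: (cposZ cs); rewrite ?invr_ge0//;
     apply: (cposD cs); exact: (cpos_sqr cs).
apply: (sa_norm_le cs) => //; first exact: (saC cs).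
  move=> l el; have l0 : 0 < l by apply: le_lt_trans el.
  have le0 : 0 < l - e by rewrite subr_gt0.
  have D0 : 0 < l - e + N y ^+ 2 by rewrite ltr_wpDr ?sqr_ge0.
  (* The constant results from eliminating [N (y w)] between [(l - e) N (y w) <= N y N v] and
     [l N w <= N v + N y N (y w)], where [v = l w + y^* y w]. *)
  exists ((l - e) * l / (l - e + N y ^+ 2)); first by rewrite divr_gt0// mulr_gt0.
  move=> w; rewrite mulrAC ler_pdivrMr//; set v := _ *: w + _.
  have h1 : (l - e) * N (y * w) <= N y * N v.
    have := cpos_lower cs (y * w) pe' (ltW le0).
    have -> : (l - e)%:C *: (y * w) + (e%:C%:A + y * st y) * (y * w) = y * v.
      rewrite rmorphB scalerBl mulrDl -scalerAl mul1r addrA subrK /v mulrDr.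
      by rewrite -scalerAr !mulrA.
    by move/le_trans; apply; exact: (csnM cs).
  have h2 : l * N w <= N v + N y * N (y * w).
    have vE : l%:C *: w = v - st y * y * w by rewrite /v addrK.
    have := csnB cs v (st y * y * w); rewrite -vE (csnZr cs) gtr0_norm// -mulrA.
    have := csnM cs (st y) (y * w); rewrite (csn_st cs); lra.
  have := cge0 y; nra.
move=> l el; exists (l - e); first by rewrite subr_gt0.
move=> w; have -> : l%:C *: w - st y * y * w =
    (l - e)%:C *: w + (e%:C%:A - st y * y) * w.
  by rewrite rmorphB scalerBl mulrBl -scalerAl mul1r addrA subrK.
by apply: (cpos_lower cs) => //; rewrite subr_ge0 ltW.
Qed.

(** For [t >= 0] the stronger bound [(1 - t)^n (1 + n t) <= 1] passes through the induction, since
    [(1 - t)(1 + (n + 1) t) <= 1 + n t]. For [t < 0] the left side is at most 0. *)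
Lemma one_minus_expn_le (n : nat) t : `|t| <= 1 -> n%:R * (t * (1 - t) ^+ n) <= 1.
Proof.
rewrite ler_norml => /andP[t1 t2].
have u0 : 0 <= (1 - t) ^+ n by rewrite exprn_ge0// subr_ge0.
have [tn|tp] := ltP t 0.
  by apply: (@le_trans _ _ 0) => //; rewrite mulr_ge0_le0// mulr_le0_ge0// ltW.
have H : (1 - t) ^+ n * (1 + n%:R * t) <= 1.
  elim: n {u0} => [|n ih]; first by rewrite expr0 mul0r addr0 mul1r.
  apply: le_trans ih; rewrite exprSr -mulrA ler_wpM2l ?exprn_ge0 ?subr_ge0//.
  by rewrite -natr1; have := ler0n R n; nra.
nra.
Qed.

(* With [y = x (1 - h) ^ n], the element [y^* y = h (1 - h) ^ 2n] is at most
   [1 / 2n], hence small, while [h - y^* y >= 0]. *)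
Lemma cposC1 x : N x <= 1 -> cpos (st x * x).
Proof.
move=> x1; set h := st x * x.
have sh : sa h by exact: (saC cs).
have h1 : N h <= 1 by rewrite (csnC cs) expr_le1// cge0.
apply: (cpos_approx cs) => // e e0.
have [n ne] : exists n : nat, 1 <= (n.*2)%:R * e.
  exists (Num.bound (1 / e)); rewrite -ler_pdivrMr//.
  have /ltW/le_trans := archi_boundP (divr_ge0 ler01 (ltW e0)); apply.
  by rewrite ler_nat -addnn leq_addr.
have nneg (t : R) : `|t| <= 1 -> 0 <= (1 - t) ^+ n.*2.
  by move=> t1; rewrite -mul2n exprM exprn_ge0// sqr_ge0.
pose y := x * peval h ((1 - 'X) ^+ n).
have yy : st y * y = peval h ('X * (1 - 'X) ^+ n.*2).
  rewrite /y (csM cs) (sa_peval cs)// -!mulrA (mulrA (st x)) -/h.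
  rewrite -{2}(pevalX h) -!pevalM; congr peval.
  by rewrite -addnn exprD; ring.
have ye : N (st y * y) <= e.
  apply: csn_le_of_opp_spectrum; first exact: ltW.
  rewrite yy -(pevalC h) -pevalB; apply: (peval_cpos cs sh h1) => t t1.
  rewrite !hornerE subr_ge0.
  have := one_minus_expn_le n.*2 t1; set T := t * _ => hT.
  have n0 : 0 < n.*2%:R :> R.
    by rewrite lt_neqAle ler0n andbT; apply: contraTneq ne => <-; rewrite mul0r -ltNge.
  by rewrite -(ler_pM2l n0) (le_trans hT).
exists (peval h ('X - 'X * (1 - 'X) ^+ n.*2)).
  apply: (peval_cpos cs sh h1) => t t1.
  rewrite !hornerE.
  (* [t (1 - (1 - t)^(2n))] is nonnegative because both factors change sign at 0. *)
  have [t0|t0] := leP 0 t.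
    rewrite subr_ge0 ler_piMr// exprn_ile1//; move: t1; rewrite ler_norml; lra.
  suff : 1 <= (1 - t) ^+ n.*2 by nra.
  by rewrite exprn_ege1//; lra.
by rewrite pevalB pevalX opprB addrC subrK -yy.
Qed.

Lemma cposC x : cpos (st x * x).
Proof.
pose t := N x + 1; have t0 : 0 < t by rewrite ltr_wpDl// cge0.
have := cposC1 (x := t^-1%:C *: x); rewrite (csnZr cs) gtr0_norm ?invr_gt0//.
rewrite ler_pdivrMl// mulr1 lerDl ler01 => /(_ isT) /(cposZ cs (sqr_ge0 t)).
rewrite (csZr cs) -scalerAl -scalerAr !scalerA -!rmorphM.
by rewrite [X in X%:C *: _](_ : _ = 1) ?scale1r//; field; rewrite gt_eqF.
Qed.

Lemma cpos_conj c g : cpos g -> cpos (st c * g * c).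
Proof.
move=> pg; have sg := cpos_sa pg.
have scg : sa (st c * g * c) by rewrite /sa !(csM cs) (csK cs) sg mulrA.
apply: (cpos_approx cs) => // e e0.
have D0 : 0 < N c ^+ 2 + 1 by rewrite ltr_wpDl ?sqr_ge0.
have [s ss hs] := cpos_sqrt pg (divr_gt0 e0 D0).
exists (st (s * c) * (s * c)); first exact: cposC.
have -> : st c * g * c - st (s * c) * (s * c) = st c * (g - s * s) * c.
  by rewrite (csM cs) ss mulrBr mulrBl !mulrA.
apply: (le_trans (csnM cs _ _)); apply: (le_trans (ler_wpM2r (cge0 _) (csnM cs _ _))).
rewrite (csn_st cs) mulrAC -expr2.
apply: (le_trans (ler_wpM2l (sqr_ge0 _) hs)).
rewrite mulrCA ler_piMr ?(ltW e0)// ler_pdivrMr// mul1r lerDl//.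
Qed.

(** The Hilbert module argument: the positive elements [sum |s^-1 u_i a - v_i|^2] and
    [s^-2 a^* (s - H) a] add up to [G - s^-1 a^* a], whence [N a ^ 2 <= s N G]. Taking [s = N H + e]
    avoids dividing by a vanishing [N H]. *)
Lemma csn_cauchy_schwarz I (r : seq I) (u v : I -> U) :
  N (\sum_(i <- r) st (u i) * v i) ^+ 2 <=
  N (\sum_(i <- r) st (u i) * u i) * N (\sum_(i <- r) st (v i) * v i).
Proof.
set a := \sum_(i <- r) _; set H := \sum_(i <- r) _; set G := \sum_(i <- r) _.
apply: (@le_affine_small _ _ _ (N G) 1) => // e e0 _.
pose s := N H + e; have s0 : 0 < s by rewrite ltr_wpDl// cge0.
have sH : cpos H by apply: (cpos_sum cs) => i _; exact: cposC.
have p1 : cpos ((s^-1 ^+ 2)%:C *: (st a * (s%:C%:A - H) * a)).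
  apply: (cposZ cs); rewrite ?sqr_ge0//; apply: cpos_conj.
  by apply: (cpos_norm_sub cs); [exact: cpos_sa sH | rewrite lerDl ltW].
have p2 : cpos (\sum_(i <- r) st (s^-1%:C *: (u i * a) - v i) * (s^-1%:C *: (u i * a) - v i)).
  by apply: (cpos_sum cs) => i _; exact: cposC.
have saE : st a = \sum_(i <- r) st (v i) * u i.
  by rewrite (cs_sum cs); apply: eq_bigr => i _; rewrite (csM cs) (csK cs).
have E : \sum_(i <- r) st (s^-1%:C *: (u i * a) - v i) * (s^-1%:C *: (u i * a) - v i) =
    (s^-1 ^+ 2)%:C *: (st a * H * a) - s^-1%:C *: (st a * a) - s^-1%:C *: (st a * a) + G.
  transitivity (\sum_(i <- r) ((s^-1 ^+ 2)%:C *: (st a * (st (u i) * u i) * a)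
      - s^-1%:C *: (st a * (st (u i) * v i)) - s^-1%:C *: ((st (v i) * u i) * a)
      + st (v i) * v i)).
    apply: eq_bigr => i _; rewrite (csB cs) (csZr cs) (csM cs) mulrBl !mulrBr opprB.
    rewrite -!scalerAl -!scalerAr scalerA -rmorphM -expr2 !mulrA addrA.
    by rewrite -!addrA; congr (_ + (_ + _)); rewrite addrC.
  rewrite big_split /= !sumrB -!scaler_sumr.
  by rewrite -!mulr_suml -!mulr_sumr -saE.
have := cposD cs p1 p2; rewrite E.
have -> : (s^-1 ^+ 2)%:C *: (st a * (s%:C%:A - H) * a) +
   ((s^-1 ^+ 2)%:C *: (st a * H * a) - s^-1%:C *: (st a * a) - s^-1%:C *: (st a * a) + G)
   = G - s^-1%:C *: (st a * a).
  rewrite mulrBr mulrBl -scalerAr mulr1 -scalerAl scalerBr scalerA -rmorphM.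
  rewrite (_ : s^-1 ^+ 2 * s = s^-1); last by field; rewrite gt_eqF.
  by rewrite !addrA subrK subrr sub0r addrC.
move=> /(cpos_le_norm cs (cposZ cs _ (cposC a))).
rewrite invr_ge0 (ltW s0) => /(_ isT).
rewrite (csnZr cs) gtr0_norm ?invr_gt0// (csnC cs) ler_pdivrMl//.
by rewrite /s mulrDl [N G * e]mulrC.
Qed.

Lemma csn_sum_sqr_ge (I : eqType) (r : seq I) (u : I -> U) i : i \in r ->
  N (u i) ^+ 2 <= N (\sum_(i <- r) st (u i) * u i).
Proof.
move=> ir; rewrite -(csnC cs); apply: (cpos_le_norm cs); first exact: cposC.
elim: r ir => // j r ih; rewrite inE big_cons => /predU1P[->|ir].
  by rewrite addrC addKr; apply: (cpos_sum cs) => k _; exact: cposC.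
by rewrite -addrA; apply: (cposD cs); [exact: cposC | exact: ih].
Qed.

(* [1 - e] is the average of the powers [(1 - k) ^ j], so that
   [k (1 - e) = (1 - (1 - k) ^ n) / n]. *)
Definition ergodic_mean n : {poly R} := n.+1%:R^-1 *: \sum_(j < n.+1) (1 - 'X) ^+ j.

Lemma ergodic_mean_norm k n : cpos k -> N k <= 1 -> N (peval k (ergodic_mean n)) <= 1.
Proof.
move=> pk k1; have h1 := cpos_compl cs pk k1.
rewrite pevalZ (csnZr cs) ger0_norm ?invr_ge0// ler_pdivrMl// mulr1.
have -> : peval k (\sum_(j < n.+1) (1 - 'X) ^+ j) = \sum_(j < n.+1) (1 - k) ^+ j.
  rewrite (big_morph _ (pevalD k) (peval0 k)); apply: eq_bigr => j _.
  by rewrite pevalXn pevalB peval1 pevalX.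
apply: (le_trans (csn_sum cs _ _ _)).
rewrite -[leRHS]mulr1 mulr_natl -[X in _ *+ X]card_ord -sumr_const.
apply: ler_sum => -[[|j] _] _ /=; first by rewrite expr0 (csn1 cs).
by rewrite (le_trans (csnX cs _ _))// exprn_ile1// cge0.
Qed.

Lemma ergodic_mean_small k n : cpos k -> N k <= 1 ->
  N (k * peval k (ergodic_mean n)) <= 2 / n.+1%:R.
Proof.
move=> pk k1; have h1 := cpos_compl cs pk k1.
have -> : k * peval k (ergodic_mean n) = n.+1%:R^-1%:C *: (1 - (1 - k) ^+ n.+1).
  transitivity (peval k (n.+1%:R^-1 *: (1 - (1 - 'X) ^+ n.+1))); last first.
    by rewrite pevalZ pevalB peval1 pevalXn pevalB peval1 pevalX.
  rewrite -[X in X * _]pevalX -pevalM; congr peval.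
  rewrite /ergodic_mean -scalerAr; congr (_ *: _).
  by rewrite -[RHS]opprB subrX1 -mulNr opprB subKr.
rewrite (csnZr cs) ger0_norm ?invr_ge0// mulrC ler_pM2r ?invr_gt0//.
rewrite (le_trans (csnB cs _ _))// (_ : 2 = 1 + 1 :> R)// lerD ?(csn1 cs)//.
by rewrite (le_trans (csnX cs _ _))// exprn_ile1// cge0.
Qed.
End positive_elements.

(** * Unitizations *)

Section cstar_norms.
Variables (R : realType) (D : starAlgType R).

Record cstar_norm (N : D -> R) : Prop := CStarNorm {
  cnD : forall x y, N (x + y) <= N x + N y;
  cnZ : forall c x, N (c *: x) = normc c * N x;
  cnM : forall x y, N (x ** y) <= N x * N y;
  cnC : forall x, N (star x ** x) = N x ^+ 2;
  cn_eq0 : forall x, N x = 0 -> x = 0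
}.

Definition unitization : Type := (R[i] * D)%type.

HB.instance Definition _ := GRing.Lmodule.copy unitization (R[i]^o * D)%type.

Implicit Types (u v w : unitization) (x y a : D).

Definition umul u v : unitization :=
  (u.1 * v.1, u.1 *: v.2 + v.1 *: u.2 + u.2 ** v.2).

Definition uone : unitization := (1, 0).

Definition uact u x : D := u.1 *: x + u.2 ** x.

Lemma unitization_ext u v : u.1 = v.1 -> u.2 = v.2 -> u = v.
Proof. by case: u; case: v => ? ? ? ? /= -> ->. Qed.

Lemma umulA : associative umul.
Proof.
move=> [r a] [s b] [t c]; rewrite /umul /=; congr pair; first by rewrite mulrA.
rewrite !scalerDr !smulDl !smulDr !scalerA !smulZl !smulZr smulA.
rewrite (mulrC t r) (mulrC t s) -!addrA; congr (_ + (_ + _)).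
rewrite addrCA; congr (_ + _); rewrite [RHS]addrCA; congr (_ + _).
by rewrite addrCA.
Qed.

Lemma umul1 : left_id uone umul.
Proof.
by case=> s a; rewrite /umul /= mul1r scale1r scaler0 addr0 smul0r addr0.
Qed.

Lemma umulr1 : right_id uone umul.
Proof.
by case=> s a; rewrite /umul /= mulr1 scale1r scaler0 add0r smulr0 addr0.
Qed.

Lemma umulDl : left_distributive umul +%R.
Proof.
move=> [r a] [s b] [t c]; apply: unitization_ext; rewrite /umul /=; first by rewrite mulrDl.
rewrite scalerDl scalerDr smulDl -!addrA; congr (_ + _).
rewrite addrCA; congr (_ + _); rewrite [RHS]addrCA; congr (_ + _).
by rewrite addrCA.
Qed.

Lemma umulDr : right_distributive umul +%R.
Proof.
move=> [r a] [s b] [t c]; apply: unitization_ext; rewrite /umul /=; first by rewrite mulrDr.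
rewrite scalerDl scalerDr smulDr -!addrA; congr (_ + _).
rewrite addrCA; congr (_ + _); rewrite [RHS]addrCA; congr (_ + _).
by rewrite addrCA.
Qed.

Lemma uone_neq0 : uone != 0.
Proof. by apply/eqP => -[/eqP]; rewrite oner_eq0. Qed.

HB.instance Definition _ := GRing.Zmodule_isNzRing.Build unitization
  umulA umul1 umulr1 umulDl umulDr uone_neq0.

Lemma uscaleAl (c : R[i]) u v : c *: (u * v) = (c *: u) * v.
Proof.
apply: unitization_ext => /=; first exact: mulrA.
by rewrite /umul /= !scalerDr !scalerA smulZl [v.1 * c]mulrC.
Qed.

HB.instance Definition _ :=
  GRing.Lmodule_isLalgebra.Build R[i] unitization uscaleAl.

Lemma uscaleAr (c : R[i]) u v : c *: (u * v) = u * (c *: v).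
Proof.
apply: unitization_ext => /=; first exact: mulrCA.
by rewrite /umul /= !scalerDr !scalerA smulZr [u.1 * c]mulrC.
Qed.

HB.instance Definition _ :=
  GRing.Lalgebra_isAlgebra.Build R[i] unitization uscaleAr.

Definition ustar u : unitization := (conjc u.1, star u.2).

Definition uinj x : unitization := (0, x).

Lemma uinjD x y : uinj (x + y) = uinj x + uinj y.
Proof. by apply: unitization_ext; rewrite //= addr0. Qed.

Lemma uinjB x y : uinj (x - y) = uinj x - uinj y.
Proof. by apply: unitization_ext; rewrite //= subr0. Qed.

Lemma uinj0 : uinj 0 = 0. Proof. by []. Qed.

Lemma uinjZ (c : R[i]) x : uinj (c *: x) = c *: uinj x.
Proof. by apply: unitization_ext; rewrite //= scaler0. Qed.

Lemma uinjM x y : uinj (x ** y) = uinj x * uinj y.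
Proof. by apply: unitization_ext; rewrite //= ?mulr0// !scale0r !add0r. Qed.

Lemma uinj_star x : uinj (star x) = ustar (uinj x).
Proof. by apply: unitization_ext => //; exact/esym/conjc0. Qed.

Lemma uinj_sum I (r : seq I) (P : pred I) (F : I -> D) :
  uinj (\sum_(i <- r | P i) F i) = \sum_(i <- r | P i) uinj (F i).
Proof. exact: (big_morph _ uinjD uinj0). Qed.

Lemma uinj_act u x : u * uinj x = uinj (uact u x).
Proof. by apply: unitization_ext; rewrite /= ?mulr0// scale0r addr0. Qed.

Lemma uinjI : injective uinj. Proof. by move=> x y []. Qed.

Lemma uactM u v x : uact (u * v) x = uact u (uact v x).
Proof. by apply: uinjI; rewrite -!uinj_act mulrA. Qed.

Lemma uactD u v x : uact (u + v) x = uact u x + uact v x.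
Proof. by apply: uinjI; rewrite uinjD -!uinj_act mulrDl. Qed.

Lemma uactZ (c : R[i]) u x : uact (c *: u) x = c *: uact u x.
Proof. by apply: uinjI; rewrite uinjZ -!uinj_act scalerAl. Qed.

Lemma uactZr (c : R[i]) u x : uact u (c *: x) = c *: uact u x.
Proof. by apply: uinjI; rewrite uinjZ -!uinj_act uinjZ scalerAr. Qed.

Lemma ustarM u v : ustar (u * v) = ustar v * ustar u.
Proof.
apply: unitization_ext => /=; first by rewrite rmorphM mulrC.
by rewrite /umul !starD !starZ starM /= [X in X + _]addrC.
Qed.

Lemma uinj_snd u : u.1 = 0 -> uinj u.2 = u.
Proof. by move=> u0; apply: unitization_ext. Qed.

Variables (N : D -> R) (cn : cstar_norm N).

Lemma cn0 : N 0 = 0.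
Proof. by rewrite -(scale0r (0 : D)) (cnZ cn) normc0 mul0r. Qed.

Lemma cnN x : N (- x) = N x.
Proof.
rewrite -scaleN1r (cnZ cn) (_ : -1 = (-1)%:C) ?normcR ?normrN1 ?mul1r//.
by rewrite rmorphN1.
Qed.

Lemma cn_ge0 x : 0 <= N x.
Proof. by have := cnD cn x (- x); rewrite subrr cn0 cnN; lra. Qed.

Lemma cnZr (r : R) x : N (r%:C *: x) = `|r| * N x.
Proof. by rewrite (cnZ cn) normcR. Qed.

Lemma cnB x y : N (x - y) <= N x + N y.
Proof. by rewrite -(cnN y) (cnD cn). Qed.

Lemma cn_star x : N (star x) = N x.
Proof.
suff H y : N y <= N (star y) by apply/le_anti; rewrite H -{2}(starK x) H.
have := cnM cn (star y) y; rewrite (cnC cn) expr2.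
have [->|y0] := eqVneq (N y) 0; first by rewrite cn_ge0.
by rewrite ler_pM2r// lt_neqAle eq_sym y0 cn_ge0.
Qed.

(** The operator norm of the left action on [D]; the simpler norm [|c| + N x] fails the C*-identity
    in general. *)
Definition unorm u := sup [set N (uact u x) | x in [set x | N x <= 1]].

Let bound u x : N x <= 1 -> N (uact u x) <= normc u.1 + N u.2.
Proof.
move=> x1; rewrite (le_trans (cnD cn _ _))// (cnZ cn) lerD//.
  by rewrite ler_piMr// normc_ge0.
by rewrite (le_trans (cnM cn _ _))// ler_piMr// cn_ge0.
Qed.

Let has_sup_unorm u : has_sup [set N (uact u x) | x in [set x | N x <= 1]].
Proof.
split; first by exists (N (uact u 0)), 0; rewrite //= cn0.
by exists (normc u.1 + N u.2) => _ [x /= x1 <-]; exact: bound.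
Qed.

Lemma unorm_le u c : (forall x, N x <= 1 -> N (uact u x) <= c) -> unorm u <= c.
Proof.
move=> h; apply: ge_sup => [|_ [x x1 <-]]; last exact: h.
by have [] := has_sup_unorm u.
Qed.

Lemma unorm_ge u x : N x <= 1 -> N (uact u x) <= unorm u.
Proof. by move=> x1; apply: ub_le_sup; [have [] := has_sup_unorm u | exists x]. Qed.

Lemma uact0r u : uact u 0 = 0.
Proof. by rewrite /uact scaler0 smulr0 addr0. Qed.

Lemma unorm_act u x : N (uact u x) <= unorm u * N x.
Proof.
have [/(cn_eq0 cn) ->|x0] := eqVneq (N x) 0; first by rewrite uact0r cn0 mulr0.
have xp : 0 < N x by rewrite lt_neqAle eq_sym x0 cn_ge0.
have := unorm_ge u (x := (N x)^-1%:C *: x).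
rewrite cnZr gtr0_norm ?invr_gt0// mulVf// lexx => /(_ isT).
by rewrite uactZr cnZr gtr0_norm ?invr_gt0// ler_pdivrMl// mulrC.
Qed.

Lemma unorm_ge0 u : 0 <= unorm u.
Proof. by apply: le_trans (unorm_ge u (x := 0) _); rewrite ?cn_ge0// cn0. Qed.

(** The lower bound comes from testing on [star x], as there may be no unit to test on. *)
Lemma unorm_inj x : unorm (uinj x) = N x.
Proof.
apply/le_anti/andP; split.
  apply: unorm_le => y y1; rewrite /uact /= scale0r add0r.
  by rewrite (le_trans (cnM cn _ _))// ler_piMr// cn_ge0.
have := unorm_act (uinj x) (star x); rewrite /uact /= scale0r add0r.
rewrite -{1}(starK x) (cnC cn) cn_star expr2.
have [->|x0] := eqVneq (N x) 0; first by rewrite unorm_ge0.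
by rewrite ler_pM2r// lt_neqAle eq_sym x0 cn_ge0.
Qed.

Lemma cstar_seminorm_unitization : cstar_seminorm ustar unorm.
Proof.
have uM u v : unorm (u * v) <= unorm u * unorm v.
  apply: unorm_le => x x1; rewrite uactM (le_trans (unorm_act _ _))//.
  by rewrite ler_wpM2l ?unorm_ge0// unorm_ge.
(* Half of the C*-identity, from [N (u x) ^ 2 = N (x^* u^* u x) <= N (u^* u x)] for [N x <= 1]. The
   other half follows once [u] and its adjoint are known to have equal norms. *)
have uC u : unorm u ^+ 2 <= unorm (ustar u * u).
  rewrite -[leRHS]sqr_sqrtr ?unorm_ge0// lerXn2r ?nnegrE ?sqrtr_ge0 ?unorm_ge0//.
  apply: unorm_le => x x1.
  rewrite -[leLHS]ger0_norm ?cn_ge0// -sqrtr_sqr ler_wsqrtr//.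
  have -> : N (uact u x) ^+ 2 = N (star x ** uact (ustar u * u) x).
    rewrite -(cnC cn); congr N; apply: uinjI.
    by rewrite !uinjM uinj_star -!uinj_act uinj_star ustarM !mulrA.
  rewrite (le_trans (cnM cn _ _))// cn_star -[leRHS]mul1r ler_pM ?cn_ge0//.
  exact: unorm_ge.
have uSt u : unorm (ustar u) = unorm u.
  suff H v : unorm v <= unorm (ustar v).
    have uK : ustar (ustar u) = u by apply: unitization_ext; rewrite /= ?conjcK ?starK.
    by apply/le_anti; rewrite H -{2}uK H.
  have := le_trans (uC v) (uM _ _); rewrite expr2.
  have [->|v0] := eqVneq (unorm v) 0; first by rewrite unorm_ge0.
  by rewrite ler_pM2r// lt_neqAle eq_sym v0 unorm_ge0.
split => //.
- by move=> u; apply: unitization_ext; rewrite /= ?conjcK ?starK.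
- by move=> u v; apply: unitization_ext; rewrite /= ?rmorphD ?starD.
- by move=> c u; apply: unitization_ext; rewrite /= ?rmorphM ?starZ.
- exact: ustarM.
- move=> u v; apply: unorm_le => x x1.
  by rewrite uactD (le_trans (cnD cn _ _))// lerD// unorm_ge.
- move=> c u; apply/le_anti/andP; split.
    apply: unorm_le => x x1; rewrite uactZ (cnZ cn) ler_wpM2l ?normc_ge0//.
    exact: unorm_ge.
  have [->|c0] := eqVneq (normc c) 0; first by rewrite mul0r unorm_ge0.
  have cp : 0 < normc c by rewrite lt_neqAle eq_sym c0 normc_ge0.
  rewrite mulrC -ler_pdivlMr//; apply: unorm_le => x x1.
  by rewrite ler_pdivlMr// mulrC -(cnZ cn) -uactZ unorm_ge.
- move=> u; apply/le_anti; rewrite uC andbT expr2 (le_trans (uM _ _))//.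
  by rewrite uSt.
Qed.

End cstar_norms.

Lemma exists_small_ratio (R : realType) (c e : R) : 0 < e ->
  exists n : nat, c / n.+1%:R <= e.
Proof.
move=> e0; exists (Num.bound (`|c| / e)).
rewrite ler_pdivrMr// mulrC -ler_pdivrMr//.
have /ltW h := archi_boundP (divr_ge0 (normr_ge0 c) (ltW e0)).
apply: (@le_trans _ _ (`|c| / e)); first by rewrite ler_pM2r ?invr_gt0// ler_norm.
by rewrite (le_trans h)// ler_nat.
Qed.

Section star_algebra.
Variables (R : realType) (D : starAlgType R).
Implicit Types (x y z : D).

Lemma smulBr x y z : x ** (y - z) = x ** y - x ** z.
Proof. by apply/eqP; rewrite eq_sym subr_eq -smulDr subrK. Qed.

Lemma smulBl x y z : (x - y) ** z = x ** z - y ** z.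
Proof. by apply/eqP; rewrite eq_sym subr_eq -smulDl subrK. Qed.

Lemma starB x y : star (x - y) = star x - star y.
Proof. by apply/eqP; rewrite eq_sym subr_eq -starD subrK. Qed.

End star_algebra.

Section nonunital.
Variables (R : realType) (D : starAlgType R) (N : D -> R) (cn : cstar_norm N).
Implicit Types (x y a b : D).

Let cs := cstar_seminorm_unitization cn.

Lemma cn_sum I (r : seq I) (P : pred I) (F : I -> D) :
  N (\sum_(i <- r | P i) F i) <= \sum_(i <- r | P i) N (F i).
Proof.
elim/big_rec2 : _ => [|i y1 y2 _ h]; first by rewrite (cn0 cn).
by rewrite (le_trans (cnD cn _ _))// lerD2l.
Qed.

Lemma cn_cauchy_schwarz I (r : seq I) (u v : I -> D) :
  N (\sum_(i <- r) star (u i) ** v i) ^+ 2 <=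
  N (\sum_(i <- r) star (u i) ** u i) * N (\sum_(i <- r) star (v i) ** v i).
Proof.
have := csn_cauchy_schwarz cs r (fun i => uinj (u i)) (fun i => uinj (v i)).
have E (x y : I -> D) : \sum_(i <- r) ustar (uinj (x i)) * uinj (y i) =
    uinj (\sum_(i <- r) star (x i) ** y i).
  by rewrite uinj_sum; apply: eq_bigr => i _; rewrite uinjM uinj_star.
by rewrite !E !(unorm_inj cn).
Qed.

Lemma cn_sum_sqr_ge (I : eqType) (r : seq I) (u : I -> D) i : i \in r ->
  N (u i) ^+ 2 <= N (\sum_(i <- r) star (u i) ** u i).
Proof.
move=> ir; have := csn_sum_sqr_ge cs (fun i => uinj (u i)) ir.
have -> : \sum_(i <- r) ustar (uinj (u i)) * uinj (u i) =
    uinj (\sum_(i <- r) star (u i) ** u i).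
  by rewrite uinj_sum; apply: eq_bigr => j _; rewrite uinjM uinj_star.
by rewrite !(unorm_inj cn).
Qed.

(** In particular [1 - p(a)] lies in the ideal [D] as soon as [p(0) = 1], which brings approximate
    units built in the unitization back to [D]. *)
Lemma peval_inj_fst a (p : {poly R}) : (peval (uinj a) p).1 = p.[0]%:C.
Proof.
elim/poly_ind: p => [|p c ih]; first by rewrite peval0 horner0.
rewrite pevalD pevalM pevalX pevalC hornerMXaddC mulr0 add0r /=.
by rewrite mulr0 add0r; exact: mulr1.
Qed.

(** Let [k'] be a multiple of [sum b b^*] with norm at most 1, [E] the average of the powers of
    [1 - k'], and [f = 1 - E]. Each [E b b^* E] is dominated by a multiple of [E k' E], which is of
    order [1 / n]. The bound 2 for [f] is that of [1 + N E]. *)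
Lemma cn_approx_unit (r : seq D) e : 0 < e ->
  exists f, [/\ star f = f, N f <= 2, (forall x, N (x - f ** x) <= N x) &
    forall b, b \in r -> N (b - f ** b) <= e].
Proof.
move=> e0; pose k := \sum_(b <- r) star (star b) ** star b.
pose t := N k + 1; have t0 : 0 < t by rewrite ltr_wpDl// (cn_ge0 cn).
pose k' := t^-1%:C *: k.
have pk : cpos (@ustar R D) (unorm N) (uinj k').
  rewrite /k' uinjZ; apply: (cposZ cs); first by rewrite invr_ge0 ltW.
  rewrite /k uinj_sum; apply: (cpos_sum cs) => b _.
  by rewrite uinjM uinj_star; exact: (cposC cs).
have k1 : unorm N (uinj k') <= 1.
  rewrite (unorm_inj cn) /k' (cnZr cn) gtr0_norm ?invr_gt0//.
  by rewrite ler_pdivrMl// mulr1 lerDl.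
have [n ne] := exists_small_ratio (2 * t) (exprn_gt0 2 e0).
set E := peval (uinj k') (ergodic_mean R n).
have sE : ustar E = E by apply: (sa_peval cs); exact: cpos_sa pk.
have E1 : unorm N E <= 1 by exact: (ergodic_mean_norm cs).
have fE : uinj (1 - E).2 = 1 - E.
  apply: uinj_snd; rewrite /= peval_inj_fst /ergodic_mean hornerZ horner_sum.
  rewrite (eq_bigr (fun=> 1)) => [|j _]; last by rewrite !hornerE subr0 expr1n.
  by rewrite sumr_const card_ord mulVf ?pnatr_eq0// rmorph1 subrr.
have Ef x : uinj (x - (1 - E).2 ** x) = E * uinj x.
  by rewrite uinjB uinjM fE mulrBl mul1r subKr.
exists (1 - E).2; split.
- by apply: uinjI; rewrite uinj_star fE (csB cs) (cs1 cs) sE.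
- rewrite -(unorm_inj cn) fE (le_trans (csnB cs _ _))//.
  by rewrite (_ : 2 = 1 + 1 :> R)// lerD// (csn1 cs).
- move=> x; rewrite -(unorm_inj cn) Ef -(unorm_inj cn x).
  by rewrite (le_trans (csnM cs _ _))// ler_piMl// (csn_ge0 cs).
move=> b br; rewrite -(unorm_inj cn) Ef -(csn_st cs) (csM cs) sE.
rewrite -(@ler_pXn2r _ 2)// ?nnegrE ?(csn_ge0 cs)// ?(ltW e0)//.
have := csn_sum_sqr_ge cs (fun b => ustar (uinj b) * E) br; move/le_trans; apply.
have -> : \sum_(b <- r) ustar (ustar (uinj b) * E) * (ustar (uinj b) * E) =
   t%:C *: (E * (uinj k' * E)).
  rewrite /k' uinjZ -scalerAl -scalerAr scalerA -rmorphM divff ?gt_eqF// scale1r.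
  rewrite /k uinj_sum mulr_suml mulr_sumr; apply: eq_bigr => c _.
  by rewrite (csM cs) sE uinjM !uinj_star !mulrA.
rewrite (csnZr cs) gtr0_norm//; apply: le_trans ne; rewrite [2 * t]mulrC -mulrA.
rewrite ler_pM2l// (le_trans (csnM cs _ _))//.
rewrite -[leRHS]mul1r ler_pM ?(csn_ge0 cs)//.
exact: (ergodic_mean_small cs).
Qed.

End nonunital.

(** * Local C*-algebras: approximate units, Neumann series, contractivity *)

Section precstar_norm.
Variables (R : realType).

Lemma normrE (B : preCStarType R) (x : B) : `|x| = (rnorm x)%:C.
Proof. by rewrite /rnorm RRe_real// ger0_real. Qed.

Lemma normc_rnorm (c : R[i]) : `|c| = (normc c)%:C.
Proof. by case: c. Qed.

Lemma cstar_norm_rnorm (B : preCStarType R) : cstar_norm (@rnorm R B).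
Proof.
split.
- by move=> x y; have := ler_normD x y; rewrite !normrE -rmorphD lecR.
- by move=> c x; apply: complexI; rewrite -normrE normrZ normc_rnorm normrE -rmorphM.
- by move=> x y; have := norm_smul x y; rewrite !normrE -rmorphM lecR.
- by move=> x; apply: complexI; rewrite -normrE norm_cstar normrE rmorphXn.
- by move=> x x0; apply/eqP; rewrite -normr_eq0 normrE x0.
Qed.

Lemma cvg_rnorm (B : preCStarType R) (u : nat -> B) (l : B) : u @ \oo --> l ->
  forall e, 0 < e -> exists n0, forall n, (n0 <= n)%N -> rnorm (u n - l) <= e.
Proof.
move=> /cvgrPdist_le ul e e0.
have [|n0 _ h] := ul e%:C; first by rewrite ltcR.
by exists n0 => n /h /=; rewrite distrC normrE lecR.
Qed.

Lemma cauchy_rnorm (B : preCStarType R) (u : nat -> B) :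
  (forall e, 0 < e -> exists n0, forall m n, (n0 <= m)%N -> (n0 <= n)%N ->
    rnorm (u m - u n) <= e) -> cauchy (u @ \oo).
Proof.
move=> h; apply: cauchy_exP => e e0.
have eE : e = (complex.Re e)%:C by rewrite RRe_real// gtr0_real.
have e'0 : 0 < complex.Re e / 2 by rewrite divr_gt0// -ltcR -eE.
have [n0 hn] := h _ e'0.
exists (u n0); exists n0 => // n /= n0n; rewrite -ball_normE /= normrE eE ltcR.
rewrite (le_lt_trans (hn _ _ (leqnn _) n0n))// ltr_pdivrMr// ltr_pMr// ?ltr1n//.
by rewrite -ltcR -eE.
Qed.

Variable A : localCStarType R.

Lemma dense_seq : exists u : nat -> A, forall a e, 0 < e -> exists i, rnorm (a - u i) <= e.
Proof.
have [u du] := @local_separable R A; exists u => a e e0.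
have a0 : (interior (ball a e%:C)) !=set0 by exists a; apply: nbhsx_ballx; rewrite ltcR.
have [x [/= h [i _ xE]]] := du _ a0 (@open_interior _ _).
exists i; have := interior_subset h; rewrite -xE.
by rewrite -ball_normE /= normrE ltcR => /ltW.
Qed.

(** The finite sets exhaust a dense sequence, and the contractivity of [x |-> x - f x], uniform in
    [n], carries the convergence over to every [a]. *)
Lemma approx_unit : exists f : nat -> A,
  (forall n, star (f n) = f n) /\ (forall n, rnorm (f n) <= 2) /\
  forall a e, 0 < e -> exists n0, forall n, (n0 <= n)%N -> rnorm (a - f n ** a) <= e.
Proof.
have cn := cstar_norm_rnorm A.
have [u du] := dense_seq.
have /choice[f hf] : forall n, exists f : A, [/\ star f = f, rnorm f <= 2,
    (forall x, rnorm (x - f ** x) <= rnorm x) &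
    forall b, b \in [seq u i | i <- iota 0 n] -> rnorm (b - f ** b) <= n.+1%:R^-1].
  by move=> n; apply: (cn_approx_unit cn); rewrite invr_gt0.
exists f; split; first by move=> n; have [] := hf n.
split; first by move=> n; have [] := hf n.
move=> a e e0; have e20 : 0 < e / 2 by rewrite divr_gt0.
have [i hi] := du a _ e20; have [m hm] := exists_small_ratio 1 e20.
exists (maxn i.+1 m) => n; rewrite geq_max => /andP[ni nm].
have [_ _ h1 h2] := hf n.
have -> : a - f n ** a = (a - u i - f n ** (a - u i)) + (u i - f n ** u i).
  by rewrite smulBr opprB addrAC !subrKA.
rewrite (le_trans (cnD cn _ _))// (splitr e) lerD//.
  by rewrite (le_trans (h1 _)).
apply: (le_trans (h2 _ _)); first by apply: map_f; rewrite mem_iota.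
apply: le_trans hm; rewrite mul1r lef_pV2 ?posrE// ler_nat ltnS//.
Qed.

Lemma local_complete (a : A) : exists S : set A, cstar_subalgebra S /\ S a.
Proof.
have [I [S [hS _ cover]]] := @local_family R A.
have : [set: A] a by []. 
by rewrite -cover => -[i _ Sia]; exists (S i).
Qed.

Lemma cstar_subalgebra_lim (S : set A) (u : nat -> A) : cstar_subalgebra S ->
  (forall n, S (u n)) ->
  (forall e, 0 < e -> exists n0, forall m n, (n0 <= m)%N -> (n0 <= n)%N ->
    rnorm (u m - u n) <= e) ->
  exists2 l, S l & forall e, 0 < e ->
    exists n0, forall n, (n0 <= n)%N -> rnorm (u n - l) <= e.
Proof.
move=> [_ _ _ _ hS] Su /cauchy_rnorm/(hS _ Su)[l Sl /cvg_rnorm ul].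
by exists l.
Qed.

(* [w] is the sum of the powers [h ^ n], [n >= 1]. *)
Lemma neumann (h : A) : rnorm h < 1 -> exists w, w = h + w ** h.
Proof.
have cn := cstar_norm_rnorm A; have h0 := cn_ge0 cn h.
move=> h1; have [S [hS Sh]] := local_complete h.
pose u := fix u n := if n is m.+1 then h + u m ** h else 0.
have Su n : S (u n).
  have [S0 SD _ [SM _] _] := hS.
  by elim: n => //= n ih; apply: SD => //; exact: SM.
pose B := rnorm h / (1 - rnorm h).
have B0 : 0 <= B by rewrite divr_ge0// subr_ge0 ltW.
have uB n : rnorm (u n) <= B.
  elim: n => [|n ih]; first by rewrite /= (cn0 cn).
  rewrite /= (le_trans (cnD cn _ _))//.
  have -> : B = rnorm h + rnorm h * B.
    by rewrite /B; field; rewrite gt_eqF// subr_gt0.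
  by rewrite lerD2l (le_trans (cnM cn _ _))// mulrC ler_wpM2l.
have uC m k : rnorm (u (m + k)%N - u m) <= rnorm h ^+ m * B.
  elim: m => [|m ih]; first by rewrite expr0 mul1r /= subr0.
  rewrite addSn /= opprD addrACA subrr add0r -smulBl.
  by rewrite (le_trans (cnM cn _ _))// exprS -mulrA mulrC ler_wpM2l.
have [e e0|l _ ul] := cstar_subalgebra_lim hS Su.
  have e20 : 0 < e / 2 / (B + 1) by rewrite !divr_gt0// ltr_wpDl.
  have h1' : `|rnorm h| < 1 by rewrite ger0_norm.
  have /cvgrPdist_le/(_ _ e20)[n0 _ hn0] := cvg_expr h1'.
  have Bn0 k : rnorm (u (n0 + k)%N - u n0) <= e / 2.
    apply: (le_trans (uC _ _)); have /= := hn0 n0 (leqnn _).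
    rewrite sub0r normrN ger0_norm ?exprn_ge0// ler_pdivlMr ?ltr_wpDl//.
    apply: le_trans; rewrite ler_wpM2l ?exprn_ge0// lerDl//.
  exists n0 => m n /subnKC <- /subnKC <-.
  rewrite -(subrKA (u n0)) (splitr e) (le_trans (cnD cn _ _))// lerD//.
  by rewrite -(cnN cn) opprB.
exists l; apply/eqP; rewrite -subr_eq0; apply/eqP/(cn_eq0 cn).
apply/le_anti; rewrite (cn_ge0 cn) andbT; apply/ler_addgt0Pr => e e0; rewrite add0r.
have [n0 hn0] := ul _ (divr_gt0 e0 (ltr0n R 2)).
have -> : l - (h + l ** h) = - (u n0.+1 - l) + (u n0 - l) ** h.
  by rewrite /= opprB smulBl !opprD !addrA subrK.
rewrite (splitr e) (le_trans (cnD cn _ _))// lerD//.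
  by rewrite (cnN cn) hn0.
rewrite (le_trans (cnM cn _ _))//.
by apply: le_trans (hn0 _ (leqnn _)); rewrite ler_piMr ?(cn_ge0 cn)// ltW.
Qed.

End precstar_norm.

(** If [f] increased the norm of [a], scale [star a ** a] to [h] with [rnorm h < 1] and
    [rnorm (f h) = 1]. A Neumann series in the domain makes [1 - f h] left invertible, hence bounded
    below. Since [1 + f h] expands norms, [1 - (f h)^2 = (1 + f h)(1 - f h)] would be bounded below
    as well, against the approximate eigenvector of [(f h)^2]. *)
Lemma star_hom_contractive (R : realType) (A A' : localCStarType R)
  (f : star_hom A A') (a : A) : rnorm (f a) <= rnorm a.
Proof.
have cnA := cstar_norm_rnorm A; have cnA' := cstar_norm_rnorm A'.
have cs := cstar_seminorm_unitization cnA'.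
rewrite leNgt; apply/negP => fa.
have fa0 : 0 < rnorm (f a) by apply: le_lt_trans fa; exact: (cn_ge0 cnA).
pose h := (rnorm (f a) ^- 2)%:C *: (star a ** a).
have h1 : rnorm h < 1.
  rewrite /h (cnZr cnA) (cnC cnA) gtr0_norm ?invr_gt0 ?exprn_gt0//.
  by rewrite ltr_pdivrMl ?exprn_gt0// mulr1 ltrXn2r// (cn_ge0 cnA).
have fh : f h = (rnorm (f a) ^- 2)%:C *: (star (f a) ** f a).
  by rewrite /h linearZ /= star_homM star_homV.
have fh1 : unorm (@rnorm R A') (uinj (f h)) = 1.
  rewrite (unorm_inj cnA') fh (cnZr cnA') (cnC cnA') gtr0_norm ?invr_gt0 ?exprn_gt0//.
  by rewrite mulVf// expf_neq0// gt_eqF.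
have pfh : cpos (@ustar R A') (unorm (@rnorm R A')) (uinj (f h)).
  rewrite fh uinjZ; apply: (cposZ cs); first by rewrite invr_ge0 exprn_ge0// ltW.
  by rewrite uinjM uinj_star; exact: (cposC cs).
have [w wE] := neumann h1.
have wE' : (1 + uinj (f w)) * (1 - uinj (f h)) = 1.
  rewrite mulrBr mulr1 mulrDl mul1r -uinjM {1}wE linearD /= star_homM.
  by rewrite uinjD addrK.
have K0 : 0 < unorm (@rnorm R A') (1 + uinj (f w)) + 1.
  by rewrite ltr_wpDl// (csn_ge0 cs).
have e0 : 0 < (unorm (@rnorm R A') (1 + uinj (f w)) + 1)^-1 / 2.
  by rewrite divr_gt0// invr_gt0.
have [y y0 hy] := sa_approx_eigen1 cs (cpos_sa pfh) fh1 e0.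
have E : y - uinj (f h) * uinj (f h) * y =
    (1 - uinj (f h)) * y + 1%:C *: (uinj (f h) * ((1 - uinj (f h)) * y)).
  by rewrite scale1r !mulrBl mul1r mulrBr addrA subrK mulrA.
rewrite E in hy.
have h2 := le_trans (pfh.2 1 ((1 - uinj (f h)) * y) ler01) hy.
have : unorm (@rnorm R A') y <=
    unorm (@rnorm R A') (1 + uinj (f w)) * unorm (@rnorm R A') ((1 - uinj (f h)) * y).
  rewrite [leLHS](_ : _ = unorm (@rnorm R A') ((1 + uinj (f w)) * ((1 - uinj (f h)) * y))).
    exact: (csnM cs).
  by rewrite mulrA wE' mul1r.
move: h2; rewrite -mulrA ler_pdivlMl//.
by have := csn_ge0 cs ((1 - uinj (f h)) * y); nra.
Qed.

(** * The norm of M_oo(B) *)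

(* The best constant [s] in [F <= s N] satisfies [s ^ 2 <= M s]. *)
Lemma norm_power_trick (R : realType) (T : Type) (P : T -> Prop) (sq : T -> T)
    (F N : T -> R) (M C : R) : (forall t, P t -> P (sq t)) ->
  (forall t, 0 <= F t) -> (forall t, 0 <= N t) -> 0 <= M ->
  (forall t, P t -> F t <= C * N t) ->
  (forall t, P t -> F t ^+ 2 <= M * F (sq t)) ->
  (forall t, P t -> N (sq t) <= N t ^+ 2) ->
  forall t, P t -> F t <= M * N t.
Proof.
move=> Psq F0 N0 M0 FC FM Nsq t Pt.
have [Nt|Nt] := eqVneq (N t) 0; first by have := FC t Pt; rewrite Nt !mulr0.
pose S := [set F x / N x | x in [set x | P x /\ 0 < N x]].
have posN x : N x != 0 -> 0 < N x by rewrite lt_neqAle eq_sym N0 => ->.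
have St : S (F t / N t) by exists t => //; split => //; exact: posN.
have Sub : has_ubound S.
  by exists C => _ [x [Px Nx] <-]; rewrite ler_pdivrMr// FC.
pose s := sup S.
have Fs x : P x -> F x <= s * N x.
  move=> Px; have [Nx|/posN Nx] := eqVneq (N x) 0.
    by have := FC x Px; rewrite Nx !mulr0.
  by rewrite -ler_pdivrMr//; apply: ub_le_sup => //; exists x.
have s0 : 0 <= s.
  by apply: le_trans (ub_le_sup Sub St); rewrite divr_ge0.
have sM : s <= Num.sqrt (M * s).
  apply: ge_sup; first by exists (F t / N t).
  move=> _ [x [Px Nx] <-]; rewrite ler_pdivrMr//.
  rewrite -(@ler_pXn2r _ 2)// ?nnegrE ?mulr_ge0 ?sqrtr_ge0// exprMn sqr_sqrtr ?mulr_ge0//.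
  rewrite (le_trans (FM x Px))// -mulrA ler_wpM2l//.
  by rewrite (le_trans (Fs _ (Psq _ Px)))// ler_wpM2l// Nsq.
apply: (le_trans (Fs t Pt)); rewrite ler_wpM2r//.
have [->//|sn] := eqVneq s 0.
have sp : 0 < s by rewrite lt_neqAle eq_sym sn.
rewrite -(ler_pM2r sp) -expr2 -[leRHS]sqr_sqrtr ?mulr_ge0//.
by rewrite ler_pXn2r ?nnegrE// sqrtr_ge0.
Qed.

Lemma sumr_sqr_le (R : realType) I (r : seq I) (a : I -> R) : (forall i, 0 <= a i) ->
  \sum_(i <- r) a i ^+ 2 <= (\sum_(i <- r) a i) ^+ 2.
Proof.
move=> a0; elim: r => [|i r ih]; first by rewrite !big_nil expr0n.
rewrite !big_cons; have := a0 i; have : 0 <= \sum_(j <- r) a j by apply: sumr_ge0.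
by move: ih; nra.
Qed.

Lemma cstar_norm_of_le (R : realType) (D : starAlgType R) (N : D -> R) :
  (forall x y, N (x + y) <= N x + N y) ->
  (forall c x, N (c *: x) = normc c * N x) ->
  (forall x y, N (x ** y) <= N x * N y) ->
  (forall x, N x ^+ 2 <= N (star x ** x)) ->
  (forall x, N x = 0 -> x = 0) -> (forall x, 0 <= N x) -> cstar_norm N.
Proof.
move=> ND NZ NM NC N_eq0 N0; split=> // x.
have Nst y : N (star y) = N y.
  suff H z : N z <= N (star z) by apply/le_anti; rewrite H -{2}(starK y) H.
  have := le_trans (NC z) (NM _ _); rewrite expr2.
  have [->|z0] := eqVneq (N z) 0; first by rewrite N0.
  by rewrite ler_pM2r// lt_neqAle eq_sym z0 N0.
by apply/le_anti; rewrite NC andbT expr2 -{1}(Nst x) NM.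
Qed.

Section columns.
Variables (R : realType) (B : preCStarType R).
Implicit Types (xi eta : nat -> B) (x y : Minf B).

Let cn := cstar_norm_rnorm B.

Definition supp_below n xi := forall k, (n <= k)%N -> xi k = 0.

Lemma supp_belowW m n xi : (m <= n)%N -> supp_below m xi -> supp_below n xi.
Proof. by move=> mn h k nk; apply: h; exact: leq_trans nk. Qed.

Definition col_ip xi eta : B := \sum_(k \in [set: nat]) (star (xi k) ** eta k).

Lemma col_ipE n xi eta : supp_below n xi \/ supp_below n eta ->
  col_ip xi eta = \sum_(k < n) (star (xi k) ** eta k).
Proof.
move=> h; apply: sum_corner => k nk; case: h => -> //.
- by rewrite star0 smul0r.
- by rewrite smulr0.
Qed.

Lemma col_norm_sqr xi : col_norm xi ^+ 2 = rnorm (col_ip xi xi).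
Proof. by rewrite sqr_sqrtr// (cn_ge0 cn). Qed.

Lemma col_norm_ge0 xi : 0 <= col_norm xi. Proof. exact: sqrtr_ge0. Qed.

Lemma col_ip_le xi eta : finite_col xi -> finite_col eta ->
  rnorm (col_ip xi eta) <= col_norm xi * col_norm eta.
Proof.
move=> [n xn] [m em].
have xi' := supp_belowW (leq_maxl n m) xn; have eta' := supp_belowW (leq_maxr n m) em.
rewrite -(@ler_pXn2r _ 2)// ?nnegrE ?(cn_ge0 cn) ?mulr_ge0 ?col_norm_ge0//.
rewrite exprMn !col_norm_sqr !(@col_ipE (maxn n m)); [|by left..].
exact: (cn_cauchy_schwarz cn).
Qed.

Lemma finite_colD xi eta : finite_col xi -> finite_col eta ->
  finite_col (fun k => xi k + eta k).
Proof.
move=> [n xn] [m em]; exists (maxn n m) => k; rewrite geq_max => /andP[nk mk].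
by rewrite xn// em// addr0.
Qed.

Lemma col_normD xi eta : finite_col xi -> finite_col eta ->
  col_norm (fun k => xi k + eta k) <= col_norm xi + col_norm eta.
Proof.
move=> fx fe; rewrite -(@ler_pXn2r _ 2)// ?nnegrE ?addr_ge0 ?col_norm_ge0//.
have ip : col_ip (fun k => xi k + eta k) (fun k => xi k + eta k) =
    col_ip xi xi + col_ip xi eta + (col_ip eta xi + col_ip eta eta).
  have [n xn] := fx; have [m em] := fe; have [p pn] := finite_colD fx fe.
  pose q := maxn p (maxn n m).
  have x' : supp_below q xi.
    by apply: supp_belowW xn; rewrite /q; lia.
  have e' : supp_below q eta.
    by apply: supp_belowW em; rewrite /q; lia.
  have p' : supp_below q (fun k => xi k + eta k) by apply: supp_belowW pn; rewrite leq_maxl.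
  rewrite !(@col_ipE q); [|by left..].
  by rewrite -!big_split /=; apply: eq_bigr => k _; rewrite starD !smulDl !smulDr.
rewrite col_norm_sqr ip sqrrD !col_norm_sqr.
have h1 := col_ip_le fx fe; have h2 := col_ip_le fe fx.
have := cnD cn (col_ip xi xi + col_ip xi eta) (col_ip eta xi + col_ip eta eta).
have := cnD cn (col_ip xi xi) (col_ip xi eta).
have := cnD cn (col_ip eta xi) (col_ip eta eta).
by rewrite mulr2n; lra.
Qed.

Lemma col_normZ (c : R[i]) xi : finite_col xi ->
  col_norm (fun k => c *: xi k) = normc c * col_norm xi.
Proof.
move=> [n xn]; have xc : supp_below n (fun k => c *: xi k).
  by move=> k nk; rewrite xn// scaler0.
apply/eqP; rewrite -(eqrXn2 (n := 2)) ?mulr_ge0 ?normc_ge0 ?col_norm_ge0//.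
rewrite exprMn !col_norm_sqr !(@col_ipE n); [|by left..].
have -> : \sum_(k < n) star (c *: xi k) ** (c *: xi k) =
    (conjc c * c) *: \sum_(k < n) star (xi k) ** xi k.
  by rewrite scaler_sumr; apply: eq_bigr => k _; rewrite starZ smulZl smulZr scalerA.
by rewrite (cnZ cn) normcM normc_conj -expr2.
Qed.

Lemma col_entry_le xi k : finite_col xi -> rnorm (xi k) <= col_norm xi.
Proof.
move=> [n xn]; have xn' := supp_belowW (leq_maxl n k.+1) xn.
rewrite -(@ler_pXn2r _ 2)// ?nnegrE ?(cn_ge0 cn) ?col_norm_ge0//.
rewrite col_norm_sqr (@col_ipE (maxn n k.+1)); last by left.
have kn : (k < maxn n k.+1)%N by rewrite leq_maxr.
have := cn_sum_sqr_ge cn (fun i : 'I_(maxn n k.+1) => xi i) (mem_index_enum (Ordinal kn)).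
by [].
Qed.

Lemma col_norm_le_sum n xi : supp_below n xi -> col_norm xi <= \sum_(k < n) rnorm (xi k).
Proof.
move=> xn; rewrite -(@ler_pXn2r _ 2)// ?nnegrE ?col_norm_ge0 ?sumr_ge0//; last first.
  by move=> *; exact: (cn_ge0 cn).
rewrite col_norm_sqr (col_ipE (or_introl xn)).
apply: le_trans (sumr_sqr_le _ _); last by move=> *; exact: (cn_ge0 cn).
by apply: (le_trans (cn_sum cn _ _ _)); apply: ler_sum => k _; rewrite (cnC cn).
Qed.

Definition unit_col j (b : B) : nat -> B := fun k => if k == j then b else 0.

Lemma unit_colE j b : unit_col j b j = b.
Proof. by rewrite /unit_col eqxx. Qed.

Lemma unit_col_neq j b k : k != j -> unit_col j b k = 0.
Proof. by rewrite /unit_col => /negbTE ->. Qed.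

Lemma unit_col_supp j b : supp_below j.+1 (unit_col j b).
Proof. by move=> k jk; rewrite /unit_col gtn_eqF. Qed.

Lemma col_norm_unit j b : col_norm (unit_col j b) = rnorm b.
Proof.
apply/le_anti/andP; split.
  apply: (le_trans (col_norm_le_sum (@unit_col_supp j b))).
  rewrite (bigD1 ord_max)//= unit_colE big1 ?addr0// => k kj.
  by rewrite unit_col_neq ?(cn0 cn)//; apply: contraNN kj => /eqP kj; exact/eqP/val_inj.
have := @col_entry_le (unit_col j b) j; rewrite unit_colE; apply.
by exists j.+1; exact: unit_col_supp.
Qed.

Lemma mx_colE n x xi i : in_corner n (mx_of x) \/ supp_below n xi ->
  mx_col x xi i = \sum_(k < n) (mx_of x i k ** xi k).
Proof.
move=> h; apply: sum_corner => k nk; case: h => h.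
- by rewrite h ?nk ?orbT// smul0r.
- by rewrite h// smulr0.
Qed.

Lemma mx_col_supp n x xi : in_corner n (mx_of x) -> supp_below n (mx_col x xi).
Proof.
move=> xn k nk; rewrite (mx_colE _ (or_introl xn)) big1// => i _.
by rewrite xn ?nk// smul0r.
Qed.

Lemma mx_col_finite x xi : finite_col (mx_col x xi).
Proof. by have [n xn] := Minf_corner x; exists n; exact: mx_col_supp. Qed.

Lemma mx_colM x y xi : mx_col (x ** y) xi = mx_col x (mx_col y xi).
Proof.
have [n xn] := Minf_corner x; have [m ym] := Minf_corner y.
have xq := in_cornerW (leq_maxl n m) xn; have yq := in_cornerW (leq_maxr n m) ym.
apply/funext => i; rewrite (mx_colE _ (or_introl xq)).
rewrite (@mx_colE (maxn n m)); last by left; exact: mx_mul_corner.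
under eq_bigr => k _ do rewrite /= (mx_mulE _ _ (or_introl xq)) smul_suml.
rewrite exchange_big /=; apply: eq_bigr => k _.
rewrite (mx_colE _ (or_introl yq)) smul_sumr.
by apply: eq_bigr => l _; rewrite smulA.
Qed.

Lemma mx_colD x y xi : mx_col (x + y) xi = fun k => mx_col x xi k + mx_col y xi k.
Proof.
have [n xn] := Minf_corner x; have [m ym] := Minf_corner y.
have xq := in_cornerW (leq_maxl n m) xn; have yq := in_cornerW (leq_maxr n m) ym.
have xyq : in_corner (maxn n m) (mx_of (x + y)).
  by move=> i j h; rewrite Minf_addE xq// yq// addr0.
apply/funext => i; rewrite !(@mx_colE (maxn n m)); [|by left..].
by rewrite -big_split; apply: eq_bigr => k _; rewrite Minf_addE smulDl.
Qed.

Lemma mx_colZ (c : R[i]) x xi : mx_col (c *: x) xi = fun k => c *: mx_col x xi k.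
Proof.
have [n xn] := Minf_corner x.
have cxn : in_corner n (mx_of (c *: x)).
  by move=> i j h; rewrite Minf_scaleE xn// scaler0.
apply/funext => i; rewrite !(@mx_colE n); [|by left..].
by rewrite scaler_sumr; apply: eq_bigr => k _; rewrite Minf_scaleE smulZl.
Qed.

Lemma mx_colZr (c : R[i]) x xi : mx_col x (fun k => c *: xi k) = fun k => c *: mx_col x xi k.
Proof.
have [n xn] := Minf_corner x.
apply/funext => i; rewrite !(@mx_colE n); [|by left..].
by rewrite scaler_sumr; apply: eq_bigr => k _; rewrite smulZr.
Qed.

Lemma mx_col_adj x xi eta : col_ip (mx_col x xi) eta = col_ip xi (mx_col (star x) eta).
Proof.
have [n xn] := Minf_corner x.
have sxn : in_corner n (mx_of (star x)).
  by move=> i j h /=; rewrite xn ?star0// orbC.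
rewrite (@col_ipE n); last by left; exact: mx_col_supp.
rewrite (@col_ipE n); last by right; exact: mx_col_supp.
under eq_bigr => k _ do rewrite (mx_colE _ (or_introl xn)) star_sum smul_suml.
rewrite exchange_big; apply: eq_bigr => k _ /=.
rewrite (mx_colE _ (or_introl sxn)) smul_sumr; apply: eq_bigr => l _ /=.
by rewrite starM smulA.
Qed.

Lemma mx_col_unit x i j b : mx_col x (unit_col j b) i = mx_of x i j ** b.
Proof.
rewrite (mx_colE _ (or_intror (@unit_col_supp j b))) (bigD1 ord_max)//=.
rewrite unit_colE big1 ?addr0// => k kj.
by rewrite unit_col_neq ?smulr0//; apply: contraNN kj => /eqP kj; exact/eqP/val_inj.
Qed.

Lemma mx_col_bound n x xi : in_corner n (mx_of x) -> finite_col xi -> col_norm xi <= 1 ->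
  col_norm (mx_col x xi) <= \sum_(i < n) \sum_(k < n) rnorm (mx_of x i k).
Proof.
move=> xn fxi xi1; apply: (le_trans (col_norm_le_sum (mx_col_supp _ xn))).
apply: ler_sum => i _; rewrite (mx_colE _ (or_introl xn)).
apply: (le_trans (cn_sum cn _ _ _)); apply: ler_sum => k _.
rewrite (le_trans (cnM cn _ _))// ler_piMr ?(cn_ge0 cn)//.
exact: le_trans (col_entry_le _ fxi) xi1.
Qed.

Let has_sup_Minf x : has_sup [set col_norm (mx_col x xi) |
  xi in [set xi | finite_col xi /\ col_norm xi <= 1]].
Proof.
split.
  exists (col_norm (mx_col x (unit_col 0 0))), (unit_col 0 0) => //=.
  by rewrite col_norm_unit (cn0 cn); split=> //; exists 1%N; exact: unit_col_supp.
have [n xn] := Minf_corner x.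
by exists (\sum_(i < n) \sum_(k < n) rnorm (mx_of x i k)) => _ [xi [? ?] <-]; exact: mx_col_bound.
Qed.

Lemma Minf_norm_le x c : (forall xi, finite_col xi -> col_norm xi <= 1 ->
  col_norm (mx_col x xi) <= c) -> Minf_norm x <= c.
Proof.
move=> h; apply: ge_sup; first by have [] := has_sup_Minf x.
by move=> _ [xi [? ?] <-]; exact: h.
Qed.

Lemma Minf_norm_ge x xi : finite_col xi -> col_norm xi <= 1 ->
  col_norm (mx_col x xi) <= Minf_norm x.
Proof. by move=> fx x1; apply: ub_le_sup; [have [] := has_sup_Minf x | exists xi]. Qed.

Lemma Minf_norm_ge0 x : 0 <= Minf_norm x.
Proof.
apply: le_trans (col_norm_ge0 _) (@Minf_norm_ge x (unit_col 0 0) _ _).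
  by exists 1%N; exact: unit_col_supp.
by rewrite col_norm_unit (cn0 cn).
Qed.

Lemma mx_col_le x xi : finite_col xi ->
  col_norm (mx_col x xi) <= Minf_norm x * col_norm xi.
Proof.
move=> fx; have [x0|x0] := eqVneq (col_norm xi) 0.
  have xi0 k : xi k = 0.
    apply: (cn_eq0 cn); apply/le_anti; rewrite (cn_ge0 cn) andbT -x0.
    exact: col_entry_le.
  rewrite x0 mulr0; have [n xn] := Minf_corner x.
  apply: (le_trans (col_norm_le_sum (mx_col_supp _ xn))).
  rewrite big1// => k _; rewrite (mx_colE _ (or_introl xn)) big1 ?(cn0 cn)//.
  by move=> j _; rewrite xi0 smulr0.
have xp : 0 < col_norm xi by rewrite lt_neqAle eq_sym x0 col_norm_ge0.
have E := col_normZ ((col_norm xi)^-1%:C) fx.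
rewrite normcR gtr0_norm ?invr_gt0// mulVf// in E.
have := @Minf_norm_ge x (fun k => (col_norm xi)^-1%:C *: xi k).
rewrite E mx_colZr col_normZ; last exact: mx_col_finite.
rewrite normcR gtr0_norm ?invr_gt0// ler_pdivrMl// mulrC; apply=> //.
by have [n xn] := fx; exists n => k nk; rewrite xn// scaler0.
Qed.

(** Tested on the column carrying the adjoint of the entry [b]: the image has the entry [b b^*], of
    norm [rnorm b ^ 2]. *)
Lemma Minf_entry_le x i j : rnorm (mx_of x i j) <= Minf_norm x.
Proof.
have fu : finite_col (unit_col j (star (mx_of x i j))).
  by exists j.+1; exact: unit_col_supp.
have := le_trans (col_entry_le i (mx_col_finite x _)) (mx_col_le x fu).
rewrite mx_col_unit col_norm_unit (cn_star cn) -{1}(starK (mx_of x i j)).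
rewrite (cnC cn) (cn_star cn) expr2.
have [->|x0] := eqVneq (rnorm (mx_of x i j)) 0; first by rewrite Minf_norm_ge0.
by rewrite ler_pM2r// lt_neqAle eq_sym x0 (cn_ge0 cn).
Qed.

(** Crude, yet enough to deduce convergence from that of the entries, and to start the power
    trick. *)
Lemma Minf_norm_le_entries n x e : in_corner n (mx_of x) ->
  (forall i j, rnorm (mx_of x i j) <= e) -> Minf_norm x <= n%:R * (n%:R * e).
Proof.
move=> xn h; apply: Minf_norm_le => xi fx x1.
apply: (le_trans (mx_col_bound xn fx x1)).
rewrite !mulr_natl -[X in _ *+ X]card_ord -sumr_const; apply: ler_sum => i _.
by rewrite -[X in _ *+ X]card_ord -sumr_const; apply: ler_sum => j _.
Qed.

Lemma cstar_norm_Minf : cstar_norm (@Minf_norm R B).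
Proof.
apply: cstar_norm_of_le; last exact: Minf_norm_ge0.
- move=> x y; apply: Minf_norm_le => xi fx x1; rewrite mx_colD.
  rewrite (le_trans (col_normD _ _))//; try exact: mx_col_finite.
  by rewrite lerD// Minf_norm_ge.
- have H (c : R[i]) x : Minf_norm (c *: x) <= normc c * Minf_norm x.
    apply: Minf_norm_le => xi fx x1; rewrite mx_colZ col_normZ; last exact: mx_col_finite.
    by rewrite ler_wpM2l ?normc_ge0// Minf_norm_ge.
  move=> c x; apply/le_anti; rewrite H /=.
  have [->|c0] := eqVneq c 0; first by rewrite normc0 mul0r Minf_norm_ge0.
  have cp : 0 < normc c.
    by rewrite lt_neqAle normc_ge0 andbT eq_sym; apply: contra c0 => /eqP/eq0_normc ->.
  by rewrite -ler_pdivlMl// -normcV -{1}[x](scalerK c0) H.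
- move=> x y; apply: Minf_norm_le => xi fx x1; rewrite mx_colM.
  rewrite (le_trans (mx_col_le _ (mx_col_finite _ _)))//.
  by rewrite ler_wpM2l ?Minf_norm_ge0// Minf_norm_ge.
(* [|x xi|^2 = |<xi, x^* x xi>|] by adjointness, and the Cauchy-Schwarz inequality bounds this by
   the norm of [x^* x]. *)
- move=> x; rewrite -[leRHS]sqr_sqrtr ?Minf_norm_ge0//.
  rewrite lerXn2r ?nnegrE ?sqrtr_ge0 ?Minf_norm_ge0//.
  apply: Minf_norm_le => xi fx x1; rewrite -[leLHS]ger0_norm ?col_norm_ge0//.
  rewrite -sqrtr_sqr ler_wsqrtr// col_norm_sqr mx_col_adj -mx_colM.
  rewrite (le_trans (col_ip_le fx (mx_col_finite _ _)))//.
  rewrite -[leRHS]mul1r ler_pM ?col_norm_ge0//.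
  by rewrite Minf_norm_ge.
- move=> x x0; apply: Minf_eq => i j; apply: (cn_eq0 cn).
  by apply/le_anti; rewrite (cn_ge0 cn) andbT -x0 Minf_entry_le.
Qed.

End columns.

(** * Direct sums in M_oo(B) and operations on order zero maps *)

Section direct_sums.
Variables (R : realType) (B : starAlgType R).
Implicit Types (x y : Minf B).

Lemma dsumE x y i j : mx_of (Minf_dsum x y) i j =
  if odd i == odd j then mx_of (if odd i then y else x) i./2 j./2 else 0.
Proof.
rewrite /= /mx2_to_mx mxE.
have E (b c : bool) : (inord b == inord c :> 'I_2) = (b == c).
  by apply/eqP/eqP => [/(congr1 val)|->//]; rewrite /= !inordK; case: b c => -[].
have E0 (b : bool) : (inord b == ord0 :> 'I_2) = ~~ b.
  by rewrite -(inj_eq val_inj) /= inordK; case: b.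
rewrite E E0; case: eqP => // _.
by case: (odd i).
Qed.

Lemma dsum_corner n x y : in_corner n (mx_of x) -> in_corner n (mx_of y) ->
  in_corner n.*2 (mx_of (Minf_dsum x y)).
Proof.
move=> xn yn i j h; rewrite dsumE; case: eqP => // _.
by case: (odd i); [apply: yn | apply: xn]; rewrite !geq_half_double.
Qed.

Lemma dsumD x y x' y' : Minf_dsum (x + x') (y + y') = Minf_dsum x y + Minf_dsum x' y'.
Proof.
apply: Minf_eq => i j; rewrite Minf_addE !dsumE; case: eqP => _; last by rewrite addr0.
by case: (odd i).
Qed.

Lemma dsumZ (c : R[i]) x y : Minf_dsum (c *: x) (c *: y) = c *: Minf_dsum x y.
Proof.
apply: Minf_eq => i j; rewrite Minf_scaleE !dsumE; case: eqP => _; last by rewrite scaler0.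
by case: (odd i).
Qed.

Lemma dsumB x y x' y' : Minf_dsum (x - x') (y - y') = Minf_dsum x y - Minf_dsum x' y'.
Proof.
by rewrite dsumD -(scaleN1r x') -(scaleN1r y') dsumZ scaleN1r.
Qed.

Lemma dsum0 : Minf_dsum 0 0 = 0 :> Minf B.
Proof. by have := dsumB (0 : Minf B) 0 0 0; rewrite !subrr. Qed.

Lemma dsum_star x y : star (Minf_dsum x y) = Minf_dsum (star x) (star y).
Proof.
apply: Minf_eq => i j.
rewrite [LHS](_ : _ = star (mx_of (Minf_dsum x y) j i))// !dsumE eq_sym.
by case: eqP => [->|_]; [case: (odd j) | rewrite star0].
Qed.

Lemma big_ord_double (V : zmodType) n (F : nat -> V) :
  \sum_(k < n.*2) F k = \sum_(k < n) (F k.*2 + F k.*2.+1).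
Proof.
elim: n => [|n ih]; first by rewrite !big_ord0.
by rewrite doubleS !big_ord_recr /= ih addrA.
Qed.

Lemma dsumM x y x' y' :
  Minf_dsum (x ** x') (y ** y') = Minf_dsum x y ** Minf_dsum x' y'.
Proof.
have [n1 h1] := Minf_corner x; have [n2 h2] := Minf_corner y.
pose n := maxn n1 n2.
have xn := in_cornerW (leq_maxl n1 n2) h1; have yn := in_cornerW (leq_maxr n1 n2) h2.
apply: Minf_eq => i j.
rewrite [RHS](@mx_mulE _ _ n.*2); last by left; exact: dsum_corner.
rewrite (big_ord_double n (fun k => mx_of (Minf_dsum x y) i k ** mx_of (Minf_dsum x' y') k j)).
rewrite dsumE; under eq_bigr => k _.
  rewrite !dsumE /= odd_double /= doubleK uphalf_double; over.
case: (odd i); case: (odd j) => /=; under eq_bigr => k _ do rewrite ?smul0r ?smulr0 ?addr0 ?add0r.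
- by rewrite (mx_mulE _ _ (or_introl yn)).
- by rewrite big1.
- by rewrite big1.
- by rewrite (mx_mulE _ _ (or_introl xn)).
Qed.

End direct_sums.

Section direct_sum_norm.
Variables (R : realType) (B : preCStarType R).
Implicit Types (x y : Minf B).

Let cn := cstar_norm_Minf B.

(** The entrywise bound costs a factor [(2 n)^2], which the power trick removes: [x |-> x^* x]
    commutes with direct sums and preserves the corner of size [n], so one factor serves all
    iterates. *)
Lemma dsum_norm_le x y : Minf_norm (Minf_dsum x y) <= Num.max (Minf_norm x) (Minf_norm y).
Proof.
have [n1 h1] := Minf_corner x; have [n2 h2] := Minf_corner y.
pose n := maxn n1 n2.
pose P (t : Minf B * Minf B) := in_corner n (mx_of t.1) /\ in_corner n (mx_of t.2).
pose sq (t : Minf B * Minf B) := (star t.1 ** t.1, star t.2 ** t.2).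
pose Nm (t : Minf B * Minf B) := Num.max (Minf_norm t.1) (Minf_norm t.2).
have cst (z : Minf B) : in_corner n (mx_of z) -> in_corner n (mx_of (star z ** z)).
  move=> zn; apply: mx_mul_corner => // i j h /=.
  by rewrite zn ?star0// orbC.
rewrite -[leRHS]mul1r.
apply: (@norm_power_trick _ _ P sq (fun t => Minf_norm (Minf_dsum t.1 t.2)) Nm 1
  ((n.*2)%:R * (n.*2)%:R) _ _ _ _ _ _ _ (x, y)) => //.
- by move=> [a b] [? ?]; split; exact: cst.
- by move=> t; exact: (cn_ge0 cn).
- by move=> t; rewrite le_max (cn_ge0 cn).
- move=> [a b] [an bn]; rewrite -mulrA.
  apply: Minf_norm_le_entries => [|i j]; first exact: dsum_corner.
  have N0 := cn_ge0 cn a; rewrite dsumE /Nm /=; case: eqP => _; last first.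
    by rewrite (cn0 (cstar_norm_rnorm B)) le_max N0.
  by rewrite le_max; case: (odd i); rewrite Minf_entry_le// orbT.
- by move=> [a b] _ /=; rewrite mul1r -(cnC cn) dsum_star -dsumM.
- move=> [a b] _; rewrite /Nm /= !(cnC cn) ge_max.
  by rewrite !lerXn2r ?nnegrE ?le_max ?(cn_ge0 cn) ?lexx ?orbT.
- split => /=; [exact: in_cornerW (leq_maxl n1 n2) h1 | exact: in_cornerW (leq_maxr n1 n2) h2].
Qed.

Lemma dsum_norm_leD x y : Minf_norm (Minf_dsum x y) <= Minf_norm x + Minf_norm y.
Proof.
rewrite (le_trans (dsum_norm_le x y))// ge_max lerDl lerDr.
by rewrite !(cn_ge0 cn).
Qed.

End direct_sum_norm.

Section cpc0_constructions.
Variable R : realType.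

Lemma zero_linear (A : localCStarType R) (B : localCStarType R) : linear (fun _ : A => 0 : Minf B).
Proof. by move=> c x y; rewrite scaler0 addr0. Qed.

Section zero.
Variables (A B : localCStarType R).

Definition zero_map := fun _ : A => 0 : Minf B.

HB.instance Definition _ := GRing.isLinear.Build R[i] A (Minf B) *:%R zero_map
  (@zero_linear A B).

Definition cpc0_zero : cpc0 A B.
Proof.
exists zero_map.
- move=> n x _; exists 0; apply/matrixP => i j; rewrite !mxE big1// => k _.
  by rewrite !mxE smulr0.
- move=> a; rewrite (cn0 (cstar_norm_Minf B)); exact: (cn_ge0 (cstar_norm_rnorm A)).
- by move=> a b _ _ _; rewrite smulr0.
Defined.

Variables (phi psi : cpc0 A B).

Definition dsum_map a := Minf_dsum (phi a) (psi a).

Lemma dsum_linear : linear dsum_map.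
Proof. by move=> c x y; rewrite /dsum_map !linearP dsumD dsumZ. Qed.

HB.instance Definition _ := GRing.isLinear.Build R[i] A (Minf B) *:%R dsum_map
  dsum_linear.

Definition cpc0_dsum : cpc0 A B.
Proof.
exists dsum_map.
- move=> n x xp; have [y yE] := cpc0_cp phi xp; have [z zE] := cpc0_cp psi xp.
  exists (\matrix_(i, j) Minf_dsum (y i j) (z i j)); apply/matrixP => i j.
  move/matrixP/(_ i j): yE; move/matrixP/(_ i j): zE; rewrite !mxE /= => zE yE.
  rewrite [LHS]/dsum_map zE yE.
  transitivity (\sum_k Minf_dsum (star (y k i) ** y k j) (star (z k i) ** z k j)).
    elim/big_rec3: _ => [|k a b c _ <-]; first by rewrite dsum0.
    by rewrite dsumD.
  by apply: eq_bigr => k _; rewrite !mxE dsum_star -dsumM.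
- move=> a; apply: (le_trans (dsum_norm_le _ _)).
  by rewrite ge_max !cpc0_contractive.
- move=> a b pa pb ab; rewrite /= /dsum_map -dsumM.
  by rewrite !(cpc0_order_zero _ pa pb ab) dsum0.
Defined.

End zero.

Section composition.
Variables (A A' B : localCStarType R) (f : star_hom A A') (psi : cpc0 A' B).

Definition cpc0_comp : cpc0 A B.
Proof.
exists (psi \o f : {linear A -> Minf B}).
- move=> n x [y ->]; have -> : map_mx (psi \o f) (\matrix_(i, j) \sum_k star (y k i) ** y k j) =
      map_mx psi (\matrix_(i, j) \sum_k star (map_mx f y k i) ** map_mx f y k j).
    apply/matrixP => i j; rewrite !mxE /= linear_sum; congr (psi _).
    by apply: eq_bigr => k _; rewrite !mxE star_homM star_homV.
  by apply: cpc0_cp; exists (map_mx f y).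
- move=> a; apply: (le_trans (cpc0_contractive psi (f a))).
  exact: star_hom_contractive.
- move=> a b [x ->] [y ->] ab /=; apply: cpc0_order_zero.
  + by exists (f x); rewrite star_homM star_homV.
  + by exists (f y); rewrite star_homM star_homV.
  + by rewrite -star_homM ab linear0.
Defined.

End composition.
End cpc0_constructions.

(** * Order zero maps *)

Section order_zero_maps.
Variables (R : realType) (A B : localCStarType R) (psi : cpc0 A B).
Implicit Types (a b c z w : A) (u v x y : Minf B).

Let cnA := cstar_norm_rnorm A.
Let cnMB := cstar_norm_Minf B.
Local Notation M := (@Minf_norm R B).

(** Complete positivity on the 2 by 2 Gram matrix of the row [z, w]. The row is padded by a row of
    zeros, since positive matrices are defined through square factors. *)
Lemma cp_gram z w : exists p q : 'I_2 -> Minf B,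
  [/\ psi (star z ** z) = \sum_k star (p k) ** p k,
      psi (star z ** w) = \sum_k star (p k) ** q k,
      psi (star w ** z) = \sum_k star (q k) ** p k &
      psi (star w ** w) = \sum_k star (q k) ** q k].
Proof.
have [y [y00 y01 y1]] : exists y : 'M[A]_2,
    [/\ y 0 0 = z, y 0 1 = w & forall i, y (lift ord0 ord0) i = 0].
  exists (\matrix_(k, i) if k == 0 then if i == 0 then z else w else 0).
  by split=> [||i]; rewrite mxE.
have : mx_positive (\matrix_(i, j) \sum_k star (y k i) ** y k j) by exists y.
move=> /(cpc0_cp psi)[Y YE]; exists (Y^~ 0), (Y^~ 1).
have E i j : psi (star (y 0 i) ** y 0 j) = \sum_k star (Y k i) ** Y k j.
  have /matrixP/(_ i j) := YE; rewrite !mxE => <-; congr (psi _).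
  by rewrite big_ord_recl big_ord1 y1 star0 smul0r addr0.
by split; rewrite -E ?y00 ?y01.
Qed.

Lemma cp_cauchy_schwarz z w u v :
  M (star u ** psi (star z ** w) ** v) ^+ 2 <=
  M (star u ** psi (star z ** z) ** u) * M (star v ** psi (star w ** w) ** v).
Proof.
have [p [q [-> -> _ ->]]] := cp_gram z w.
have E (s t : Minf B) (f g : 'I_2 -> Minf B) :
    star s ** (\sum_k star (f k) ** g k) ** t =
    \sum_k star (f k ** s) ** (g k ** t).
  rewrite smul_sumr smul_suml; apply: eq_bigr => k _.
  by rewrite starM !smulA.
by rewrite !E; exact: (cn_cauchy_schwarz cnMB).
Qed.

(** Gram matrices give the claim for products [f ** a] with [f] self-adjoint; an approximate unit
    extends it to [a] itself. *)
Lemma cpc0_star a : psi (star a) = star (psi a).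
Proof.
apply/eqP; rewrite -subr_eq0; apply/eqP/(cn_eq0 cnMB)/le_anti.
rewrite (cn_ge0 cnMB) andbT; apply/ler_addgt0Pr => e e0; rewrite add0r.
have [f [fs [_ fa]]] := approx_unit A.
have [n0 /(_ n0 (leqnn _)) hn] := fa a _ (divr_gt0 e0 (ltr0n R 2)).
have E : psi (star (f n0 ** a)) = star (psi (f n0 ** a)).
  have [p [q [_ h1 h2 _]]] := cp_gram (f n0) a.
  rewrite starM fs; rewrite fs in h1 h2; rewrite h1 h2 star_sum.
  by apply: eq_bigr => k _; rewrite starM starK.
have -> : psi (star a) - star (psi a) =
    psi (star (a - f n0 ** a)) - star (psi (a - f n0 ** a)).
  by rewrite starB !linearB /= starB E opprB addrA subrK.
rewrite (splitr e) (le_trans (cnB cnMB _ _))// lerD//.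
  by rewrite (le_trans (cpc0_contractive psi _))// (cn_star cnA).
by rewrite (cn_star cnMB) (le_trans (cpc0_contractive psi _)).
Qed.

(** For [v = psi(a) x], the element [v^* v] is the limit of [x^* psi(a^* f_n) v], to which the
    Cauchy-Schwarz inequality applies, [psi(f_n^2)] having norm at most 4. The constant is
    immaterial: the inequality serves to show that products vanish. *)
Lemma kadison_schwarz a x : M (psi a ** x) ^+ 2 <= 4 * M (star x ** psi (star a ** a) ** x).
Proof.
set v := psi a ** x; set K := M (star x ** _ ** x).
have K0 : 0 <= K by exact: (cn_ge0 cnMB).
have v0 : 0 <= M v by exact: (cn_ge0 cnMB).
have [f [fs [f2 fa]]] := approx_unit A.
have vv : M v ^+ 2 <= 2 * Num.sqrt K * M v.
  apply/ler_addgt0Pr => e e0.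
  have D0 : 0 < M x * M v + 1 by rewrite ltr_wpDl// mulr_ge0// (cn_ge0 cnMB).
  have [n0 /(_ n0 (leqnn _)) hn] := fa a _ (divr_gt0 e0 D0).
  have h1 : M (star x ** psi (star a ** f n0) ** v) <= 2 * Num.sqrt K * M v.
    rewrite -(@ler_pXn2r _ 2)// ?nnegrE ?mulr_ge0 ?sqrtr_ge0 ?(cn_ge0 cnMB)//.
    rewrite (le_trans (cp_cauchy_schwarz _ _ _ _))// !exprMn sqr_sqrtr//.
    rewrite (_ : 2 ^+ 2 * K * M v ^+ 2 = K * (4 * M v ^+ 2)); last by ring.
    rewrite ler_wpM2l//.
    have h : M (psi (star (f n0) ** f n0)) <= 4.
      rewrite (le_trans (cpc0_contractive psi _))// (cnC cnA).
      by rewrite (_ : 4 = 2 ^+ 2) ?lerXn2r ?nnegrE ?(cn_ge0 cnA)//; ring.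
    rewrite (le_trans (cnM cnMB _ _))// expr2 mulrA ler_wpM2r//.
    rewrite (le_trans (cnM cnMB _ _))// (cn_star cnMB) mulrC ler_wpM2r//.
  have h2 : M (star x ** psi (star (a - f n0 ** a)) ** v) <= e.
    have ha : M (psi (star (a - f n0 ** a))) <= e / (M x * M v + 1).
      by rewrite (le_trans (cpc0_contractive psi _))// (cn_star cnA).
    rewrite (le_trans (cnM cnMB _ _))//.
    have := ler_wpM2r v0 (cnM cnMB (star x) (psi (star (a - f n0 ** a)))).
    move=> /le_trans; apply; rewrite (cn_star cnMB).
    have := ler_wpM2l (mulr_ge0 (cn_ge0 cnMB x) v0) ha.
    rewrite mulrAC => /le_trans; apply.
    by rewrite mulrCA ler_piMr ?(ltW e0)// ler_pdivrMr// mul1r lerDl.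
  have -> : M v ^+ 2 = M (star x ** psi (star a ** f n0) ** v +
      star x ** psi (star (a - f n0 ** a)) ** v).
    rewrite -smulDl -smulDr -linearD /= -(cnC cnMB) {1}/v starM -cpc0_star.
    by rewrite starB starM fs addrC subrK.
  by rewrite (le_trans (cnD cnMB _ _))// lerD.
have [v00|vn] := eqVneq (M v) 0; first by rewrite v00 expr0n mulr_ge0.
have vp : 0 < M v by rewrite lt_neqAle eq_sym vn.
move: vv; rewrite expr2 ler_pM2r// => vK.
rewrite -expr2 (le_trans (lerXn2r 2 _ _ vK)) ?nnegrE ?mulr_ge0 ?sqrtr_ge0//.
by rewrite exprMn sqr_sqrtr// ler_wpM2r//; lra.
Qed.

(** If [a b = 0], the positive elements [a^* a] and [b b^*] are orthogonal, so the order zero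
    condition applies to them. The Kadison-Schwarz inequality then removes the squares, first on the
    right and then on the left. *)
Lemma cpc0_zero_product a b : a ** b = 0 -> psi a ** psi b = 0.
Proof.
move=> ab; apply: (cn_eq0 cnMB).
pose w := psi (star a ** a).
have sw : star w = w by rewrite -cpc0_star starM starK.
have wb : w ** psi (b ** star b) = 0.
  apply: cpc0_order_zero; [by exists a | by exists (star b); rewrite starK |].
  by rewrite smulA -(smulA (star a)) ab smulr0 smul0r.
have wb0 : w ** psi b = 0.
  rewrite -[LHS]starK starM sw -cpc0_star.
  suff -> : psi (star b) ** w = 0 by rewrite star0.
  apply: (cn_eq0 cnMB); have := kadison_schwarz (star b) w.
  rewrite starK sw wb smul0r (cn0 cnMB) mulr0 => h.
  by apply/eqP; rewrite -sqrf_eq0; apply/eqP/le_anti; rewrite h sqr_ge0.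
have := kadison_schwarz a (psi b); rewrite -/w -smulA wb0 smulr0 (cn0 cnMB) mulr0 => h.
by apply/eqP; rewrite -sqrf_eq0; apply/eqP/le_anti; rewrite h sqr_ge0.
Qed.

End order_zero_maps.

(** * Polynomial approximation of piecewise linear functions on [-1, 1] *)

Section approximable_functions.
Variable R : realType.
Implicit Types (f g : R -> R) (t r e : R).

Definition approximable f := forall e, 0 < e ->
  exists p : {poly R}, forall t, `|t| <= 1 -> `|f t - p.[t]| <= e.

Lemma approximable_poly (p : {poly R}) : approximable (horner p).
Proof. by move=> e e0; exists p => t _; rewrite subrr normr0 ltW. Qed.

Lemma approximableD f g : approximable f -> approximable g ->
  approximable (fun t => f t + g t).
Proof.
move=> hf hg e e0; have e20 : 0 < e / 2 by rewrite divr_gt0.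
have [p hp] := hf _ e20; have [q hq] := hg _ e20; exists (p + q) => t t1.
rewrite hornerD opprD addrACA (splitr e) (le_trans (ler_normD _ _))// lerD//.
  exact: hp.
exact: hq.
Qed.

Lemma approximableZ r f : approximable f -> approximable (fun t => r * f t).
Proof.
move=> hf e e0; have r1 : 0 < `|r| + 1 by rewrite ltr_wpDl.
have [p hp] := hf _ (divr_gt0 e0 r1); exists (r *: p) => t t1.
rewrite hornerZ -mulrBr normrM (le_trans (ler_wpM2l (normr_ge0 r) (hp t t1)))//.
by rewrite mulrCA ler_piMr ?(ltW e0)// ler_pdivrMr// mul1r lerDl.
Qed.

Lemma sqrt_iter_scalar n t : `|t| <= 1 ->
  `|(sqrt_iter R n).[t]| <= sqrt_val R n /\
  `|(sqrt_iter R n.+1).[t] - (sqrt_iter R n).[t]| <= sqrt_val R n.+1 - sqrt_val R n.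
Proof.
move=> t1; have S m : (sqrt_iter R m.+1).[t] = 2^-1 * (t + (sqrt_iter R m).[t] ^+ 2).
  by rewrite /= !hornerE.
elim: n => [|n [ih1 ih2]].
  rewrite S /= horner0 normr0 expr0n/= !addr0 subr0 normrM ger0_norm// subr0 mulr1.
  by split=> //; rewrite ler_piMr.
have ih3 : `|(sqrt_iter R n.+1).[t]| <= sqrt_val R n.+1.
  rewrite S /= normrM ger0_norm// ler_pM2l// (le_trans (ler_normD _ _))// lerD//.
  by rewrite normrX lerXn2r ?nnegrE//; case/andP: (sqrt_val_bounds R n).
split=> //; rewrite S {2}[(sqrt_iter R n.+1).[t]]S.
have -> : sqrt_val R n.+2 - sqrt_val R n.+1 =
    2^-1 * ((sqrt_val R n.+1 - sqrt_val R n) * (sqrt_val R n.+1 + sqrt_val R n)).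
  by rewrite /=; ring.
rewrite [X in `|X|](_ : _ = 2^-1 * (((sqrt_iter R n.+1).[t] - (sqrt_iter R n).[t]) *
   ((sqrt_iter R n.+1).[t] + (sqrt_iter R n).[t]))); last by ring.
rewrite normrM ger0_norm// ler_pM2l// normrM ler_pM//.
by rewrite (le_trans (ler_normD _ _))// lerD.
Qed.

(** As [|t| = sqrt (1 - (1 - t^2))], the square root iteration at [1 - t^2] applies. For nonnegative
    numbers [|u - v|^2 <= |u^2 - v^2|], and here the difference of squares is twice an increment of
    the iteration; hence the tolerance [e^2 / 2]. *)
Lemma abs_approx e : 0 < e -> exists q : {poly R}, forall t, `|t| <= 1 ->
  `|(`|t|) - q.[t]| <= e.
Proof.
move=> e0; have [n hn] := sqrt_val_step (divr_gt0 (exprn_gt0 2 e0) (ltr0n R 2)).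
pose Y := sqrt_iter R n; exists (1 - (Y \Po (1 - 'X ^+ 2))) => t t1.
rewrite hornerD hornerN horner_comp !hornerE; set a := 1 - t ^+ 2.
have t2 : t ^+ 2 <= 1 by rewrite -real_normK ?num_real// expr_le1.
have a1 : `|a| <= 1 by rewrite ger0_norm /a; have := sqr_ge0 t; lra.
have [hY hd] := sqrt_iter_scalar n a1; have /andP[v0 v1] := sqrt_val_bounds R n.
rewrite -/Y in hY hd; set y := Y.[a] in hY hd *.
have q0 : 0 <= 1 - y by move: hY; rewrite ler_norml; lra.
rewrite -(@ler_pXn2r _ 2)// ?nnegrE ?(ltW e0)//.
apply: (@le_trans _ _ `|(`|t|) ^+ 2 - (1 - y) ^+ 2|).
  have s0 : 0 <= `|t| + (1 - y) by exact: addr_ge0.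
  rewrite subr_sqr normrM expr2 ler_wpM2l// [leRHS]ger0_norm//.
  by rewrite (le_trans (ler_normB _ _))// normr_id (ger0_norm q0).
rewrite real_normK ?num_real//.
have -> : t ^+ 2 - (1 - y) ^+ 2 = - (2 * ((sqrt_iter R n.+1).[a] - y)).
  by rewrite /= !hornerE -/Y -/y /a; field.
rewrite normrN normrM ger0_norm//.
by have := le_trans hd hn; lra.
Qed.

Lemma approximable_abs r : approximable (fun t => `|t - r|).
Proof.
have [r1|r1] := leP `|r| 1; last first.
  move=> e e0; exists (if 0 < r then r%:P - 'X else 'X - r%:P) => t.
  rewrite ler_norml => /andP[t1 t2]; move: r1; case: ifP => r0.
    rewrite !hornerE gtr0_norm// => r1.
    have -> : `|t - r| = r - t by rewrite ler0_norm ?opprB//; lra.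
    by rewrite subrr normr0 ltW.
  have {}r0 : r <= 0 by rewrite leNgt r0.
  rewrite !hornerE ler0_norm// => r1.
  have -> : `|t - r| = t - r by rewrite ger0_norm//; lra.
  by rewrite subrr normr0 ltW.
move=> e e0; have [q hq] := abs_approx (divr_gt0 e0 (ltr0n R 2)).
exists (2 *: (q \Po (2^-1 *: ('X - r%:P)))) => t t1.
rewrite hornerZ horner_comp hornerZ !hornerE.
have x1 : `|2^-1 * (t - r)| <= 1.
  rewrite normrM ger0_norm// ler_pdivrMl// mulr1 (le_trans (ler_normB _ _))//.
  by rewrite (_ : 2 = 1 + 1)// lerD.
have -> : `|t - r| = 2 * `|2^-1 * (t - r)|.
  by rewrite normrM [`|2^-1|]ger0_norm// mulrA mulfV// mul1r.
rewrite -mulrBr normrM ger0_norm//.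
by have := hq _ x1; lra.
Qed.

Definition clamp (t : R) := Num.min 1 (Num.max 0 t).

Lemma clampE t : clamp t = 2^-1 * (`|t| - `|t - 1| + 1).
Proof.
rewrite /clamp; have [t0|t0] := leP 0 t.
  have [t1|t1] := leP 1 t.
    by rewrite !ger0_norm ?subr_ge0//; lra.
  by rewrite ger0_norm// ltr0_norm ?subr_lt0//; lra.
have t1 : t - 1 < 0 by lra.
by rewrite min_r// (ltr0_norm t0) (ltr0_norm t1); lra.
Qed.

Lemma clamp_bounds t : 0 <= clamp t <= 1.
Proof. by rewrite /clamp le_min ge_min le_max ler01 !lexx. Qed.

Lemma clamp0 t : t <= 0 -> clamp t = 0.
Proof. by move=> t0; rewrite /clamp max_l// min_r. Qed.

Lemma clamp1 t : 1 <= t -> clamp t = 1.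
Proof. by move=> t1; rewrite /clamp max_r ?(le_trans ler01)// min_l. Qed.

Lemma clamp_homo s t : s <= t -> clamp s <= clamp t.
Proof.
move=> st; rewrite /clamp le_min ge_min lexx /= ge_min; apply/orP; right.
by rewrite ge_max !le_max lexx st orbT.
Qed.

(* [tent i] is the piecewise linear function of a rescaled variable
   [s] in [0, n] which is [1] at [i] and [0] at the other integers. *)
Definition tent (i : nat) (s : R) := clamp (s + 1 - i%:R) - clamp (s - i%:R).

Lemma tent_ge0 i s : 0 <= tent i s.
Proof. by rewrite subr_ge0 clamp_homo//; lra. Qed.

Lemma tentM0 i j s : (i.+2 <= j)%N -> tent i s * tent j s = 0.
Proof.
move=> ij; have ij' : i%:R + 2 <= j%:R :> R by rewrite -natrD addn2 ler_nat.
have [si|si] := leP (s + 1 - j%:R) 0.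
  by rewrite [tent j s]/tent !clamp0 ?subrr ?mulr0//; lra.
by rewrite [tent i s]/tent !clamp1 ?subrr ?mul0r//; lra.
Qed.

(** The remainder terms in [clamp] are kept so that the induction on [n] goes through for all
    [s >= 0]; they vanish for [s <= n]. *)
Lemma tent_sums n s : 0 <= s ->
  \sum_(i < n.+1) tent i s = 1 - clamp (s - n%:R) /\
  \sum_(i < n.+1) i%:R * tent i s = Num.min s n%:R - n%:R * clamp (s - n%:R).
Proof.
move=> s0; elim: n => [|n [ih1 ih2]].
  by rewrite !big_ord1 /tent mul0r subr0 min_r// mul0r subrr clamp1// lerDr.
rewrite big_ord_recr ih1 [X in _ /\ X = _]big_ord_recr ih2 /= /tent.
have -> : s + 1 - n.+1%:R = s - n%:R by rewrite -natr1; ring.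
split; first by ring.
have -> : Num.min s n.+1%:R = Num.min s n%:R + clamp (s - n%:R).
  rewrite -natr1; have [sn|sn] := leP s n%:R.
    by rewrite clamp0 ?subr_le0// addr0 min_l//; lra.
  have [sn1|sn1] := leP s (n%:R + 1).
    by rewrite /clamp max_r ?min_r; lra.
  by rewrite clamp1//; lra.
by rewrite -natr1; ring.
Qed.

Lemma tent_sum1 n s : 0 <= s -> s <= n%:R -> \sum_(i < n.+1) tent i s = 1.
Proof. by move=> s0 sn; have [-> _] := tent_sums n s0; rewrite clamp0 ?subr0 ?subr_le0. Qed.

Lemma tent_sum_id n s : 0 <= s -> s <= n%:R -> \sum_(i < n.+1) i%:R * tent i s = s.
Proof.
move=> s0 sn; have [_ ->] := tent_sums n s0.
by rewrite clamp0 ?subr_le0// mulr0 subr0 min_l.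
Qed.

Lemma approximable_ext f g : (forall t, `|t| <= 1 -> f t = g t) ->
  approximable f -> approximable g.
Proof. by move=> fg hf e /hf[p hp]; exists p => t t1; rewrite -fg// hp. Qed.

Definition rescale (n : nat) (t : R) := n%:R / 2 * (t + 1).

Lemma rescale_bounds n t : `|t| <= 1 -> 0 <= rescale n t <= n%:R.
Proof.
rewrite ler_norml => /andP[t1 t2]; have := ler0n R n.
by rewrite /rescale; nra.
Qed.

Lemma approximable_clamp n (c : R) : (0 < n)%N ->
  approximable (fun t => clamp (rescale n t - c)).
Proof.
move=> n0; have n0' : 0 < n%:R :> R by rewrite ltr0n.
have ab (d : R) : approximable (fun t => `|rescale n t - d|).
  apply: (@approximable_ext (fun t => n%:R / 2 * `|t - (2 * d / n%:R - 1)|)).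
    move=> t _; rewrite -[n%:R / 2]ger0_norm ?divr_ge0// -normrM; congr (`| _ |).
    by rewrite /rescale; field; rewrite gt_eqF.
  by apply: approximableZ; exact: approximable_abs.
apply: (@approximable_ext (fun t => 2^-1 * (`|rescale n t - c| +
    (-1 * `|rescale n t - (c + 1)| + (1%:P : {poly R}).[t])))).
  move=> t _; rewrite clampE hornerC.
  have -> : rescale n t - (c + 1) = rescale n t - c - 1 by ring.
  by ring.
apply: approximableZ; apply: approximableD => //; apply: approximableD.
  exact: approximableZ.
exact: approximable_poly.
Qed.

Lemma approximable_tent n i : (0 < n)%N -> approximable (fun t => tent i (rescale n t)).
Proof.
move=> n0; apply: (@approximable_ext (fun t => clamp (rescale n t - (i%:R - 1)) +
    -1 * clamp (rescale n t - i%:R))).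
  by move=> t _; rewrite /tent opprB addrA mulN1r addrAC.
apply: approximableD; first exact: approximable_clamp.
by apply: approximableZ; exact: approximable_clamp.
Qed.

End approximable_functions.

(** * Functional calculus for approximable functions *)

Definition complete_around (R : realType) (D : starAlgType R) (N : D -> R) (b : D) :=
  exists S : set D, [/\ S b, S 0, (forall x y, S x -> S y -> S (x + y)),
    (forall (c : R[i]) x, S x -> S (c *: x)) /\
    (forall x y, S x -> S y -> S (x ** y)) &
    forall u : nat -> D, (forall n, S (u n)) ->
    (forall e, 0 < e -> exists n0, forall m n, (n0 <= m)%N -> (n0 <= n)%N ->
       N (u m - u n) <= e) ->
    exists2 l, S l & forall e, 0 < e ->
      exists n0, forall n, (n0 <= n)%N -> N (u n - l) <= e].

Lemma local_complete_around (R : realType) (A : localCStarType R) (b : A) :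
  complete_around (@rnorm R A) b.
Proof.
have [S [hS Sb]] := local_complete b; have [S0 SD SZ [SM _] _] := hS.
by exists S; split=> // u Su; exact: cstar_subalgebra_lim.
Qed.

Section functional_calculus.
Variables (R : realType) (A : starAlgType R) (nm : A -> R) (cnA : cstar_norm nm).
Variable b : A.
Hypotheses (sb : star b = b) (b1 : nm b <= 1).
Local Notation U := (unitization A : algType R[i]).
Implicit Types (f g : R -> R) (F G : U) (p q : {poly R}).

Let cs := cstar_seminorm_unitization cnA.
Local Notation N := (unorm nm).

Let sab : sa (@ustar R A) (uinj b). Proof. by rewrite /sa -uinj_star sb. Qed.
Let nb1 : N (uinj b) <= 1. Proof. by rewrite (unorm_inj cnA). Qed.

(** One polynomial approximates [f] on [[-1, 1]] and, evaluated at [b], also [F]. A relation is used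
    because a seminorm does not determine [F] from [f], and because completeness is then confined to
    the existence of [F]. *)
Definition fun_calc f F := forall e, 0 < e -> exists2 p : {poly R},
  (forall t, `|t| <= 1 -> `|f t - p.[t]| <= e) & N (F - peval (uinj b) p) <= e.

Lemma fun_calc_poly p : fun_calc (horner p) (peval (uinj b) p).
Proof.
move=> e e0; exists p; first by move=> t _; rewrite subrr normr0 ltW.
by rewrite subrr (csn0 cs) ltW.
Qed.

Lemma fun_calcD f g F G : fun_calc f F -> fun_calc g G ->
  fun_calc (fun t => f t + g t) (F + G).
Proof.
move=> hf hg e e0; have e20 : 0 < e / 2 by rewrite divr_gt0.
have [p fp Fp] := hf _ e20; have [q gq Gq] := hg _ e20; exists (p + q).
  move=> t t1; rewrite hornerD opprD addrACA (splitr e).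
  by rewrite (le_trans (ler_normD _ _))// lerD// ?fp ?gq.
rewrite pevalD opprD addrACA (splitr e).
exact: (le_trans (csnD cs _ _) (lerD Fp Gq)).
Qed.

Lemma fun_calcZ r f F : fun_calc f F -> fun_calc (fun t => r * f t) (r%:C *: F).
Proof.
move=> hf e e0; have r1 : 0 < `|r| + 1 by rewrite ltr_wpDl.
have re : `|r| * (e / (`|r| + 1)) <= e.
  by rewrite mulrCA ler_piMr ?(ltW e0)// ler_pdivrMr// mul1r lerDl.
have [p fp Fp] := hf _ (divr_gt0 e0 r1); exists (r *: p).
  move=> t t1; rewrite hornerZ -mulrBr normrM.
  by rewrite (le_trans (ler_wpM2l (normr_ge0 r) (fp t t1))).
rewrite pevalZ -scalerBr (csnZr cs).
by rewrite (le_trans (ler_wpM2l (normr_ge0 r) Fp)).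
Qed.

Lemma fun_calc_ext f g F : (forall t, `|t| <= 1 -> f t = g t) ->
  fun_calc f F -> fun_calc g F.
Proof. by move=> fg hf e /hf[p hp Fp]; exists p => // t t1; rewrite -fg// hp. Qed.

Lemma fun_calc_sum I (r : seq I) (P : pred I) (f : I -> R -> R) (F : I -> U) :
  (forall i, fun_calc (f i) (F i)) ->
  fun_calc (fun t => \sum_(i <- r | P i) f i t) (\sum_(i <- r | P i) F i).
Proof.
move=> h; elim: r => [|i r ih].
  rewrite big_nil -(peval0 (uinj b)).
  by apply: fun_calc_ext (fun_calc_poly 0) => t _; rewrite horner0 big_nil.
rewrite big_cons; case: ifP => Pi.
  by apply: fun_calc_ext (fun_calcD (h i) ih) => t _; rewrite big_cons Pi.
by apply: fun_calc_ext ih => t _; rewrite big_cons Pi.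
Qed.

Lemma fun_calc_norm f F K : fun_calc f F -> (forall t, `|t| <= 1 -> `|f t| <= K) ->
  N F <= K.
Proof.
move=> hf fK; apply/ler_addgt0Pr => e e0; have [p fp Fp] := hf _ (divr_gt0 e0 (ltr0n R 2)).
have : N (peval (uinj b) p) <= K + e / 2.
  apply: (peval_norm_le cs sab nb1) => t t1.
  have := ler_normB (f t) (f t - p.[t]); rewrite subKr.
  by have := fp t t1; have := fK t t1; lra.
by have := csnD cs (F - peval (uinj b) p) (peval (uinj b) p); rewrite subrK; lra.
Qed.

Lemma fun_calc_exists f : complete_around nm b -> approximable f ->
  exists F, fun_calc f F.
Proof.
move=> [S [Sb S0 SD [SZ SM] Slim]] hf.
have /choice[p hp] : forall n : nat, exists p : {poly R},
    forall t, `|t| <= 1 -> `|f t - p.[t]| <= n.+1%:R^-1.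
  by move=> n; apply: hf; rewrite invr_gt0.
have Sp q : S (peval (uinj b) q).2.
  elim/poly_ind: q => [|q c ih]; first by rewrite peval0.
  rewrite pevalD pevalM pevalX pevalC /= scaler0 addr0.
  by rewrite scale0r addr0; apply: SD; [exact: SZ | exact: SM].
(* The component of [q(b)] in [A] differs from [q(b)] by the scalar [q(0)]; hence uniformly Cauchy
   polynomials have Cauchy components. *)
have sndB q q' : nm ((peval (uinj b) q).2 - (peval (uinj b) q').2) <=
    N (peval (uinj b) (q - q')) + `|(q - q').[0]|.
  have -> : (peval (uinj b) q).2 - (peval (uinj b) q').2 = (peval (uinj b) (q - q')).2.
    by rewrite pevalB.
  set u := peval _ _; rewrite -(unorm_inj cnA).
  have -> : uinj u.2 = u - (q - q').[0]%:C%:A.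
    apply: unitization_ext; rewrite /= ?scaler0 ?subr0//.
    by rewrite peval_inj_fst [_ *: _]mulr1 subrr.
  rewrite (le_trans (csnB cs _ _))// lerD2l (csnZr cs).
  by rewrite ler_piMr// (csn1 cs).
have pB e : 0 < e -> exists n0, forall m n, (n0 <= m)%N -> (n0 <= n)%N ->
    forall t, `|t| <= 1 -> `|(p m - p n).[t]| <= e.
  move=> e0; have [n0 hn0] := exists_small_ratio 1 (divr_gt0 e0 (ltr0n R 2)).
  rewrite mul1r in hn0.
  have H m : (n0 <= m)%N -> m.+1%:R^-1 <= e / 2.
    by move=> n0m; apply: le_trans hn0; rewrite lef_pV2 ?posrE// ler_nat.
  exists n0 => m n n0m n0n t t1; rewrite hornerD hornerN.
  have := ler_normB (f t - (p n).[t]) (f t - (p m).[t]); rewrite opprB addrC subrKA.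
  by have := le_trans (hp m t t1) (H _ n0m); have := le_trans (hp n t t1) (H _ n0n); lra.
have norm01 : `|0 : R| <= 1 by rewrite normr0.
have [e e0|l Sl hl] := Slim _ (fun n => Sp (p n)).
  have [n0 hn0] := pB _ (divr_gt0 e0 (ltr0n R 2)).
  exists n0 => m n n0m n0n; apply: (le_trans (sndB _ _)); rewrite (splitr e) lerD//.
    by apply: (peval_norm_le cs sab nb1) => t; exact: hn0.
  exact: hn0.
(* The limit is taken componentwise, the scalar components being values at 0. *)
exists ((f 0)%:C, l) => e e0.
have [n1 hn1] := exists_small_ratio 1 (divr_gt0 e0 (ltr0n R 2)).
have [n2 hn2] := hl _ (divr_gt0 e0 (ltr0n R 2)).
pose n := maxn n1 n2.
have pe t : `|t| <= 1 -> `|f t - (p n).[t]| <= e / 2.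
  move=> t1; apply: (le_trans (hp n t t1)); apply: le_trans hn1.
  by rewrite mul1r lef_pV2 ?posrE// ler_nat ltnS leq_maxl.
exists (p n); first by move=> t /pe h; apply: (le_trans h); lra.
have -> : ((f 0)%:C, l) - peval (uinj b) (p n) =
    (f 0 - (p n).[0])%:C%:A - uinj ((peval (uinj b) (p n)).2 - l).
  apply: unitization_ext; rewrite /= ?scaler0 ?subr0 ?add0r ?opprB//.
  by rewrite peval_inj_fst [_ *: _]mulr1 rmorphB.
rewrite (splitr e) (le_trans (csnB cs _ _))// lerD//.
  rewrite (csnZr cs) (le_trans _ (pe 0 norm01))//.
  by rewrite ler_piMr// (csn1 cs).
by rewrite (unorm_inj cnA) hn2// leq_maxr.
Qed.

Lemma fun_calc_mul0 f g F G : fun_calc f F -> fun_calc g G ->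
  (forall t, `|t| <= 1 -> [/\ `|f t| <= 1, `|g t| <= 1 & f t * g t = 0]) ->
  N (F * G) <= 0.
Proof.
move=> hf hg fg.
(* [6 = 1 + 2 + 3]: the errors from replacing [F] by [p(b)] and [G] by [q(b)], and the norm of
   [(p q)(b)], small because [f g = 0]. *)
apply: (@le_affine_small _ _ _ 6 1) => // e e0 e1; rewrite add0r.
have [p fp Fp] := hf e e0; have [q gq Gq] := hg e e0.
have p2 t : `|t| <= 1 -> `|p.[t]| <= 2.
  move=> t1; rewrite -[p.[t]](subKr (f t)) (le_trans (ler_normB _ _))//.
  have [f1 _ _] := fg t t1; rewrite (_ : 2 = 1 + 1 :> R)//.
  exact: lerD f1 (le_trans (fp t t1) e1).
have NG : N G <= 1 by apply: (fun_calc_norm hg) => t /fg[].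
have NP : N (peval (uinj b) p) <= 2 by apply: (peval_norm_le cs sab nb1).
have NPQ : N (peval (uinj b) (p * q)) <= 3 * e.
  apply: (peval_norm_le cs sab nb1) => t t1; rewrite hornerM.
  have [_ g1 fg0] := fg t t1.
  have -> : p.[t] * q.[t] = - (p.[t] * (g t - q.[t])) - (f t - p.[t]) * g t.
    by transitivity (p.[t] * q.[t] - f t * g t); [rewrite fg0 subr0 | ring].
  rewrite (le_trans (ler_normB _ _))// normrN !normrM.
  have h1 : `|p.[t]| * `|g t - q.[t]| <= 2 * e by rewrite ler_pM// ?p2 ?gq.
  have h2 : `|f t - p.[t]| * `|g t| <= e * 1 by rewrite ler_pM// fp.
  by rewrite (_ : 3 * e = 2 * e + e * 1) ?lerD//; ring.
have -> : F * G = (F - peval (uinj b) p) * G +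
    (peval (uinj b) p * (G - peval (uinj b) q) + peval (uinj b) (p * q)).
  by rewrite pevalM mulrBr subrK mulrBl subrK.
have h1 := le_trans (csnM cs _ _) (ler_pM (csn_ge0 cs _) (csn_ge0 cs _) Fp NG).
have h2 := le_trans (csnM cs _ _) (ler_pM (csn_ge0 cs _) (csn_ge0 cs _) NP Gq).
rewrite (_ : 6 * e = e * 1 + (2 * e + 3 * e)); last by ring.
apply: (le_trans (csnD cs _ _)); apply: lerD h1 _.
exact: le_trans (csnD cs _ _) (lerD h2 NPQ).
Qed.

End functional_calculus.

(** * Bounded bilinear maps vanishing on zero products *)

Section zero_product.
Variables (R : realType) (A : starAlgType R) (nm : A -> R) (cnA : cstar_norm nm).
Variables (D : starAlgType R) (N : D -> R) (cnD' : cstar_norm N).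
Variable V : A -> A -> D.
Hypotheses (VDl : forall x y c, V (x + y) c = V x c + V y c)
  (VDr : forall a x y, V a (x + y) = V a x + V a y)
  (VZl : forall (k : R[i]) x c, V (k *: x) c = k *: V x c)
  (VZr : forall (k : R[i]) a x, V a (k *: x) = k *: V a x)
  (V_le : forall a c, N (V a c) <= nm a * nm c)
  (V0 : forall a c, a ** c = 0 -> V a c = 0).
Hypothesis complete : forall b, complete_around nm b.
Implicit Types (a b c : A).

Let cs := cstar_seminorm_unitization cnA.
Local Notation U := (unitization A : algType R[i]).

Lemma bilin_suml I (r : seq I) (P : pred I) (F : I -> A) c :
  V (\sum_(i <- r | P i) F i) c = \sum_(i <- r | P i) V (F i) c.
Proof.
apply: (big_morph (V^~ c)) => [x y|]; first exact: VDl.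
by rewrite -(scale0r (0 : A)) VZl scale0r.
Qed.

Lemma bilin_sumr I (r : seq I) (P : pred I) (F : I -> A) a :
  V a (\sum_(i <- r | P i) F i) = \sum_(i <- r | P i) V a (F i).
Proof.
apply: (big_morph (V a)) => [x y|]; first exact: VDr.
by rewrite -(scale0r (0 : A)) VZr scale0r.
Qed.

Section selfadjoint.
Variables (a b c : A) (n : nat).
Hypotheses (sb : star b = b) (b1 : nm b <= 1) (n0 : (0 < n)%N).

Local Notation fc := (fun_calc nm b).

Lemma tent_family : exists T : nat -> U,
  forall i, fc (fun t => tent i (rescale n t)) (T i).
Proof.
suff /choice : forall i, exists F : U, fc (fun t => tent i (rescale n t)) F.
  by move=> [T hT]; exists T.
move=> i; apply: (fun_calc_exists cnA sb b1 (complete b)).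
exact: approximable_tent.
Qed.

Variable T : nat -> U.
Hypothesis TE : forall i, fc (fun t => tent i (rescale n t)) (T i).

Let lft i : A := (T i).1 *: a + a ** (T i).2.
Let rgt i : A := uact (T i) c.

Let lftE i : uinj (lft i) = uinj a * T i :> U.
Proof.
by apply: unitization_ext => /=; [rewrite mul0r | rewrite scale0r add0r].
Qed.

Let rgtE i : uinj (rgt i) = T i * uinj c :> U.
Proof. by rewrite uinj_act. Qed.

Let nm0 x : nm x <= 0 -> x = 0.
Proof. by move=> x0; apply: (cn_eq0 cnA); apply/le_anti; rewrite x0 (cn_ge0 cnA). Qed.

Let orth i j : (i.+2 <= j)%N || (j.+2 <= i)%N -> lft i ** rgt j = 0.
Proof.
move=> ij; apply: nm0; rewrite -(unorm_inj cnA) uinjM lftE rgtE -!mulrA (mulrA (T i)).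
have T0 : unorm nm (T i * T j) <= 0.
  apply: (fun_calc_mul0 cnA sb b1 (TE i) (TE j)) => t t1.
  have tent1 k : `|tent k (rescale n t)| <= 1.
    rewrite ger0_norm ?tent_ge0// /tent.
    have /andP[_ h1] := clamp_bounds (rescale n t + 1 - k%:R).
    by have /andP[h2 _] := clamp_bounds (rescale n t - k%:R); lra.
  by split=> //; case/orP: ij => ij; [|rewrite mulrC]; exact: tentM0.
have T0' : unorm nm (T i * T j) = 0 by apply/le_anti; rewrite T0 (csn_ge0 cs).
apply: (le_trans (csnM cs _ _)); apply: mulr_ge0_le0; first exact: (csn_ge0 cs).
by apply: (le_trans (csnM cs _ _)); rewrite T0' mul0r.
Qed.

(** A partial sum of a partition of unity takes values in [[0, 1]]; this bounds the sums over
    residue classes independently of [n]. *)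
Let sumT (P : pred 'I_n.+1) : unorm nm (\sum_(i < n.+1 | P i) T i) <= 1.
Proof.
have h := fun_calc_sum cnA (index_enum _) P (fun i : 'I_n.+1 => TE i).
apply: (fun_calc_norm cnA sb b1 h) => t t1.
have /andP[s0 sn] := rescale_bounds n t1.
rewrite ger0_norm; last by apply: sumr_ge0 => i _; exact: tent_ge0.
rewrite -(tent_sum1 s0 sn) [leRHS](bigID P) /= lerDl.
by apply: sumr_ge0 => i _; exact: tent_ge0.
Qed.

Let sum_lft_le (P : pred 'I_n.+1) : nm (\sum_(i < n.+1 | P i) lft i) <= nm a.
Proof.
rewrite -(unorm_inj cnA) uinj_sum (eq_bigr _ (fun (i : 'I_n.+1) _ => lftE i)) -mulr_sumr.
apply: (le_trans (csnM cs _ _)); rewrite (unorm_inj cnA).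
exact: (ler_piMr (cn_ge0 cnA _) (sumT _)).
Qed.

Let sum_rgt_le (P : pred 'I_n.+1) : nm (\sum_(i < n.+1 | P i) rgt i) <= nm c.
Proof.
rewrite -(unorm_inj cnA) uinj_sum (eq_bigr _ (fun (i : 'I_n.+1) _ => rgtE i)) -mulr_suml.
apply: (le_trans (csnM cs _ _)); rewrite (unorm_inj cnA).
exact: (ler_piMl (cn_ge0 cnA _) (sumT _)).
Qed.

(** An equality up to the seminorm suffices: after multiplication by [a] or [c] the difference lies
    in [A], where the seminorm is the norm. *)
Let sumT1 : unorm nm (\sum_(i < n.+1) T i - 1) = 0.
Proof.
apply/le_anti; rewrite (csn_ge0 cs) andbT.
have h := fun_calcD cnA (fun_calc_sum cnA (index_enum _) xpredT (fun i : 'I_n.+1 => TE i))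
  (fun_calcZ cnA (-1) (fun_calc_poly cnA b 1)).
move: h; rewrite peval1 rmorphN1 scaleN1r => h.
apply: (fun_calc_norm cnA sb b1 h) => t t1.
have /andP[s0 sn] := rescale_bounds n t1.
by rewrite (tent_sum1 s0 sn) hornerC mulN1r subrr normr0.
Qed.

Let sumiT : unorm nm (\sum_(i < n.+1) i%:R%:C *: T i - (n%:R / 2)%:C *: (uinj b + 1)) = 0.
Proof.
apply/le_anti; rewrite (csn_ge0 cs) andbT.
have h := fun_calcD cnA (fun_calc_sum cnA (index_enum _) xpredT
    (fun i : 'I_n.+1 => fun_calcZ cnA i%:R (TE i)))
  (fun_calcZ cnA (-1) (fun_calc_poly cnA b (n%:R / 2 *: ('X + 1)))).
move: h; rewrite pevalZ pevalD pevalX peval1 rmorphN1 scaleN1r => h.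
apply: (fun_calc_norm cnA sb b1 h) => t t1.
have /andP[s0 sn] := rescale_bounds n t1.
by rewrite (tent_sum_id s0 sn) hornerZ hornerD hornerX hornerC mulN1r subrr normr0.
Qed.

Let unorm_eq0_lft (u : U) x : unorm nm u = 0 -> uinj x = uinj a * u :> U -> x = 0.
Proof.
move=> u0 xE; apply: nm0; rewrite -(unorm_inj cnA) xE.
by apply: (le_trans (csnM cs _ _)); rewrite u0 mulr0.
Qed.

Let unorm_eq0_rgt (u : U) x : unorm nm u = 0 -> uinj x = u * uinj c :> U -> x = 0.
Proof.
move=> u0 xE; apply: nm0; rewrite -(unorm_inj cnA) xE.
by apply: (le_trans (csnM cs _ _)); rewrite u0 mul0r.
Qed.

Let sum_lft : \sum_(i < n.+1) lft i = a.
Proof.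
apply/eqP; rewrite -subr_eq0; apply/eqP/(unorm_eq0_lft sumT1).
by rewrite uinjB uinj_sum (eq_bigr _ (fun (i : 'I_n.+1) _ => lftE i)) mulrBr mulr1 mulr_sumr.
Qed.

Let sum_rgt : \sum_(i < n.+1) rgt i = c.
Proof.
apply/eqP; rewrite -subr_eq0; apply/eqP/(unorm_eq0_rgt sumT1).
by rewrite uinjB uinj_sum (eq_bigr _ (fun (i : 'I_n.+1) _ => rgtE i)) mulrBl mul1r mulr_suml.
Qed.

Let sumi_lft : \sum_(i < n.+1) i%:R%:C *: lft i = (n%:R / 2)%:C *: (a ** b + a).
Proof.
apply/eqP; rewrite -subr_eq0; apply/eqP/(unorm_eq0_lft sumiT).
rewrite uinjB uinj_sum mulrBr uinjZ -scalerAr uinjD uinjM mulrDr mulr1; congr (_ - _).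
by rewrite mulr_sumr; apply: eq_bigr => i _; rewrite uinjZ lftE scalerAr.
Qed.

Let sumi_rgt : \sum_(i < n.+1) i%:R%:C *: rgt i = (n%:R / 2)%:C *: (b ** c + c).
Proof.
apply/eqP; rewrite -subr_eq0; apply/eqP/(unorm_eq0_rgt sumiT).
rewrite uinjB uinj_sum mulrBl uinjZ -scalerAl uinjD uinjM mulrDl mul1r; congr (_ - _).
by rewrite mulr_suml; apply: eq_bigr => i _; rewrite uinjZ rgtE scalerAl.
Qed.

Let eps (r q : nat) : R := if (q.+1 == r %[mod 3])%N then 1
  else if (r.+1 == q %[mod 3])%N then -1 else 0.

(* Only the terms with [|i - j| <= 1] survive, and for these [i - j] only
   depends on the residues of [i] and [j] modulo 3. *)
Lemma balanced_defect_le :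
  (n%:R / 2) * N (V (a ** b) c - V a (b ** c)) <= 9 * (nm a * nm c).
Proof.
pose cl (i : 'I_n.+1) : 'I_3 := inord (i %% 3).
have clE i : cl i = (i %% 3)%N :> nat by rewrite inordK// ltn_pmod.
have E : (n%:R / 2)%:C *: (V (a ** b) c - V a (b ** c)) =
    \sum_(r < 3) \sum_(q < 3) (eps r q)%:C *:
      V (\sum_(i < n.+1 | cl i == r) lft i) (\sum_(j < n.+1 | cl j == q) rgt j).
  (* The sums weighted by [i] reproduce [n / 2 (b + 1)], as [rescale n t = n / 2 (t + 1)]; the
     contributions of the summand 1 cancel. *)
  transitivity (V (\sum_(i < n.+1) i%:R%:C *: lft i) (\sum_(j < n.+1) rgt j) -
      V (\sum_(i < n.+1) lft i) (\sum_(j < n.+1) j%:R%:C *: rgt j)).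
    rewrite sumi_lft sum_rgt sum_lft sumi_rgt VZl VZr -scalerBr VDl VDr.
    by rewrite opprD addrACA subrr addr0.
  transitivity (\sum_(i < n.+1) \sum_(j < n.+1) (eps (cl i) (cl j))%:C *: V (lft i) (rgt j)).
    rewrite !bilin_suml -sumrB; apply: eq_bigr => i _.
    rewrite !bilin_sumr -sumrB; apply: eq_bigr => j _.
    rewrite VZl VZr -scalerBl -rmorphB.
    have [ij|] := boolP ((i.+2 <= j)%N || (j.+2 <= i)%N).
      by rewrite (V0 (orth ij)) !scaler0.
    rewrite negb_or -!leqNgt => /andP[ij ji]; congr (_%:C *: _).
    rewrite /eps !clE.
    have [ijE|ijE] := eqVneq (nat_of_ord i) j.
      by rewrite ijE subrr !ifF//; lia.
    have [lij|lij] := ltnP i j.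
      have -> : nat_of_ord j = i.+1 by lia.
      by rewrite -natr1 ifF ?ifT; [ring | lia | lia].
    have -> : nat_of_ord i = j.+1 by lia.
    by rewrite -natr1 ifT; [ring | lia].
  rewrite (partition_big cl xpredT)//=; apply: eq_bigr => r _.
  transitivity (\sum_(i < n.+1 | cl i == r) \sum_(q < 3) \sum_(j < n.+1 | cl j == q)
      (eps r q)%:C *: V (lft i) (rgt j)).
    apply: eq_bigr => i /eqP <-; rewrite (partition_big cl xpredT)//=.
    by apply: eq_bigr => q _; apply: eq_bigr => j /eqP <-.
  rewrite exchange_big /=; apply: eq_bigr => q _.
  rewrite bilin_suml scaler_sumr; apply: eq_bigr => i _.
  by rewrite bilin_sumr scaler_sumr.
have -> : (n%:R / 2) * N (V (a ** b) c - V a (b ** c)) =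
    N ((n%:R / 2)%:C *: (V (a ** b) c - V a (b ** c))).
  by rewrite (cnZr cnD') ger0_norm// divr_ge0.
rewrite E; apply: (le_trans (cn_sum cnD' _ _ _)).
have h (r q : 'I_3) : N ((eps r q)%:C *: V (\sum_(i < n.+1 | cl i == r) lft i)
    (\sum_(j < n.+1 | cl j == q) rgt j)) <= nm a * nm c.
  rewrite (cnZr cnD').
  have e1 : `|eps r q| <= 1.
    by rewrite /eps; case: ifP => _; [|case: ifP => _]; rewrite ?normrN ?normr1 ?normr0.
  apply: (le_trans (ler_piMl (cn_ge0 cnD' _) e1)).
  apply: (le_trans (V_le _ _)).
  exact: (ler_pM (cn_ge0 cnA _) (cn_ge0 cnA _) (sum_lft_le _) (sum_rgt_le _)).
(* Nine pairs of residue classes, each contributing at most [nm a * nm c]. *)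
apply: (@le_trans _ _ (\sum_(r < 3) \sum_(q < 3) (nm a * nm c))).
  apply: ler_sum => r _; apply: (le_trans (cn_sum cnD' _ _ _)).
  by apply: ler_sum => q _; exact: h.
by rewrite !sumr_const !card_ord -mulrnA mulr_natl.
Qed.

End selfadjoint.

Lemma balanced_selfadjoint a b c : star b = b -> nm b <= 1 ->
  V (a ** b) c = V a (b ** c).
Proof.
move=> sb b1; apply/eqP; rewrite -subr_eq0; apply/eqP/(cn_eq0 cnD')/le_anti.
rewrite (cn_ge0 cnD') andbT; apply/ler_addgt0Pr => e e0; rewrite add0r.
(* With [n + 1] subdivisions the defect is at most [18 / (n + 1)] times [nm a * nm c]. *)
have [n hn] := exists_small_ratio (18 * (nm a * nm c)) e0.
have [T TE] := tent_family sb b1 (ltn0Sn n).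
have h := balanced_defect_le a c sb b1 (ltn0Sn n) TE.
apply: le_trans hn; rewrite ler_pdivlMr ?ltr0n//.
move: h; rewrite mulrAC ler_pdivrMr// mulrC => h; apply: (le_trans h).
by rewrite mulrAC -natrM.
Qed.

Lemma zero_product_balanced a b c : V (a ** b) c = V a (b ** c).
Proof.
have sa_case h : star h = h -> V (a ** h) c = V a (h ** c).
  move=> sh; pose t := nm h + 1; have t0 : 0 < t by rewrite ltr_wpDl// (cn_ge0 cnA).
  have hE : h = t%:C *: (t^-1%:C *: h).
    by rewrite scalerA -rmorphM divff ?gt_eqF// scale1r.
  rewrite hE smulZl smulZr VZl VZr; congr (_ *: _); apply: balanced_selfadjoint.
    by rewrite starZ conjc_real sh.
  by rewrite (cnZr cnA) gtr0_norm ?invr_gt0// ler_pdivrMl// mulr1 lerDl.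
have bE : b = 2^-1%:C *: ((b + star b) + (- 'i%C) *: ('i%C *: (b - star b))).
  rewrite scalerA mulNr -(expr2 'i%C) sqr_i opprK scale1r addrACA subrr addr0.
  rewrite (_ : b + b = 2%:C *: b); last by rewrite rmorph_nat scaler_nat mulr2n.
  by rewrite scalerA -rmorphM mulVf// scale1r.
rewrite bE smulZl smulZr VZl VZr smulDl smulDr VDl VDr; congr (_ *: (_ + _)).
  by apply: sa_case; rewrite starD starK addrC.
rewrite smulZl smulZr VZl VZr; congr (_ *: _); apply: sa_case.
by rewrite starZ starB starK conjci scaleNr -scalerN opprB.
Qed.

End zero_product.

Lemma cpc0_balanced (R : realType) (A B : localCStarType R) (psi : cpc0 A B) (a b c : A) :
  psi (a ** b) ** psi c = psi a ** psi (b ** c).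
Proof.
have cnMB := cstar_norm_Minf B; have cnA := cstar_norm_rnorm A.
apply: (zero_product_balanced cnA cnMB (V := fun x y => psi x ** psi y)).
- by move=> x y z; rewrite linearD smulDl.
- by move=> x y z; rewrite linearD smulDr.
- by move=> k x y; rewrite linearZ smulZl.
- by move=> k x y; rewrite linearZ smulZr.
- move=> x y; apply: (le_trans (cnM cnMB _ _)).
  apply: ler_pM; rewrite ?(cn_ge0 cnMB)//; exact: cpc0_contractive.
- by move=> x y xy; exact: cpc0_zero_product.
- exact: local_complete_around.
Qed.

(** * Compression of order zero maps *)

Section cutting.
Variables (R : realType) (A B : localCStarType R) (psi : cpc0 A B).
Implicit Types (a b f : A) (d p : Minf B).

Let cnA := cstar_norm_rnorm A.
Let cnMB := cstar_norm_Minf B.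
Let cs := cstar_seminorm_unitization cnMB.
Local Notation M := (@Minf_norm R B).
Local Notation UM := (unorm M).
Local Notation U := (unitization (Minf B) : algType R[i]).

Lemma cpc0_sa f : star f = f -> star (psi f) = psi f.
Proof. by move=> sf; rewrite -cpc0_star sf. Qed.

(** Formally [psi(b f) = pi(b) psi(f)] with a *-homomorphism [pi]. In its absence, the balanced
    identity gives [|psi(t f) y|^2 <= |psi(t^* t f) y| |psi(f) y|], and the power trick sharpens the
    crude bound. *)
Lemma cpc0_mul_le f (y : U) b : star f = f ->
  UM (uinj (psi (b ** f)) * y) <= rnorm b * UM (uinj (psi f) * y).
Proof.
move=> sf; rewrite [leRHS]mulrC.
refine (@norm_power_trick _ _ (fun _ => True) (fun b => star b ** b)
  (fun b => UM (uinj (psi (b ** f)) * y)) (@rnorm R A) (UM (uinj (psi f) * y))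
  (rnorm f * UM y) _ _ _ _ _ _ _ b Logic.I).
- by [].
- by move=> t; exact: (csn_ge0 cs).
- by move=> t; exact: (cn_ge0 cnA).
- exact: (csn_ge0 cs).
- move=> t _; apply: (le_trans (csnM cs _ _)).
  rewrite (unorm_inj cnMB) mulrAC; apply: ler_wpM2r; first exact: (csn_ge0 cs).
  apply: (le_trans (cpc0_contractive psi _)); rewrite mulrC; exact: (cnM cnA).
- move=> t _; rewrite -(csnC cs) mulrC.
  have -> : ustar (uinj (psi (t ** f)) * y) * (uinj (psi (t ** f)) * y) =
      ustar (uinj (psi ((star t ** t) ** f)) * y) * (uinj (psi f) * y).
    rewrite !(csM cs) -!mulrA; congr (_ * _); rewrite !mulrA; congr (_ * _).
    rewrite -!uinj_star -!uinjM -!cpc0_star; congr uinj.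
    by rewrite !starM starK sf smulA -cpc0_balanced.
  by apply: (le_trans (csnM cs _ _)); rewrite (csn_st cs).
- by move=> t _; rewrite (cnC cnA).
Qed.

(* Order zero structure: [psi = h pi] for a *-homomorphism [pi] commuting with
   [h], and [p] is an approximation of [pi f] inside the algebra, namely
   [p = psi (f ^ 2) psi f Q] with [psi f ^ 2 Q] close to [1] on [psi f]. *)
Lemma cpc0_cut f e : star f = f -> 0 < e ->
  exists p, forall a, M (star p ** psi a ** p - psi (f ** a ** f)) <= e * rnorm a.
Proof.
move=> sf e0; pose k := psi f; pose t := M k + 1.
have t0 : 0 < t by rewrite ltr_wpDl// (cn_ge0 cnMB).
have sk : star k = k by exact: cpc0_sa.
pose K : U := uinj k; have sK : ustar K = K by rewrite -uinj_star sk.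
pose h : U := (t^-1%:C *: K) * (t^-1%:C *: K).
have sh' : sa (@ustar R (Minf B)) (t^-1%:C *: K) by exact: (saZ cs).
have ph : cpos (@ustar R (Minf B)) UM h by exact: (cpos_sqr cs).
have k1 : UM (t^-1%:C *: K) <= 1.
  rewrite (csnZr cs) (unorm_inj cnMB) gtr0_norm ?invr_gt0//.
  by rewrite ler_pdivrMl// mulr1 lerDl.
have h1 : UM h <= 1.
  apply: (le_trans (csnM cs _ _)); rewrite -[leRHS]mulr1.
  exact: (ler_pM (csn_ge0 cs _) (csn_ge0 cs _) k1 k1).
(* Prepares the final error, three times [rnorm f * rnorm a] times the bound for [K G]: two parts
   from [G X (1 - G)] and one from [X G]. *)
have D0 : 0 < 3 * rnorm f + 1 by rewrite ltr_wpDl// mulr_ge0// (cn_ge0 cnA).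
have [n hn] := exists_small_ratio (2 * t ^+ 2) (exprn_gt0 2 (divr_gt0 e0 D0)).
pose G : U := peval h (ergodic_mean R n).
have sG : ustar G = G by apply: (sa_peval cs); exact: cpos_sa ph.
have G1 : UM G <= 1 by exact: (ergodic_mean_norm cs n ph h1).
have KG : UM (K * G) <= e / (3 * rnorm f + 1).
  rewrite -(@ler_pXn2r _ 2)// ?nnegrE ?(csn_ge0 cs)//; last by rewrite ltW// divr_gt0.
  rewrite -(csnC cs) (csM cs) sG sK.
  have -> : G * K * (K * G) = (t ^+ 2)%:C *: (G * (h * G)).
    have -> : h = (t ^- 2)%:C *: (K * K).
      by rewrite /h -scalerAl -scalerAr scalerA -rmorphM -exprVn expr2.
    rewrite -scalerAl -scalerAr scalerA -rmorphM divff ?expf_neq0 ?gt_eqF//.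
    by rewrite scale1r !mulrA.
  rewrite (csnZr cs) ger0_norm ?sqr_ge0//; apply: le_trans hn.
  rewrite [leRHS]mulrAC [leRHS]mulrC; apply: ler_wpM2l; first exact: sqr_ge0.
  apply: (le_trans (csnM cs _ _)); rewrite -[leRHS]mul1r.
  apply: (ler_pM (csn_ge0 cs _) (csn_ge0 cs _) G1).
  exact: (ergodic_mean_small cs n ph h1).
(* The mean has value 1 at 0, so [1 - G] is divisible by [h]; the quotient yields an approximate
   inverse [S] of [K^2]. *)
have [Q QE] : exists Q : {poly R}, 1 - ergodic_mean R n = Q * 'X.
  have : root (1 - ergodic_mean R n) 0.
    rewrite rootE hornerD hornerN hornerC /ergodic_mean hornerZ horner_sum.
    rewrite (eq_bigr (fun=> 1)) => [|j _]; last by rewrite !hornerE subr0 expr1n.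
    by rewrite sumr_const card_ord mulVf ?pnatr_eq0// subrr.
  by move/factor_theorem => [Q ->]; exists Q; rewrite subr0.
pose S : U := (t ^- 2)%:C *: peval h Q.
have sS : ustar S = S.
  by apply: (saZ cs); apply: (sa_peval cs); exact: cpos_sa ph.
have hE : h = (t ^- 2)%:C *: (K * K).
  by rewrite /h -scalerAl -scalerAr scalerA -rmorphM -exprVn expr2.
have SE : S * (K * K) = 1 - G.
  rewrite /S -scalerAl scalerAr -hE -{2}(pevalX h) -pevalM -QE.
  by rewrite pevalB peval1.
have SE' : K * K * S = 1 - G.
  rewrite /S -scalerAr scalerAl -hE -{1}(pevalX h) -pevalM mulrC -QE.
  by rewrite pevalB peval1.
pose P : U := uinj (psi (f ** f)) * K * S.
have PE : uinj P.2 = P by apply: uinj_snd; rewrite /= !mul0r.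
exists P.2 => a; rewrite -(unorm_inj cnMB) uinjB !uinjM uinj_star PE.
pose X : U := uinj (psi (f ** a ** f)).
have -> : ustar P * uinj (psi a) * P = (1 - G) * X * (1 - G).
  rewrite -{1}SE -{1}SE' /P !(csM cs) sS sK -uinj_star -cpc0_star starM sf.
  rewrite !mulrA; congr (_ * _ * _).
  (* The balanced identity, used on either side, moves one [f] from each outer factor into the
     middle. *)
  have E : psi (f ** f) ** psi a ** psi (f ** f) = k ** psi (f ** a ** f) ** k.
    rewrite /k [psi (f ** f) ** psi a]cpc0_balanced -[LHS]smulA -[RHS]smulA.
    by congr (_ ** _); rewrite -cpc0_balanced.
  have E' : uinj (psi (f ** f)) * uinj (psi a) * uinj (psi (f ** f)) = K * X * K.
    by rewrite -!uinjM E.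
  rewrite -!mulrA; congr (_ * (_ * _)).
  by move: E'; rewrite -!mulrA.
have XG b : UM (uinj (psi (f ** b ** f)) * G) <= rnorm f * rnorm b * (e / (3 * rnorm f + 1)).
  apply: (le_trans (cpc0_mul_le _ _ sf)).
  exact: (ler_pM (cn_ge0 cnA _) (csn_ge0 cs _) (cnM cnA _ _) KG).
have GX : UM (G * X) <= rnorm f * rnorm a * (e / (3 * rnorm f + 1)).
  rewrite -(csn_st cs) (csM cs) sG -uinj_star -cpc0_star !starM sf smulA.
  by apply: (le_trans (XG _)); rewrite (cn_star cnA).
have -> : (1 - G) * X * (1 - G) - X = - (G * X * (1 - G)) - X * G.
  by rewrite mulrBl mul1r mulrBl [X * (1 - G)]mulrBr mulr1 addrC !addrA addNr add0r addrC.
have E2 : UM (1 - G) <= 2.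
  rewrite (_ : 2 = 1 + 1 :> R)//; exact: (le_trans (csnB cs _ _) (lerD (csn1 cs) G1)).
have h3 : UM (G * X * (1 - G)) <= rnorm f * rnorm a * (e / (3 * rnorm f + 1)) * 2.
  exact: (le_trans (csnM cs _ _) (ler_pM (csn_ge0 cs _) (csn_ge0 cs _) GX E2)).
apply: (le_trans (csnB cs _ _)); rewrite (csnN cs).
apply: (le_trans (lerD h3 (XG a))).
rewrite [leLHS](_ : _ = e * rnorm a * (3 * rnorm f / (3 * rnorm f + 1))); last first.
  by field; rewrite gt_eqF.
apply: ler_piMr; first by rewrite mulr_ge0 ?(ltW e0)// (cn_ge0 cnA).
by rewrite ler_pdivrMr// mul1r lerDl.
Qed.

(** The map [a |-> d^* psi(f a f) d] behaves like a positive functional, whose norm is its value at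
    the unit, here [d^* psi(f f) d]. The Cauchy-Schwarz inequality for [t^* f] and [f] provides the
    squaring step of the power trick. *)
Lemma cpc0_compress_le f d a : star f = f ->
  M (star d ** psi (f ** a ** f) ** d) <= rnorm a * M (star d ** psi (f ** f) ** d).
Proof.
move=> sf; rewrite [leRHS]mulrC.
refine (@norm_power_trick _ _ (fun _ => True) (fun b => b ** star b)
  (fun b => M (star d ** psi (f ** b ** f) ** d)) (@rnorm R A)
  (M (star d ** psi (f ** f) ** d)) (M d * (rnorm f * rnorm f) * M d)
  _ _ _ _ _ _ _ a Logic.I).
- by [].
- by move=> t; exact: (cn_ge0 cnMB).
- by move=> t; exact: (cn_ge0 cnA).
- exact: (cn_ge0 cnMB).
- move=> t _.
  have h1 : M (psi (f ** t ** f)) <= rnorm f * rnorm t * rnorm f.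
    apply: (le_trans (cpc0_contractive psi _)); apply: (le_trans (cnM cnA _ _)).
    by apply: ler_wpM2r; [exact: (cn_ge0 cnA) | exact: (cnM cnA)].
  apply: (le_trans (cnM cnMB _ _)).
  rewrite [leRHS](_ : _ = M d * (rnorm f * rnorm t * rnorm f) * M d); last by ring.
  apply: ler_wpM2r; first exact: (cn_ge0 cnMB).
  apply: (le_trans (cnM cnMB _ _)); rewrite (cn_star cnMB).
  by apply: ler_wpM2l => //; exact: (cn_ge0 cnMB).
- move=> t _; have := cp_cauchy_schwarz psi (star t ** f) f d d.
  by rewrite starM starK sf !smulA mulrC.
- by move=> t _; rewrite -{1}(starK t) (cnC cnA) (cn_star cnA).
Qed.

End cutting.

(** * Cuntz comparison *)

Lemma cn_conj_sub_le (R : realType) (D : starAlgType R) (N : D -> R) (f x : D) :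
  cstar_norm N -> N (f ** x ** f - x) <= N f * N (x - x ** f) + N (x - f ** x).
Proof.
move=> cn; have -> : f ** x ** f - x = - (f ** (x - x ** f)) - (x - f ** x).
  by rewrite smulBr !opprB smulA addrA subrK.
apply: (le_trans (cnB cn _ _)); rewrite (cnN cn) lerD2r; exact: (cnM cn).
Qed.

Section cuntz_comparison.
Variables (R : realType) (A B : localCStarType R).
Implicit Types (phi psi chi : cpc0 A B).

Let cnA := cstar_norm_rnorm A.
Let cnMB := cstar_norm_Minf B.
Local Notation M := (@Minf_norm R B).

Lemma cuntz_leP phi psi : cuntz_le phi psi <->
  exists b : nat -> Minf B, forall a e, 0 < e -> exists n0, forall n, (n0 <= n)%N ->
    M (star (b n) ** psi a ** b n - phi a) <= e.
Proof.
split=> -[b hb]; exists b => a.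
  move=> e e0; have /cvgrPdist_le/(_ _ e0)[n0 _ hn] := hb a.
  exists n0 => n /hn /=; rewrite sub0r normrN ger0_norm//; exact: (cn_ge0 cnMB).
apply/cvgrPdist_le => e e0; have [n0 hn] := hb a e e0.
exists n0 => // n /= /hn; rewrite sub0r normrN ger0_norm//; exact: (cn_ge0 cnMB).
Qed.

Lemma eventually_all (T : eqType) (P : T -> nat -> Prop) (r : seq T) :
  (forall t, exists n0, forall n, (n0 <= n)%N -> P t n) ->
  exists n0, forall t, t \in r -> forall n, (n0 <= n)%N -> P t n.
Proof.
move=> h; elim: r => [|t r [n0 hn0]]; first by exists 0%N.
have [n1 hn1] := h t; exists (maxn n0 n1) => s; rewrite inE => /predU1P[->|sr] n.
  by rewrite geq_max => /andP[_ ?]; exact: hn1.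
by rewrite geq_max => /andP[? _]; exact: hn0.
Qed.

Lemma approx_unit_conj (r : seq A) e : 0 < e -> exists f : A,
  [/\ star f = f, rnorm f <= 2 & forall a, a \in r -> rnorm (f ** a ** f - a) <= e].
Proof.
move=> e0; have e30 : 0 < e / 3 by rewrite divr_gt0.
(* Adjoints are included so that [f] also approximates the unit from the right. *)
have [f [sf f2 _ hf]] := cn_approx_unit cnA (r ++ map star r) e30.
exists f; split=> // a ar.
have h1 : rnorm (a - f ** a) <= e / 3 by apply: hf; rewrite mem_cat ar.
have h2 : rnorm (a - a ** f) <= e / 3.
  rewrite -(cn_star cnA) starB starM sf; apply: hf.
  by rewrite mem_cat (map_f _ ar) orbT.
apply: (le_trans (cn_conj_sub_le f a cnA)).
have := ler_pM (cn_ge0 cnA _) (cn_ge0 cnA _) f2 h2; lra.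
Qed.

(* The approximation on finite sets can be made by elements [b] such that the
   maps [b^* psi b] are uniformly bounded, although [b] itself is not. *)
Lemma finite_approx_bounded phi psi (r : seq A) e : 0 < e -> e <= 1 ->
  (forall (r : seq A) e, 0 < e -> exists d : Minf B, forall a, a \in r ->
    M (star d ** psi a ** d - phi a) <= e) ->
  exists b : Minf B, (forall a, M (star b ** psi a ** b) <= 6 * rnorm a) /\
    forall a, a \in r -> M (star b ** psi a ** b - phi a) <= (rnorm a + 2) * e.
Proof.
move=> e0 e1 H; have [f [sf f2 hf]] := approx_unit_conj r e0.
(* Including [f ** f] bounds [d^* psi(f f) d] by [1 + 4], where 4 bounds [phi(f f)]; the error of
   cutting adds 1, whence the constant 6. *)
have [d hd] := H (f ** f :: [seq f ** a ** f | a <- r]) e e0.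
have D0 : 0 < M d * M d + 1 by rewrite ltr_wpDl// mulr_ge0// (cn_ge0 cnMB).
have [p hp] := cpc0_cut psi sf (divr_gt0 e0 D0); exists (p ** d).
have E a : star (p ** d) ** psi a ** (p ** d) =
    star d ** (star p ** psi a ** p - psi (f ** a ** f)) ** d +
    star d ** psi (f ** a ** f) ** d.
  by rewrite -smulDl -smulDr subrK starM !smulA.
have h1 a : M (star d ** (star p ** psi a ** p - psi (f ** a ** f)) ** d) <= e * rnorm a.
  apply: (le_trans (cnM cnMB _ _)).
  apply: (le_trans (ler_wpM2r (cn_ge0 cnMB _) (cnM cnMB _ _))).
  rewrite (cn_star cnMB) mulrAC.
  apply: (le_trans (ler_wpM2l (mulr_ge0 (cn_ge0 cnMB d) (cn_ge0 cnMB d)) (hp a))).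
  rewrite [leLHS](_ : _ = e * rnorm a * (M d * M d / (M d * M d + 1))); last first.
    by field; rewrite gt_eqF.
  apply: ler_piMr; first by rewrite mulr_ge0 ?(ltW e0)// (cn_ge0 cnA).
  by rewrite ler_pdivrMr// mul1r lerDl.
have hff : M (star d ** psi (f ** f) ** d) <= 5.
  have h := hd _ (mem_head _ _).
  have p4 : M (phi (f ** f)) <= 2 * 2.
    apply: (le_trans (cpc0_contractive phi _)); apply: (le_trans (cnM cnA _ _)).
    exact: (ler_pM (cn_ge0 cnA _) (cn_ge0 cnA _) f2 f2).
  rewrite -[star d ** _ ** d](subrK (phi (f ** f))).
  apply: (le_trans (cnD cnMB _ _)); apply: (le_trans (lerD (le_trans h e1) p4)).
  by rewrite -natrM -natr1 addrC natr1.
split=> a; first rewrite E.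
  apply: (le_trans (cnD cnMB _ _)).
  have h2 := le_trans (cpc0_compress_le psi d a sf) (ler_wpM2l (cn_ge0 cnA a) hff).
  apply: (le_trans (lerD (h1 a) h2)).
  rewrite -[6]/(1 + 5)%:R natrD mulrDl [rnorm a * 5]mulrC lerD2r.
  exact: (ler_wpM2r (cn_ge0 cnA a) e1).
move=> ar.
have h2 : M (star d ** psi (f ** a ** f) ** d - phi (f ** a ** f)) <= e.
  by apply: hd; rewrite inE; apply/orP; right; apply: map_f.
have h3 : M (phi (f ** a ** f - a)) <= e.
  exact: (le_trans (cpc0_contractive phi _) (hf a ar)).
have -> : star (p ** d) ** psi a ** (p ** d) - phi a =
    star d ** (star p ** psi a ** p - psi (f ** a ** f)) ** d +
    ((star d ** psi (f ** a ** f) ** d - phi (f ** a ** f)) + phi (f ** a ** f - a)).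
  by rewrite E linearB /= subrKA addrA.
rewrite (_ : (rnorm a + 2) * e = e * rnorm a + (e + e)); last by ring.
apply: (le_trans (cnD cnMB _ _)); apply: lerD; first exact: h1.
exact: (le_trans (cnD cnMB _ _) (lerD h2 h3)).
Qed.

(* Unlike [cuntz_le], this form is visibly transitive. *)
Lemma cuntz_le_finite phi psi : cuntz_le phi psi <->
  forall (r : seq A) e, 0 < e -> exists d : Minf B, forall a, a \in r ->
    M (star d ** psi a ** d - phi a) <= e.
Proof.
split.
  move=> /cuntz_leP[b hb] r e e0.
  have [n0 hn0] := @eventually_all A
    (fun a n => M (star (b n) ** psi a ** b n - phi a) <= e) r (fun a => hb a e e0).
  by exists (b n0) => a ar; exact: hn0.
move=> H; apply/cuntz_leP; have [u du] := dense_seq A.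
have inv_gt0 n : 0 < n.+1%:R^-1 :> R by rewrite invr_gt0.
have inv_le1 n : n.+1%:R^-1 <= 1 :> R by rewrite invf_le1// ler1n.
have /choice[b hb] : forall n, exists b : Minf B,
    (forall a, M (star b ** psi a ** b) <= 6 * rnorm a) /\
    forall a, a \in [seq u i | i <- iota 0 n] ->
      M (star b ** psi a ** b - phi a) <= (rnorm a + 2) * n.+1%:R^-1.
  by move=> n; exact: (finite_approx_bounded _ (inv_gt0 n) (inv_le1 n) H).
exists b => a e e0.
(* The budget is [6 e / 14 + e / 2 + e / 14 = e], the 6 being the uniform bound on the
   compressions. *)
have [i hi] := du a _ (divr_gt0 e0 (ltr0n R 14)).
have [m hm] := exists_small_ratio (rnorm (u i) + 2) (divr_gt0 e0 (ltr0n R 2)).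
exists (maxn i.+1 m) => n; rewrite geq_max => /andP[ni mn].
have [h6 hu] := hb n.
have h1 : M (star (b n) ** psi (a - u i) ** b n) <= 6 * (e / 14).
  by apply: (le_trans (h6 _)); rewrite ler_pM2l.
have h2 : M (star (b n) ** psi (u i) ** b n - phi (u i)) <= e / 2.
  apply: (le_trans (hu _ _)); first by apply: map_f; rewrite mem_iota.
  apply: le_trans hm; apply: ler_wpM2l; first by rewrite addr_ge0// (cn_ge0 cnA).
  by rewrite lef_pV2 ?posrE// ler_nat.
have h3 : M (phi (a - u i)) <= e / 14 by exact: (le_trans (cpc0_contractive phi _) hi).
have -> : star (b n) ** psi a ** b n - phi a =
    star (b n) ** psi (a - u i) ** b n +
    ((star (b n) ** psi (u i) ** b n - phi (u i)) - phi (a - u i)).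
  by rewrite (linearB psi) (linearB phi) smulBr smulBl opprB addrA subrKA addrA subrK.
apply: (le_trans (cnD cnMB _ _)).
apply: (le_trans (lerD h1 (le_trans (cnB cnMB _ _) (lerD h2 h3)))).
by rewrite le_eqVlt; apply/orP; left; apply/eqP; field.
Qed.

Lemma cuntz_le_trans psi phi chi : cuntz_le phi psi -> cuntz_le psi chi -> cuntz_le phi chi.
Proof.
move=> /cuntz_le_finite h1 /cuntz_le_finite h2; apply/cuntz_le_finite => r e e0.
have e20 : 0 < e / 2 by rewrite divr_gt0.
have [d hd] := h1 r _ e20.
(* The tolerance for [c] is fixed after [d], whose norm enters the error; this order of choice is
   what the finite form permits. *)
have D0 : 0 < M d * M d + 1 by rewrite ltr_wpDl// mulr_ge0// (cn_ge0 cnMB).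
have [c hc] := h2 r _ (divr_gt0 e20 D0); exists (c ** d) => a ar.
have -> : star (c ** d) ** chi a ** (c ** d) - phi a =
    star d ** (star c ** chi a ** c - psi a) ** d + (star d ** psi a ** d - phi a).
  by rewrite smulBr smulBl addrA subrK starM !smulA.
rewrite (splitr e); apply: (le_trans (cnD cnMB _ _)); apply: lerD; last exact: hd.
apply: (le_trans (cnM cnMB _ _)).
apply: (le_trans (ler_wpM2r (cn_ge0 cnMB _) (cnM cnMB _ _))).
rewrite (cn_star cnMB) mulrAC.
apply: (le_trans (ler_wpM2l (mulr_ge0 (cn_ge0 cnMB d) (cn_ge0 cnMB d)) (hc a ar))).
by rewrite mulrCA ler_piMr ?(ltW e20)// ler_pdivrMr// mul1r lerDl.
Qed.

End cuntz_comparison.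

(** * The monoid W(A, B) *)

Section relabelling.
Variables (R : realType) (A B : localCStarType R).
Implicit Types (phi psi : cpc0 A B).

Let cnBB := cstar_norm_rnorm B.
Local Notation M := (@Minf_norm R B).

Definition entry_at (x : Minf B) (i j : option nat) : B :=
  if i is Some k then if j is Some l then mx_of x k l else 0 else 0.

Section relabelling_matrix.
Variables (tau : nat -> option nat) (e : B) (n : nat).

(** Finite truncation of the operator sending the basis vector [i] to the basis vector [tau i], or
    to 0 if [tau i] is [None]. The element [e] of an approximate unit stands in for 1, since [B]
    need not have a unit. *)
Definition relabel_mx (k i : nat) : B :=
  if [&& (i < n)%N, (k < n)%N & tau i == Some k] then e else 0.

Lemma relabel_finite : exists m, in_corner m relabel_mx.
Proof.
exists n => i j /orP[h|h]; rewrite /relabel_mx ifF//; apply/negbTE.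
- by rewrite !negb_and -!leqNgt h orbT.
- by rewrite !negb_and -!leqNgt h.
Qed.

Definition relabel : Minf B := mk_Minf relabel_finite.

Lemma relabel_corner : in_corner n (mx_of relabel).
Proof.
move=> i j /orP[h|h]; rewrite /= /relabel_mx ifF//; apply/negbTE.
- by rewrite !negb_and -!leqNgt h orbT.
- by rewrite !negb_and -!leqNgt h.
Qed.

Lemma sum_relabel (F : nat -> B) (g : B -> B -> B) i :
  (forall y, g 0 y = 0) ->
  \sum_(k < n) g (relabel_mx k i) (F k) =
  if tau i is Some k then if (i < n)%N && (k < n)%N then g e (F k) else 0 else 0.
Proof.
move=> g0; case tE : (tau i) => [k0|]; last first.
  by rewrite big1// => k _; rewrite /relabel_mx tE !andbF g0.
case: ifP => [/andP[iltn kn]|h].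
  rewrite (bigD1 (Ordinal kn))//= big1 => [|k kk].
    by rewrite /relabel_mx iltn kn tE eqxx addr0.
  rewrite /relabel_mx tE ifF ?g0//; apply/negbTE; rewrite !negb_and.
  apply/orP; right; apply/orP; right; apply: contraNN kk => /eqP[kk].
  by apply/eqP/val_inj.
rewrite big1// => k _; rewrite /relabel_mx tE ifF ?g0//.
apply: contraFF h => /and3P[-> kn /eqP[->]] //.
Qed.

Lemma relabel_conj (x y : Minf B) K : (K <= n)%N ->
  in_corner K (mx_of x) -> in_corner K (mx_of y) ->
  (forall i j, mx_of y i j = entry_at x (tau i) (tau j)) ->
  forall i j, mx_of (star relabel ** x ** relabel) i j = star e ** mx_of y i j ** e.
Proof.
move=> Kn xK yK yE i j.
have sbn : in_corner n (mx_of (star relabel)).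
  move=> k l h; have -> : mx_of (star relabel) k l = star (mx_of relabel l k) by [].
  by rewrite relabel_corner ?star0// orbC.
rewrite [LHS](mx_mulE _ _ (or_intror relabel_corner)).
transitivity (\sum_(l < n) \sum_(k < n)
    (star (relabel_mx k i) ** mx_of x k l) ** relabel_mx l j).
  apply: eq_bigr => l _; rewrite [mx_of (star _ ** _) _ _](mx_mulE _ _ (or_introl sbn)).
  by rewrite smul_suml.
have g1 (s : B) : star (0 : B) ** s = 0 by rewrite star0 smul0r.
under eq_bigr => l _ do rewrite -smul_suml
  (sum_relabel (fun k => mx_of x k l) (g := fun u v => star u ** v) i g1).
have g2 (s : B) : s ** (0 : B) = 0 by exact: smulr0.
rewrite (sum_relabel (fun l => if tau i is Some k then
   if (i < n)%N && (k < n)%N then star e ** mx_of x k l else 0 else 0)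
   (g := fun u v => v ** u) j g2).
have yij := yE i j; rewrite yij; move: yij; rewrite /entry_at.
case tj : (tau j) => [l|]; case ti : (tau i) => [k|] yij;
  rewrite ?smulr0 ?smul0r//; last by case: ifP; rewrite ?smul0r.
(* If an index exceeds the truncation, the entry of [x] is 0: for [i] or [j] because it equals an
   entry of [y] outside its corner, for [k] or [l] because [K <= n]. *)
have [/and4P[-> -> -> ->]//|h] := boolP [&& (i < n)%N, (j < n)%N, (k < n)%N & (l < n)%N].
have -> : mx_of x k l = 0.
  move: h; rewrite !negb_and -!leqNgt => /or4P[h|h|h|h].
  - by rewrite -yij yK// (leq_trans Kn h).
  - by rewrite -yij yK// (leq_trans Kn h) orbT.
  - by rewrite xK// (leq_trans Kn h).
  - by rewrite xK// (leq_trans Kn h) orbT.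
by case: ifP => _; [case: ifP => _|]; rewrite ?smulr0 ?smul0r.
Qed.

End relabelling_matrix.

(** Common source of reflexivity and of the laws of direct sums, each a comparison along a map of
    indices. The corner containing [phi a] and [psi a] depends on [a], which the growing truncation
    absorbs; within a fixed corner, convergence is checked entry by entry. *)
Lemma cuntz_le_relabel phi psi (tau : nat -> option nat) :
  (forall a i j, mx_of (phi a) i j = entry_at (psi a) (tau i) (tau j)) ->
  cuntz_le phi psi.
Proof.
move=> tauE; have [f [sf [f2 fB]]] := approx_unit B.
apply/cuntz_leP; exists (fun n => relabel tau (f n) n) => a e e0.
have [K1 h1] := Minf_corner (phi a); have [K2 h2] := Minf_corner (psi a).
pose K := maxn K1 K2.
have phiK := in_cornerW (leq_maxl K1 K2) h1; have psiK := in_cornerW (leq_maxr K1 K2) h2.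
rewrite -/K in phiK psiK.
pose c : R := K%:R * K%:R + 1.
have c0 : 0 < c by rewrite ltr_wpDl// mulr_ge0.
have fBB (x : B) d : 0 < d -> exists n0, forall n, (n0 <= n)%N ->
    rnorm (star (f n) ** x ** f n - x) <= d.
  move=> d0; have d30 : 0 < d / 3 by rewrite divr_gt0.
  have [n1 hn1] := fB x _ d30; have [n2 hn2] := fB (star x) _ d30.
  exists (maxn n1 n2) => n; rewrite geq_max => /andP[g1 g2]; rewrite sf.
  have h3 : rnorm (x - x ** f n) <= d / 3.
    by rewrite -(cn_star cnBB) starB starM sf hn2.
  apply: (le_trans (cn_conj_sub_le _ _ cnBB)).
  have := ler_pM (cn_ge0 cnBB _) (cn_ge0 cnBB _) (f2 n) h3.
  by have := hn1 n g1; lra.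
have [n0 hn0] := @eventually_all ('I_K * 'I_K)%type
  (fun p n => rnorm (star (f n) ** mx_of (phi a) p.1 p.2 ** f n - mx_of (phi a) p.1 p.2) <= e / c)
  (enum {: 'I_K * 'I_K}) (fun p => fBB _ _ (divr_gt0 e0 c0)).
exists (maxn K n0) => n; rewrite geq_max => /andP[Kn n0n].
set X := star _ ** _ ** _.
have XE i j : mx_of (X - phi a) i j =
    star (f n) ** mx_of (phi a) i j ** f n - mx_of (phi a) i j.
  by rewrite -(relabel_conj (f n) Kn psiK phiK (tauE a)).
have X0 i j : (K <= i)%N || (K <= j)%N -> mx_of (X - phi a) i j = 0.
  by move=> h; rewrite XE phiK// smulr0 smul0r subrr.
apply: (le_trans (@Minf_norm_le_entries _ _ K _ (e / c) X0 _)).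
  move=> i j; have [/X0 ->|] := boolP ((K <= i)%N || (K <= j)%N).
    by rewrite (cn0 cnBB) divr_ge0// ltW.
  rewrite negb_or -!ltnNge => /andP[iK jK]; rewrite XE.
  exact: (hn0 (Ordinal iK, Ordinal jK) (mem_enum _ _) n n0n).
rewrite mulrA mulrCA ler_piMr ?(ltW e0)// ler_pdivrMr// mul1r lerDl.
exact: ler01.
Qed.

Lemma cuntz_le_refl phi : cuntz_le phi phi.
Proof. by apply: (@cuntz_le_relabel _ _ Some) => a i j. Qed.

End relabelling.

(** * Laws of the direct sum up to Cuntz equivalence *)

Section direct_sum_laws.
Variables (R : realType) (A B : localCStarType R).
Implicit Types (phi psi chi : cpc0 A B).

Let cnMB := cstar_norm_Minf B.
Local Notation M := (@Minf_norm R B).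

Lemma cuntz_le_dsum phi phi' psi psi' : cuntz_le phi phi' -> cuntz_le psi psi' ->
  cuntz_le (cpc0_dsum phi psi) (cpc0_dsum phi' psi').
Proof.
move=> /cuntz_leP[b hb] /cuntz_leP[c hc]; apply/cuntz_leP.
exists (fun n => Minf_dsum (b n) (c n)) => a e e0.
have e20 : 0 < e / 2 by rewrite divr_gt0.
have [n1 h1] := hb a _ e20; have [n2 h2] := hc a _ e20.
exists (maxn n1 n2) => n; rewrite geq_max => /andP[/h1 g1 /h2 g2].
rewrite [X in M (_ ** X ** _ - _)](_ : _ = Minf_dsum (phi' a) (psi' a))//.
rewrite [X in M (_ - X)](_ : _ = Minf_dsum (phi a) (psi a))//.
rewrite dsum_star -!dsumM -dsumB (splitr e).
exact: (le_trans (dsum_norm_leD _ _) (lerD g1 g2)).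
Qed.

Let dsumE' phi psi a i j : mx_of (cpc0_dsum phi psi a) i j =
  if odd i == odd j then mx_of (if odd i then psi a else phi a) i./2 j./2 else 0.
Proof. exact: dsumE. Qed.

Lemma cuntz_le_dsumC phi psi : cuntz_le (cpc0_dsum phi psi) (cpc0_dsum psi phi).
Proof.
apply: (@cuntz_le_relabel _ _ _ _ _ (fun i => Some (if odd i then i.-1 else i.+1))).
move=> a i j; rewrite /entry_at !dsumE'.
have flip k : odd (if odd k then k.-1 else k.+1) = ~~ odd k.
  by case: ifP => [|/negbT] ok; lia.
have half k : (if odd k then k.-1 else k.+1)./2 = k./2.
  by case: ifP => [|/negbT] ok; lia.
by rewrite !flip !half (inj_eq negb_inj); case: (odd i).
Qed.

Lemma cuntz_le_dsum0 phi : cuntz_le (cpc0_dsum (cpc0_zero A B) phi) phi.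
Proof.
apply: (@cuntz_le_relabel _ _ _ _ _ (fun i => if odd i then Some i./2 else None)).
move=> a i j; rewrite /entry_at dsumE'.
by case: (odd i); case: (odd j).
Qed.

Lemma cuntz_ge_dsum0 phi : cuntz_le phi (cpc0_dsum (cpc0_zero A B) phi).
Proof.
apply: (@cuntz_le_relabel _ _ _ _ _ (fun i => Some i.*2.+1)) => a i j.
by rewrite /entry_at dsumE' /= !odd_double /= !uphalf_double.
Qed.

Lemma cuntz_le_dsumA phi psi chi :
  cuntz_le (cpc0_dsum phi (cpc0_dsum psi chi)) (cpc0_dsum (cpc0_dsum phi psi) chi).
Proof.
(* In the interleaved numbering [phi], [psi], [chi] occupy the indices [2 k], [4 k + 1], [4 k + 3]
   in the left-hand sum, and [4 k], [4 k + 2], [2 k + 1] in the right-hand one. *)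
pose tau i := if odd i then if odd i./2 then i./2 else i.+1 else i.*2.
apply: (@cuntz_le_relabel _ _ _ _ _ (fun i => Some (tau i))) => a i j.
have tau_odd k : odd (tau k) = odd k && odd k./2.
  by case ok: (odd k); case ok2: (odd k./2); rewrite /tau ok ?ok2 /=; lia.
have tau_half k : odd k && odd k./2 -> (tau k)./2 = k./2./2.
  by case/andP=> ok ok2; rewrite /tau ok ok2; lia.
have tau_half_odd k : ~~ (odd k && odd k./2) -> odd (tau k)./2 = odd k.
  by case ok: (odd k); case ok2: (odd k./2) => // _; rewrite /tau ok ?ok2 /=; lia.
have tau_half2 k : ~~ (odd k && odd k./2) ->
    (tau k)./2./2 = if odd k then k./2./2 else k./2.
  by case ok: (odd k); case ok2: (odd k./2) => // _; rewrite /tau ok ?ok2 /=; lia.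
rewrite /entry_at !dsumE' !tau_odd.
have E1 := dsumE' psi chi a; have E2 := dsumE' phi psi a.
move: (cpc0_dsum psi chi a) (cpc0_dsum phi psi a) E1 E2 => D1 D2 E1 E2.
move: (tau_half i) (tau_half_odd i) (tau_half2 i).
move: (tau_half j) (tau_half_odd j) (tau_half2 j).
case oi: (odd i); case oi2: (odd i./2); case oj: (odd j); case oj2: (odd j./2);
  move=> a1 a2 a3 b1 b2 b3; rewrite /= ?E1 ?E2 ?oi2 ?oj2 //=;
  try rewrite (a1 isT); try rewrite (a2 isT) (a3 isT);
  try rewrite (b1 isT); try rewrite (b2 isT) (b3 isT); by [].
Qed.

(** Formal from the other inequality and commutativity: reversing the order of the summands
    exchanges the two bracketings. *)
Lemma cuntz_ge_dsumA phi psi chi :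
  cuntz_le (cpc0_dsum (cpc0_dsum phi psi) chi) (cpc0_dsum phi (cpc0_dsum psi chi)).
Proof.
apply: cuntz_le_trans (cuntz_le_dsumC _ _) _.
apply: cuntz_le_trans (cuntz_le_dsum (cuntz_le_refl chi) (cuntz_le_dsumC phi psi)) _.
apply: cuntz_le_trans (cuntz_le_dsumA _ _ _) _.
apply: cuntz_le_trans (cuntz_le_dsumC _ _) _.
exact: cuntz_le_dsum (cuntz_le_refl phi) (cuntz_le_dsumC _ _).
Qed.

End direct_sum_laws.

(** * Cuntz classes and functoriality *)

Section cuntz_classes.
Variables (R : realType) (B : localCStarType R).

Section monoid.
Variable A : localCStarType R.
Implicit Types (phi psi chi : cpc0 A B) (x y z : W A B).

(** Classes are sets of maps, so the operations go through chosen representatives; [W_leE], [W_addE]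
    and [W_compE] show independence of the choice. *)
Definition W_repr x : cpc0 A B := projT1 (cid (proj2_sig x)).

Lemma W_ext x y : proj1_sig x = proj1_sig y -> x = y.
Proof.
case: x y => [C hC] [C' hC'] /= CC'; move: hC; rewrite CC' => hC.
by rewrite (Prop_irrelevance hC hC').
Qed.

Lemma W_reprK x : W_cl (W_repr x) = x.
Proof. by apply: W_ext; rewrite /W_repr; case: (cid _). Qed.

Lemma W_clP phi psi : W_cl phi = W_cl psi <-> cuntz_eq phi psi.
Proof.
split=> [/(congr1 (@proj1_sig _ _)) /= E|[h1 h2]].
  have : W_class phi phi by split; exact: cuntz_le_refl.
  by rewrite E.
apply: W_ext; apply/seteqP; split=> chi [g1 g2].
- by split; [exact: cuntz_le_trans g1 h1 | exact: cuntz_le_trans h2 g2].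
- by split; [exact: cuntz_le_trans g1 h2 | exact: cuntz_le_trans h1 g2].
Qed.

Lemma W_repr_cl phi : cuntz_eq (W_repr (W_cl phi)) phi.
Proof. by apply/W_clP; rewrite W_reprK. Qed.

Definition W_le x y := cuntz_le (W_repr x) (W_repr y).

Definition W_add x y := W_cl (cpc0_dsum (W_repr x) (W_repr y)).

Lemma W_leE phi psi : W_le (W_cl phi) (W_cl psi) <-> cuntz_le phi psi.
Proof.
have [h1 h2] := W_repr_cl phi; have [h3 h4] := W_repr_cl psi.
split=> h; first exact: cuntz_le_trans h2 (cuntz_le_trans h h3).
exact: cuntz_le_trans h1 (cuntz_le_trans h h4).
Qed.

Lemma W_addE phi psi : W_add (W_cl phi) (W_cl psi) = W_cl (cpc0_dsum phi psi).
Proof.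
have [h1 h2] := W_repr_cl phi; have [h3 h4] := W_repr_cl psi.
by apply/W_clP; split; exact: cuntz_le_dsum.
Qed.

Lemma W_addA : associative W_add.
Proof.
move=> x y z; rewrite -(W_reprK x) -(W_reprK y) -(W_reprK z) !W_addE.
by apply/W_clP; split; [exact: cuntz_le_dsumA | exact: cuntz_ge_dsumA].
Qed.

Lemma W_addC : commutative W_add.
Proof.
by move=> x y; apply/W_clP; split; exact: cuntz_le_dsumC.
Qed.

Lemma W_add0 : left_id (W_cl (cpc0_zero A B)) W_add.
Proof.
move=> x; rewrite -(W_reprK x) W_addE; apply/W_clP; split.
  exact: cuntz_le_dsum0.
exact: cuntz_ge_dsum0.
Qed.

Lemma W_le_anti x y : W_le x y -> W_le y x -> x = y.
Proof. by move=> h1 h2; rewrite -(W_reprK x) -(W_reprK y); apply/W_clP. Qed.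

Lemma W_le_add x y z : W_le x y -> W_le (W_add x z) (W_add y z).
Proof. by move=> xy; apply/W_leE; apply: cuntz_le_dsum => //; exact: cuntz_le_refl. Qed.

Definition W_monoid : ordered_abelian_monoid (W A B) :=
  @OrderedAbelianMonoid _ (W_cl (cpc0_zero A B)) W_add W_le W_addA W_addC W_add0
    (fun x => cuntz_le_refl (W_repr x))
    (fun y x z => @cuntz_le_trans _ _ _ (W_repr y) (W_repr x) (W_repr z))
    W_le_anti W_le_add.

End monoid.

Section functoriality.
Variables (A A' : localCStarType R) (f : star_hom A A').
Implicit Types (phi psi : cpc0 A' B) (x y : W A' B).

Lemma cuntz_le_comp phi psi : cuntz_le phi psi ->
  cuntz_le (cpc0_comp f phi) (cpc0_comp f psi).
Proof. by move=> [b hb]; exists b => a; exact: hb (f a). Qed.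

Lemma cuntz_le_ext (phi psi : cpc0 A B) : (forall a, phi a = psi a) -> cuntz_le phi psi.
Proof.
move=> E; have [b hb] := cuntz_le_refl psi; exists b => a.
by have := hb a; rewrite -E.
Qed.

(** Maps built in different ways are bundled with different proofs and linear structures, so the
    functor laws are obtained from pointwise agreement at the level of classes. *)
Lemma W_cl_ext (phi psi : cpc0 A B) : (forall a, phi a = psi a) -> W_cl phi = W_cl psi.
Proof. by move=> E; apply/W_clP; split; apply: cuntz_le_ext. Qed.

Definition W_comp x : W A B := W_cl (cpc0_comp f (W_repr x)).

Lemma W_compE psi : W_comp (W_cl psi) = W_cl (cpc0_comp f psi).
Proof.
have [h1 h2] := W_repr_cl psi.
by apply/W_clP; split; exact: cuntz_le_comp.
Qed.

Lemma W_comp0 : W_comp (oam_zero (W_monoid A')) = oam_zero (W_monoid A).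
Proof. by rewrite /= W_compE; apply: W_cl_ext. Qed.

Lemma W_compD x y :
  W_comp (oam_add (W_monoid A') x y) = oam_add (W_monoid A) (W_comp x) (W_comp y).
Proof.
rewrite /= /W_add W_compE -[RHS]/(W_add _ _) W_addE.
exact: W_cl_ext.
Qed.

Lemma W_comp_le x y :
  oam_le (W_monoid A') x y -> oam_le (W_monoid A) (W_comp x) (W_comp y).
Proof. by move=> xy; apply/W_leE; exact: cuntz_le_comp. Qed.

Definition W_hom : oam_hom (W_monoid A') (W_monoid A) :=
  OamHom W_comp0 W_compD W_comp_le.

End functoriality.
End cuntz_classes.

Theorem proposition2p20 (R : realType) (B : localCStarType R) :
  exists (S : forall A : localCStarType R, ordered_abelian_monoid (W A B))
         (Wmap : forall A A' : localCStarType R,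
            star_hom A A' -> oam_hom (S A') (S A)),
    (* the order and the addition of W(A, B) are the prescribed ones *)
    (forall (A : localCStarType R) (phi psi : cpc0 A B),
       oam_le (S A) (W_cl phi) (W_cl psi) <-> cuntz_le phi psi) /\
    (forall (A : localCStarType R) (phi psi : cpc0 A B),
       exists2 chi : cpc0 A B,
         (forall a : A, chi a = Minf_dsum (phi a) (psi a)) &
         oam_add (S A) (W_cl phi) (W_cl psi) = W_cl chi) /\
    (* the induced map W(f, B) is [psi'] |-> [psi' o f] *)
    (forall (A A' : localCStarType R) (f : star_hom A A') (psi' : cpc0 A' B),
       exists2 chi : cpc0 A B,
         (forall a : A, chi a = psi' (f a)) &
         Wmap A A' f (W_cl psi') = W_cl chi) /\
    (* contravariant functoriality *)
    (forall (A : localCStarType R) (x : W A B),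
       Wmap A A (star_hom_id A) x = x) /\
    (forall (A A' A'' : localCStarType R)
       (f : star_hom A A') (g : star_hom A' A'') (x : W A'' B),
       Wmap A A'' (star_hom_comp g f) x = Wmap A A' f (Wmap A' A'' g x)).
Proof.
exists (W_monoid B), (fun A A' f => W_hom B f); split; [|split; [|split; [|split]]].
- by move=> A phi psi; exact: W_leE.
- by move=> A phi psi; exists (cpc0_dsum phi psi) => //; exact: W_addE.
- by move=> A A' f psi; exists (cpc0_comp f psi) => //; exact: W_compE.
- by move=> A x; rewrite -[RHS]W_reprK; exact: W_cl_ext.
- move=> A A' A'' f g x; rewrite -(W_reprK x) /=.
  by rewrite !W_compE; exact: W_cl_ext.
Qed.
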